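(* Let $g,h\in S_0(\mathbb{R})$ with $\langle g,h\rangle=1$ and let $b_0,\nu_0>0$ be such that there exist constants $0<A\le B<\infty$ with $$A\le\mathcal{U}(t,\xi)\le B\quad\text{for a.e. }(t,\xi)\in[0,\nu_0^{-1}[\times[0,b_0^{-1}[,\qquad \mathcal{U}(t,\xi)=\sum_{k,\ell\in\mathbb{Z}}\left|\mathcal{V}_gh\left(t+\tfrac{k}{\nu_0},\xi+\tfrac{\ell}{b_0}\right)\right|^2 .$$ Let $H$ be a Hilbert-Schmidt operator on $\mathbf{L}^2(\mathbb{R})$ with spreading function $\eta_H$. Then the best approximation of $H$, in Hilbert-Schmidt norm, by a Gabor multiplier $\mathbb{M}^G_{\mathbf{m};g,h}$ with lattice constants $b_0,\nu_0$ is the one whose time-frequency transfer function $\mathbf{m}$ has discrete symplectic Fourier transform $$\mathcal{M}(b,\nu)=\frac{\sum_{k,\ell\in\mathbb{Z}}\overline{\mathcal{V}_gh}\left(b+k/\nu_0,\nu+\ell/b_0\right)\,\eta_H\left(b+k/\nu_0,\nu+\ell/b_0\right)}{\sum_{k,\ell\in\mathbb{Z}}\left|\mathcal{V}_gh\left(b+k/\nu_0,\nu+\ell/b_0\right)\right|^2}\quad\text{for a.e. }(b,\nu).$$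
   Context: Notation: $T_bf(t)=f(t-b)$, $M_\nu f(t)=e^{2i\pi\nu t}f(t)$, $\pi(b,\nu)=M_\nu T_b$, $\mathcal{V}_gf(b,\nu)=\langle f,\pi(b,\nu)g\rangle$ (antilinear in the second slot). $S_0(\mathbb{R})=\{f\in\mathbf{L}^2(\mathbb{R}):\|\mathcal{V}_\varphi f\|_{\mathbf{L}^1(\mathbb{R}^2)}<\infty\}$ ($\varphi\neq0$ a fixed Schwartz function). Gabor multiplier: $\mathbb{M}^G_{\mathbf{m};g,h}f=\sum_{m,n\in\mathbb{Z}}\mathbf{m}(m,n)\mathcal{V}_gf(mb_0,n\nu_0)\,\pi(mb_0,n\nu_0)h$, here with $\mathbf{m}\in\ell^2(\mathbb{Z}^2)$ (so that it is Hilbert-Schmidt). Discrete symplectic Fourier transform of $\mathbf{m}$: $\mathcal{M}(t,\xi)=\sum_{m,n\in\mathbb{Z}}\mathbf{m}(m,n)e^{2i\pi(n\nu_0t-mb_0\xi)}$, a $(\nu_0^{-1},b_0^{-1})$-periodic function. The spreading function of a Hilbert-Schmidt operator $H$ with integral kernel $\kappa_H$ is $\eta_H(b,\nu)=\int\kappa_H(t,t-b)e^{-2i\pi\nu t}dt\in\mathbf{L}^2(\mathbb{R}^2)$; $H\mapsto\eta_H$ is isometric from Hilbert-Schmidt operators to $\mathbf{L}^2(\mathbb{R}^2)$. *)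

(* Defs.v *)
From HB Require Import structures.
From mathcomp Require Import all_boot all_order all_algebra finmap.
From mathcomp Require Import complex.
From mathcomp Require Import all_classical all_reals all_analysis.

(* Elements of L^2 are represented by Borel functions with values in R[i];
   equality in L^2 is equality a.e. *)

Set Implicit Arguments.
Unset Strict Implicit.
Unset Printing Implicit Defensive.

Import Order.TTheory GRing.Theory Num.Theory.
Import numFieldTopology.Exports numFieldNormedType.Exports.

Local Open Scope classical_set_scope.
Local Open Scope ring_scope.
Local Open Scope complex_scope.

Definition cmod (T : Type) (R : realType) (f : T -> R[i]) : T -> \bar R :=
  fun x => (Normc.normc (f x))%:E.

Section ComplexIntegration.
Context d (T : measurableType d) (R : realType).
Variable mu : {measure set T -> \bar R}.
Implicit Types f g : T -> R[i].

Definition cmeasurable f : Prop :=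
  measurable_fun setT (fun x => complex.Re (f x)) /\
  measurable_fun setT (fun x => complex.Im (f x)).

Definition cint f : R[i] :=
  Rintegral mu setT (fun x => complex.Re (f x)) +i*
  Rintegral mu setT (fun x => complex.Im (f x)).

Definition L2norm f : \bar R := 'N[mu]_2%:E[cmod f].

Definition L2 f : Prop := cmeasurable f /\ (L2norm f < +oo)%E.

Definition inner f g : R[i] := cint (fun x => f x * conjc (g x)).

End ComplexIntegration.

Section UnconditionalSums.

(* [s] is the sum of the family [u], the convergence being that of the net of
   finite partial sums for the extended (semi)norm [N]. *)
Definition sums_to (R : realType) (I : choiceType) (V : zmodType)
    (N : V -> \bar R) (u : I -> V) (s : V) : Prop :=
  forall eps : R, 0 < eps ->
    exists F0 : {fset I}, forall F : {fset I}, fsubset F0 F ->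
      (N (s - \sum_(i <- enum_fset F) u i)%R < eps%:E)%E.

(* The following sums are total functions, equal to 0 if the series diverges. *)

Definition csum (R : realType) (I : choiceType) (u : I -> R[i]) : R[i] :=
  xget 0 [set s | sums_to (fun z => (Normc.normc z)%:E) u s].

Definition L2sum d (T : measurableType d) (R : realType)
    (mu : {measure set T -> \bar R}) (I : choiceType) (u : I -> T -> R[i]) :
    T -> R[i] :=
  xget 0 [set s | L2 mu s /\ sums_to (L2norm mu) u s].

End UnconditionalSums.

Section TimeFrequency.
Context {R : realType}.
Implicit Types f g h : R -> R[i].

Definition leb : {measure set (measurableTypeR R) -> \bar R} :=
  lebesgue_measure.
Definition leb2 :
    {measure set (measurableTypeR R * measurableTypeR R) -> \bar R} :=
  (@lebesgue_measure R \x @lebesgue_measure R)%E.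

(* e^{ix} *)
Definition expi (x : R) : R[i] := cos x +i* sin x.

Definition translation (b : R) f : R -> R[i] := fun t => f (t - b).

Definition modulation (nu : R) f : R -> R[i] :=
  fun t => expi (2 * pi * nu * t) * f t.

Definition tfshift (z : R * R) f : R -> R[i] := modulation z.2 (translation z.1 f).

Definition stft g f : R * R -> R[i] := fun z => inner leb f (tfshift z g).

Definition rschwartz (f : R -> R) : Prop :=
  (forall n x, derivable (derive1n n f) x 1) /\
  (forall m n, exists C : R, forall x, `|x| ^+ m * `|derive1n n f x| <= C).

Definition schwartz f : Prop :=
  rschwartz (fun x => complex.Re (f x)) /\ rschwartz (fun x => complex.Im (f x)).

Definition S0 (phi : R -> R[i]) f : Prop :=
  L2 leb f /\ ('N[leb2]_1[cmod (stft phi f)] < +oo)%E.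

End TimeFrequency.

Section HilbertSchmidt.
Context {R : realType}.
Implicit Types (H : (R -> R[i]) -> (R -> R[i])) (f g : R -> R[i]).

Definition bounded_operator H : Prop :=
  [/\ forall f, L2 leb f -> L2 leb (H f),
      forall (a : R[i]) f g, L2 leb f -> L2 leb g ->
        {ae leb, forall t, H (fun x => a * f x + g x) t = a * H f t + H g t} &
      exists C : R, forall f, L2 leb f ->
        (L2norm leb (H f) <= C%:E * L2norm leb f)%E].

Definition orthonormal_basis (e : nat -> R -> R[i]) : Prop :=
  [/\ forall n, L2 leb (e n),
      forall i j, inner leb (e i) (e j) = (i == j)%:R &
      forall f, L2 leb f ->
        L2norm leb (f - \sum_(i < N) (fun x => inner leb f (e i) * e i x))
          @[N --> \oo] --> (0 : \bar R)].

(* The Hilbert-Schmidt norm, computed in an orthonormal basis [e], on which its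
   value does not depend. *)
Definition HSnorm (e : nat -> R -> R[i]) H : \bar R :=
  ((\sum_(0 <= n <oo) (L2norm leb (H (e n))) `^ 2) `^ 2^-1)%E.

Definition hilbert_schmidt (e : nat -> R -> R[i]) H : Prop :=
  bounded_operator H /\ (HSnorm e H < +oo)%E.

Definition integral_kernel H (kappa : R * R -> R[i]) : Prop :=
  L2 leb2 kappa /\
  forall f, L2 leb f ->
    {ae leb, forall t, H f t = cint leb (fun s => kappa (t, s) * f s)}.

(* For an L^2 kernel, the integral over t defining the spreading function is a
   Fourier-Plancherel integral: it is the limit in L^2(R^2) of the integrals
   over [-r, r]. *)
Definition truncated_spreading (kappa : R * R -> R[i]) (r : R) : R * R -> R[i] :=
  fun z => cint leb (fun t => (\1_(`[- r, r]%classic) t)%:C *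
    (kappa (t, t - z.1) * expi (- (2 * pi * z.2 * t)))).

Definition spreading_function H (eta : R * R -> R[i]) : Prop :=
  L2 leb2 eta /\
  exists2 kappa, integral_kernel H kappa &
    L2norm leb2 (eta - truncated_spreading kappa r) @[r --> +oo]
      --> (0 : \bar R).

End HilbertSchmidt.

Section GaborMultipliers.
Context {R : realType}.
Variables b0 nu0 : R.
Implicit Types (g h : R -> R[i]) (m : int * int -> R[i]).

Definition ell2 m : Prop :=
  (\esum_(p in [set: int * int]) ((Normc.normc (m p)) ^+ 2)%:E < +oo)%E.

Definition lattice_point (p : int * int) : R * R := (p.1%:~R * b0, p.2%:~R * nu0).

Definition gabor_multiplier g h m : (R -> R[i]) -> (R -> R[i]) :=
  fun f => L2sum leb (fun (p : int * int) t =>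
    m p * stft g f (lattice_point p) * tfshift (lattice_point p) h t).

Definition cell : set (R * R) := `[0, nu0^-1[%classic `*` `[0, b0^-1[%classic.

Definition cell_periodic (F : R * R -> R[i]) : Prop :=
  forall t xi, F (t + nu0^-1, xi) = F (t, xi) /\ F (t, xi + b0^-1) = F (t, xi).

Definition cell_L2norm (F : R * R -> R[i]) : \bar R :=
  'N[leb2]_2%:E[cmod F \_ cell].

(* For [m] in l^2(Z^2) the series converges in L^2 of the period cell; its sum
   is extended by periodicity. *)
Definition dsft m : R * R -> R[i] :=
  xget 0 [set F | [/\
    @cmeasurable _ (measurableTypeR R * measurableTypeR R)%type R F,
    cell_periodic F &
    sums_to cell_L2norm (fun (p : int * int) z =>
      m p * expi (2 * pi * (p.2%:~R * nu0 * z.1 - p.1%:~R * b0 * z.2))) F]].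

Definition dual_shift (z : R * R) (p : int * int) : R * R :=
  (z.1 + p.1%:~R / nu0, z.2 + p.2%:~R / b0).

Definition periodized_sqr g h (z : R * R) : \bar R :=
  \esum_(p in [set: int * int])
    ((Normc.normc (stft g h (dual_shift z p))) ^+ 2)%:E.

Definition optimal_dsft g h (eta : R * R -> R[i]) (z : R * R) : R[i] :=
  csum (fun p : int * int =>
    conjc (stft g h (dual_shift z p)) * eta (dual_shift z p))
  / (fine (periodized_sqr g h z))%:C.

Definition best_gabor_approximation (e : nat -> R -> R[i]) g h
    (H : (R -> R[i]) -> (R -> R[i])) m : Prop :=
  ell2 m /\
  forall m', ell2 m' ->
    (HSnorm e (H - gabor_multiplier g h m)%R
       <= HSnorm e (H - gabor_multiplier g h m')%R)%E.

End GaborMultipliers.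

(* Main.v *)
Require Import Defs.
From HB Require Import structures.
From mathcomp Require Import all_boot all_order all_algebra finmap.
From mathcomp Require Import complex.
From mathcomp Require Import all_classical all_reals all_analysis.
From mathcomp Require Import measurable_realfun ring lra.

(** The problem decouples on the side of spreading functions.

    The Hilbert-Schmidt norm of an operator is the L^2 norm of its kernel
    ([HSnorm_kernel]), and kernels are mapped isometrically to spreading functions:
    at a fixed shift, the spreading function is the Fourier transform of a slice of
    the kernel, so that Plancherel's theorem applies to almost every slice
    ([N2_spr]). The limit in the definition of the spreading function is dealt with
    by pairing it with kernels for which no limit is needed ([inner_spreading]).

    A Gabor multiplier with symbol [m] has the kernel [\sum_p m p * k_p], where [k_p]
    is the rank one kernel made of the windows [g] and [h] shifted to the
    [p]-th lattice point. A time-frequency shift of both windows multiplies the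
    spreading function by an exponential ([spr_rank1]), hence the spreading function
    of the multiplier is [M * V], where [V] is the transform V_g h and [M] is the
    discrete symplectic Fourier transform of [m]. As [M] is an arbitrary periodic
    function, square integrable on the cell, minimizing the norm of [eta - M * V] is
    a least squares problem at each point of the cell.

    This is carried out by normal equations ([normal_equations]): the residual is
    orthogonal to each [k_p]. The plane is tiled by translates of the cell
    ([plane_tiling]), and folding the integral over the plane onto the cell
    ([inner_planeexp]) turns these equations into the vanishing of all Fourier
    coefficients, on the cell, of the periodization of [conj V * (eta - M * V)].
    Since the exponentials are total ([cellexp_total]), they say that
    [M * U = \sum conj V * eta] almost everywhere, where [U] is the periodization
    of [|V|^2] ([residual_orth]). The upper bound of [U] makes the multipliers with
    square summable symbol well defined ([weighted_expands]). The lower bound allows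
    the division by [U], with a square integrable quotient: hence existence
    ([optimal_exists]) and uniqueness ([optimal_unique]).

    Three tools support this. Sums over a lattice are integrals against the counting
    measure ([psum]), so that periodization is Tonelli's and Fubini's theorems.
    Totality of the exponentials ([fourier_unique]) comes from trigonometric
    polynomials that tend boundedly to the indicator of an interval: if all Fourier
    coefficients of an integrable function vanish, so do its integrals over
    intervals. Plancherel's theorem ([plancherel]) comes from two uses of Parseval's
    identity for Fourier series, one in each variable of the Zak transform. *)

Set Implicit Arguments.
Unset Strict Implicit.
Unset Printing Implicit Defensive.

Import Order.TTheory GRing.Theory Num.Theory.
Import numFieldTopology.Exports numFieldNormedType.Exports.

Local Open Scope classical_set_scope.
Local Open Scope ring_scope.
Local Open Scope complex_scope.

Local Notation mod := Normc.normc.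

(** * Complex numbers *)

Section ComplexNumbers.
Context {R : realType}.
Implicit Types (x y z : R[i]) (a b t : R).

Lemma cReD x y : complex.Re (x + y) = complex.Re x + complex.Re y.
Proof. by case: x y => [? ?] [? ?]. Qed.

Lemma cImD x y : complex.Im (x + y) = complex.Im x + complex.Im y.
Proof. by case: x y => [? ?] [? ?]. Qed.

Lemma cReN x : complex.Re (- x) = - complex.Re x.
Proof. by case: x. Qed.

Lemma cImN x : complex.Im (- x) = - complex.Im x.
Proof. by case: x. Qed.

Lemma cReM x y : complex.Re (x * y) =
  complex.Re x * complex.Re y - complex.Im x * complex.Im y.
Proof. by case: x y => [? ?] [? ?]. Qed.

Lemma cImM x y : complex.Im (x * y) =
  complex.Re x * complex.Im y + complex.Im x * complex.Re y.
Proof. by case: x y => [? ?] [? ?]. Qed.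

Lemma cReMr x a : complex.Re (x * a%:C) = complex.Re x * a.
Proof. by case: x => ? ? /=; rewrite mulr0 subr0. Qed.

Lemma cImMr x a : complex.Im (x * a%:C) = complex.Im x * a.
Proof. by case: x => ? ? /=; rewrite mulr0 add0r. Qed.

Lemma cReJ x : complex.Re (conjc x) = complex.Re x.
Proof. by case: x. Qed.

Lemma cImJ x : complex.Im (conjc x) = - complex.Im x.
Proof. by case: x. Qed.

Lemma complex_eq x y :
  complex.Re x = complex.Re y -> complex.Im x = complex.Im y -> x = y.
Proof. by case: x y => [? ?] [? ?] /= -> ->. Qed.

Lemma conjcD x y : conjc (x + y) = conjc x + conjc y.
Proof. exact: rmorphD. Qed.

Lemma conjcM x y : conjc (x * y) = conjc x * conjc y.
Proof. exact: rmorphM. Qed.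

Lemma conjcN x : conjc (- x) = - conjc x.
Proof. exact: rmorphN. Qed.

Lemma mod_sqr x : mod x ^+ 2 = complex.Re x ^+ 2 + complex.Im x ^+ 2.
Proof. by case: x => a b /=; rewrite sqr_sqrtr// addr_ge0 ?sqr_ge0. Qed.

Lemma mod_ge0 x : 0 <= mod x.
Proof. by case: x => a b; rewrite sqrtr_ge0. Qed.

Lemma mod0 : mod (0 : R[i]) = 0.
Proof. exact: Normc.normc0. Qed.

Lemma mod1 : mod (1 : R[i]) = 1.
Proof. exact: Normc.normc1. Qed.

Lemma modM x y : mod (x * y) = mod x * mod y.
Proof. exact: Normc.normcM. Qed.

Lemma modD x y : mod (x + y) <= mod x + mod y.
Proof. exact: le_normcD. Qed.

Lemma modN x : mod (- x) = mod x.
Proof. exact: normcN. Qed.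

Lemma modJ x : mod (conjc x) = mod x.
Proof. by case: x => a b /=; rewrite sqrrN. Qed.

Lemma modR a : mod a%:C = `|a|.
Proof. by rewrite /= expr0n addr0 sqrtr_sqr. Qed.

Lemma realC_neq0 a : a != 0 -> a%:C != 0.
Proof. by move=> a0; rewrite eq_complex /= negb_and a0. Qed.

Lemma mod_eq0 x : mod x = 0 -> x = 0.
Proof. exact: Normc.eq0_normc. Qed.

Lemma mulcJ x : x * conjc x = (mod x ^+ 2)%:C.
Proof.
rewrite mod_sqr; case: x => a b; apply: complex_eq => /=; ring.
Qed.

Lemma ler_Re_mod x : `|complex.Re x| <= mod x.
Proof.
rewrite -(ler_pXn2r (n := 2)) ?nnegrE ?mod_ge0// mod_sqr real_normK ?num_real//.
by rewrite lerDl sqr_ge0.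
Qed.

Lemma ler_Im_mod x : `|complex.Im x| <= mod x.
Proof.
rewrite -(ler_pXn2r (n := 2)) ?nnegrE ?mod_ge0// mod_sqr real_normK ?num_real//.
by rewrite lerDr sqr_ge0.
Qed.

Lemma mod_le_ReIm x : mod x <= `|complex.Re x| + `|complex.Im x|.
Proof.
rewrite -(ler_pXn2r (n := 2)) ?nnegrE ?mod_ge0 ?addr_ge0// mod_sqr.
rewrite -[in leLHS]real_normK ?num_real// -[X in _ + X <= _]real_normK ?num_real//.
have := mulr_ge0 (normr_ge0 (complex.Re x)) (normr_ge0 (complex.Im x)); nra.
Qed.

Lemma mod_sqrD x y : mod (x + y) ^+ 2 <= 2 * mod x ^+ 2 + 2 * mod y ^+ 2.
Proof.
rewrite !mod_sqr cReD cImD.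
set a := complex.Re x; set b := complex.Im x.
set c := complex.Re y; set d := complex.Im y.
have := sqr_ge0 (a - c); have := sqr_ge0 (b - d); lra.
Qed.

Lemma mod_sqrM x y : mod (x * conjc y) <= mod x ^+ 2 + mod y ^+ 2.
Proof.
rewrite modM modJ; have := sqr_ge0 (mod x - mod y).
have := mulr_ge0 (mod_ge0 x) (mod_ge0 y); nra.
Qed.

Lemma expiD a b : expi (a + b) = expi a * expi b.
Proof. by rewrite /expi; apply: complex_eq => /=; rewrite ?cosD ?sinD; ring. Qed.

Lemma expi0 : expi (0 : R) = 1.
Proof. by rewrite /expi cos0 sin0. Qed.

Lemma conjc_expi a : conjc (expi a) = expi (- a).
Proof. by rewrite /expi /= cosN sinN. Qed.

Lemma mod_expi a : mod (expi a) = 1.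
Proof. by rewrite /= cos2Dsin2 sqrtr1. Qed.

Lemma expi_int (k : int) : expi (2 * pi * k%:~R : R) = 1.
Proof.
have nat_case (n : nat) : expi (2 * pi * n%:R : R) = 1.
  elim: n => [|n IH]; first by rewrite mulr0 expi0.
  rewrite -[n.+1%:R]natr1 mulrDr expiD IH mul1r mulr1 /expi.
  by rewrite mulrC mulr_natr cos2pi sin2pi.
case: k => n; first exact: nat_case.
by rewrite NegzE mulrNz mulrN -conjc_expi nat_case conjc1.
Qed.

End ComplexNumbers.

(** * Measurable and integrable complex functions *)

Section ComplexMeasurable.
Context d (T : measurableType d) (R : realType).
Implicit Types (f g : T -> R[i]).

Lemma cmeasurable_cst (c : R[i]) : cmeasurable (fun _ : T => c).
Proof. by split; apply: measurable_cst. Qed.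

Lemma cmeasurableD f g : cmeasurable f -> cmeasurable g ->
  cmeasurable (fun x => f x + g x).
Proof.
move=> [f1 f2] [g1 g2]; split.
- by under eq_fun do rewrite cReD; apply: measurable_funD.
- by under eq_fun do rewrite cImD; apply: measurable_funD.
Qed.

Lemma cmeasurableN f : cmeasurable f -> cmeasurable (fun x => - f x).
Proof.
move=> [f1 f2]; split.
- by under eq_fun do rewrite cReN; apply: measurable_funN.
- by under eq_fun do rewrite cImN; apply: measurable_funN.
Qed.

Lemma cmeasurableB f g : cmeasurable f -> cmeasurable g ->
  cmeasurable (fun x => f x - g x).
Proof. by move=> mf mg; apply: cmeasurableD => //; exact: cmeasurableN. Qed.

Lemma cmeasurableM f g : cmeasurable f -> cmeasurable g ->
  cmeasurable (fun x => f x * g x).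
Proof.
move=> [f1 f2] [g1 g2]; split.
- under eq_fun do rewrite cReM.
  by apply: measurable_funB; apply: measurable_funM.
- under eq_fun do rewrite cImM.
  by apply: measurable_funD; apply: measurable_funM.
Qed.

Lemma cmeasurableJ f : cmeasurable f -> cmeasurable (fun x => conjc (f x)).
Proof.
move=> [f1 f2]; split; first by under eq_fun do rewrite cReJ.
by under eq_fun do rewrite cImJ; apply: measurable_funN.
Qed.

Lemma cmeasurableZ (c : R[i]) f : cmeasurable f -> cmeasurable (fun x => c * f x).
Proof. by move=> mf; apply: cmeasurableM => //; exact: cmeasurable_cst. Qed.

Lemma cmeasurable_real (r : T -> R) : measurable_fun setT r ->
  cmeasurable (fun x => (r x)%:C).
Proof. by move=> mr; split => //=; apply: measurable_cst. Qed.

Lemma cmeasurable_expi (r : T -> R) : measurable_fun setT r ->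
  cmeasurable (fun x => expi (r x)).
Proof.
move=> mr; split => /=.
- apply: (@measurableT_comp _ _ _ _ _ _ cos) => //.
  by apply: continuous_measurable_fun; exact: continuous_cos.
- apply: (@measurableT_comp _ _ _ _ _ _ sin) => //.
  by apply: continuous_measurable_fun; exact: continuous_sin.
Qed.

Lemma cmeasurable_indic (D : set T) : measurable D ->
  cmeasurable (fun x => (\1_D x : R)%:C).
Proof. by move=> mD; apply: cmeasurable_real; exact: measurable_indic. Qed.

Lemma measurable_mod f : cmeasurable f -> measurable_fun setT (fun x => mod (f x)).
Proof.
move=> [f1 f2].
rewrite (_ : (fun x => mod (f x)) =
  Num.sqrt \o (fun x => complex.Re (f x) ^+ 2 + complex.Im (f x) ^+ 2)).
  apply: measurableT_comp; first by apply: continuous_measurable_fun; exact: sqrt_continuous.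
  by apply: measurable_funD; apply: measurable_funX.
by apply/funext => x /=; case: (f x).
Qed.

Lemma measurable_cmod f : cmeasurable f -> measurable_fun setT (cmod f).
Proof. by move=> mf; apply/measurable_EFinP/measurable_mod. Qed.

Lemma cmod_ge0 f x : (0 <= cmod f x)%E.
Proof. by rewrite lee_fin mod_ge0. Qed.

End ComplexMeasurable.

#[global] Hint Resolve cmod_ge0 : core.
#[global] Hint Extern 0 (is_true (@Order.le _ _ _ (Normc.normc _))) =>
  solve [exact: mod_ge0] : core.

Lemma cmeasurable_comp d1 d2 (T1 : measurableType d1) (T2 : measurableType d2)
    (R : realType) (f : T2 -> R[i]) (phi : T1 -> T2) :
  measurable_fun setT phi -> cmeasurable f -> cmeasurable (fun x => f (phi x)).
Proof.
by move=> mp [f1 f2]; split; [exact: measurableT_comp f1 mp|exact: measurableT_comp f2 mp].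
Qed.

Section ComplexIntegrable.
Context d (T : measurableType d) (R : realType).
Variable mu : {measure set T -> \bar R}.
Implicit Types (f g : T -> R[i]).

Definition cintegrable f : Prop :=
  cmeasurable f /\ (\int[mu]_x cmod f x < +oo)%E.

Lemma cintegrableP f : cintegrable f <->
  mu.-integrable setT (fun x => (complex.Re (f x))%:E) /\
  mu.-integrable setT (fun x => (complex.Im (f x))%:E).
Proof.
split.
- move=> [mf foo]; have mm := measurable_cmod mf; case: (mf) => f1 f2.
  by split; apply/integrableP; split; [exact/measurable_EFinP| |
     exact/measurable_EFinP|]; (apply: le_lt_trans foo;
     apply: ge0_le_integral => //;
     [by apply: measurableT_comp => //; apply/measurable_EFinP
     |by move=> x _; rewrite /cmod lee_fin ?ler_Re_mod ?ler_Im_mod]).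
- move=> [/integrableP[f1 i1] /integrableP[f2 i2]].
  have mf : cmeasurable f by split; exact/measurable_EFinP.
  split => //; have := lte_add_pinfty i1 i2; apply: le_lt_trans.
  rewrite -ge0_integralD//; [|exact: measurableT_comp..].
  apply: ge0_le_integral => //.
  + exact: measurable_cmod.
  + by apply: emeasurable_funD; exact: measurableT_comp.
  + by move=> x _; rewrite /cmod /= lee_fin mod_le_ReIm.
Qed.

Lemma cintegrable_Re f : cintegrable f ->
  mu.-integrable setT (fun x => (complex.Re (f x))%:E).
Proof. by move=> /cintegrableP[]. Qed.

Lemma cintegrable_le f g : cmeasurable f -> cintegrable g ->
  (forall x, mod (f x) <= mod (g x)) -> cintegrable f.
Proof.
move=> mf [mg ig] fg; split => //; apply: le_lt_trans ig.
apply: ge0_le_integral => //;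
  [exact: measurable_cmod..|].
by move=> x _; rewrite /cmod lee_fin.
Qed.

Lemma cintegrableD f g : cintegrable f -> cintegrable g ->
  cintegrable (fun x => f x + g x).
Proof.
move=> [mf jf] [mg jg]; split; first exact: cmeasurableD.
have := lte_add_pinfty jf jg; apply: le_lt_trans.
rewrite -ge0_integralD//;
  [|exact: measurable_cmod..].
apply: ge0_le_integral => //.
- by apply: measurable_cmod; exact: cmeasurableD.
- by apply: emeasurable_funD; exact: measurable_cmod.
- by move=> x _; rewrite /cmod -EFinD lee_fin modD.
Qed.

Lemma cintegrableZ (c : R[i]) f : cintegrable f -> cintegrable (fun x => c * f x).
Proof.
move=> [mf jf]; split; first exact: cmeasurableZ.
rewrite (_ : cmod _ = fun x => (mod c)%:E * cmod f x)%E; last first.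
  by apply/funext => x; rewrite /cmod modM EFinM.
rewrite ge0_integralZl ?lee_fin//; last exact: measurable_cmod.
by rewrite lte_mul_pinfty// lee_fin mod_ge0.
Qed.

Lemma cintegrableN f : cintegrable f -> cintegrable (fun x => - f x).
Proof.
by move=> jf; under eq_fun do rewrite -mulN1r; exact: cintegrableZ.
Qed.

Lemma cintegrableB f g : cintegrable f -> cintegrable g ->
  cintegrable (fun x => f x - g x).
Proof. by move=> jf jg; apply: cintegrableD => //; exact: cintegrableN. Qed.

Lemma cintegrable0 : cintegrable (fun _ => 0).
Proof.
split; first exact: cmeasurable_cst.
under eq_integral do rewrite /cmod mod0.
by rewrite integral0.
Qed.

Lemma cintegrableMbounded f g (c : R) : cmeasurable g -> (forall x, mod (g x) <= c) ->
  cintegrable f -> cintegrable (fun x => f x * g x).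
Proof.
move=> mg gc jf.
have c0 (x : T) : 0 <= c by exact: le_trans (mod_ge0 (g x)) (gc x).
apply: (cintegrable_le (cmeasurableM jf.1 mg) (cintegrableZ c%:C jf)) => x.
by rewrite !modM modR ger0_norm ?(c0 x)// mulrC ler_wpM2r ?mod_ge0.
Qed.

Lemma cint_ae_eq f g : cmeasurable f -> cmeasurable g ->
  {ae mu, forall x, f x = g x} -> cint mu f = cint mu g.
Proof.
move=> [f1 f2] [g1 g2] fg; apply: complex_eq => /=; rewrite /Rintegral; congr fine.
- apply: ae_eq_integral => //; [exact/measurable_EFinP..|].
  by apply: filterS fg => x ->.
- apply: ae_eq_integral => //; [exact/measurable_EFinP..|].
  by apply: filterS fg => x ->.
Qed.

Lemma eq_cint f g : (forall x, f x = g x) -> cint mu f = cint mu g.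
Proof. by move=> fg; congr (cint mu); apply/funext. Qed.

Lemma cintD f g : cintegrable f -> cintegrable g ->
  cint mu (fun x => f x + g x) = cint mu f + cint mu g.
Proof.
move=> /cintegrableP[f1 f2] /cintegrableP[g1 g2]; apply: complex_eq => /=.
- rewrite -RintegralD//; congr (Rintegral _ _ _); apply/funext => x; exact: cReD.
- rewrite -RintegralD//; congr (Rintegral _ _ _); apply/funext => x; exact: cImD.
Qed.

Lemma cintZ (c : R[i]) f : cintegrable f ->
  cint mu (fun x => c * f x) = c * cint mu f.
Proof.
move=> jf; have /cintegrableP[f1 f2] := jf.
have Zint (r : R) u : mu.-integrable setT (EFin \o u) ->
    mu.-integrable setT (EFin \o (fun x => r * u x)).
  by move=> iu; exact: (integrableZl measurableT r iu).
apply: complex_eq => /=; rewrite ?cReM ?cImM /= -!RintegralZl//.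
- rewrite -RintegralB//; [|exact: Zint..].
  by congr (Rintegral _ _ _); apply/funext => x; rewrite cReM.
- rewrite -RintegralD//; [|exact: Zint..].
  by congr (Rintegral _ _ _); apply/funext => x; rewrite cImM.
Qed.

Lemma cintN f : cintegrable f -> cint mu (fun x => - f x) = - cint mu f.
Proof.
by move=> jf; rewrite -mulN1r -cintZ//; apply: eq_cint => x; rewrite mulN1r.
Qed.

Lemma cintB f g : cintegrable f -> cintegrable g ->
  cint mu (fun x => f x - g x) = cint mu f - cint mu g.
Proof. by move=> jf jg; rewrite cintD ?cintN//; exact: cintegrableN. Qed.

Lemma cint0 : cint mu (fun _ => 0) = 0.
Proof. by rewrite /cint /Rintegral /= integral0. Qed.

Lemma cintJ f : cintegrable f -> cint mu (fun x => conjc (f x)) = conjc (cint mu f).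
Proof.
move=> /cintegrableP[f1 f2]; apply: complex_eq => /=.
  by congr (Rintegral _ _ _); apply/funext => x; exact: cReJ.
rewrite -[RHS]mulN1r -RintegralZl//; congr (Rintegral _ _ _); apply/funext => x.
by rewrite cImJ mulN1r.
Qed.

Lemma cintegrable_real (r : T -> R) : mu.-integrable setT (EFin \o r) ->
  cintegrable (fun x => (r x)%:C).
Proof.
move=> ir; apply/cintegrableP; split => //=.
rewrite (_ : (fun _ => _) = cst 0%E)//; exact: integrable0.
Qed.

Lemma cint_real (r : T -> R) : cint mu (fun x => (r x)%:C) = (\int[mu]_x r x)%:C.
Proof.
by apply: complex_eq => //=; rewrite /Rintegral integral0.
Qed.

(** Rotating the integral onto the positive axis reduces the triangle
    inequality to monotonicity of the real integral. *)
Lemma mod_cint_le f : cintegrable f -> ((mod (cint mu f))%:E <= \int[mu]_x cmod f x)%E.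
Proof.
move=> jf; have [c cE] : exists c, c = cint mu f by exists (cint mu f).
rewrite -cE; have [c0|c0] := eqVneq (mod c) 0; first by rewrite c0 integral_ge0// => x _; exact: cmod_ge0.
have cp : 0 < mod c by rewrite lt_neqAle eq_sym c0 mod_ge0.
have jm : mu.-integrable setT (cmod f).
  apply/integrableP; split; first exact: measurable_cmod jf.1.
  by under eq_integral do rewrite gee0_abs ?cmod_ge0//; exact: jf.2.
have jcf := cintegrableZ (conjc c) jf.
have : ((mod c ^+ 2)%:E <= (mod c)%:E * \int[mu]_x cmod f x)%E.
  rewrite -ge0_integralZl//; do ?[exact: measurable_cmod jf.1]; do ?[by rewrite lee_fin mod_ge0].
  have -> : mod c ^+ 2 = complex.Re (conjc c * c) by rewrite mulrC mulcJ.
  rewrite [in X in conjc _ * X]cE -cintZ// [complex.Re _]/(Rintegral _ _ _) /Rintegral fineK; last exact/integrable_fin_num/cintegrable_Re.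
  apply: le_integral => //; first exact: cintegrable_Re.
    exact: integrableZl.
  move=> x _; rewrite -EFinM lee_fin -{1}(modJ c) -modM.
  by apply: le_trans (ler_norm _) _; exact: ler_Re_mod.
by rewrite expr2 EFinM lee_pmul2l// lte_fin.
Qed.

End ComplexIntegrable.

(** * Fubini's theorem for complex functions *)

Section ComplexFubini.
Context d1 d2 (T1 : measurableType d1) (T2 : measurableType d2) (R : realType).
Variables (m1 : {sigma_finite_measure set T1 -> \bar R})
          (m2 : {sigma_finite_measure set T2 -> \bar R}).
Implicit Types f : T1 * T2 -> R[i].

Lemma measurable_Rintegral2 (u : T1 * T2 -> R) : measurable_fun setT u ->
  measurable_fun setT (fun x => \int[m2]_y u (x, y)).
Proof.
move=> mu; apply: (@measurableT_comp _ _ _ _ _ _ fine) => //.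
have mE : measurable_fun setT (EFin \o u) by exact/measurable_EFinP.
under eq_fun do rewrite integralE.
apply: emeasurable_funB.
- have h : measurable_fun setT (fubini_F m2 (EFin \o u)^\+%E).
    by apply: measurable_fun_fubini_tonelli_F => //; exact: measurable_funepos.
  congr (measurable_fun _ _): h; apply/funext => x; apply: eq_integral => y _.
  by rewrite !funeposE.
- have h : measurable_fun setT (fubini_F m2 (EFin \o u)^\-%E).
    by apply: measurable_fun_fubini_tonelli_F => //; exact: measurable_funeneg.
  congr (measurable_fun _ _): h; apply/funext => x; apply: eq_integral => y _.
  by rewrite !funenegE.
Qed.

Lemma cmeasurable_cint2 f : cmeasurable f ->
  cmeasurable (fun x => cint m2 (fun y => f (x, y))).
Proof.
move=> [f1 f2]; split; first exact: measurable_Rintegral2 f1.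
exact: measurable_Rintegral2 f2.
Qed.

Lemma cmeasurable_section1 f x : cmeasurable f -> cmeasurable (fun y => f (x, y)).
Proof. by move=> mf; apply: cmeasurable_comp mf; exact: pair1_measurable. Qed.

Lemma cmeasurable_section2 f y : cmeasurable f -> cmeasurable (fun x => f (x, y)).
Proof. by move=> mf; apply: cmeasurable_comp mf; exact: pair2_measurable. Qed.

Lemma ae_cintegrable_section1 f : cintegrable (m1 \x m2)%E f ->
  {ae m1, forall x, cintegrable m2 (fun y => f (x, y))}.
Proof.
move=> /cintegrableP[/ae_integrable1 i1 /ae_integrable1 i2].
by apply: filterS2 i1 i2 => x h1 h2; apply/cintegrableP.
Qed.

Lemma cintegrable_cint2 f : cintegrable (m1 \x m2)%E f ->
  cintegrable m1 (fun x => cint m2 (fun y => f (x, y))).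
Proof.
move=> jf; split; first exact: cmeasurable_cint2 jf.1.
have mm : measurable_fun setT (cmod f) by exact: measurable_cmod jf.1.
have := jf.2; rewrite (fubini_tonelli1 _ mm) //.
apply: le_lt_trans; apply: ae_ge0_le_integral => //.
- exact/measurable_cmod/cmeasurable_cint2/jf.1.
- by move=> x _; exact: integral_ge0.
- exact: measurable_fun_fubini_tonelli_F.
- by apply: filterS (ae_cintegrable_section1 jf) => x jx _; exact: mod_cint_le.
Qed.

Lemma cfubini1 f : cintegrable (m1 \x m2)%E f ->
  cint (m1 \x m2)%E f = cint m1 (fun x => cint m2 (fun y => f (x, y))).
Proof.
move=> jf; have /cintegrableP[f1 f2] := jf.
have R1 (u : T1 * T2 -> R) : (m1 \x m2)%E.-integrable setT (EFin \o u) ->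
    \int[(m1 \x m2)%E]_z u z = \int[m1]_x \int[m2]_y u (x, y).
  move=> iu; rewrite /Rintegral -(integral12_prod_meas1 iu); congr fine.
  apply: ae_eq_integral => //; first exact: (measurable_fubini_F iu).
    apply/measurable_EFinP/measurable_Rintegral2.
    by apply/measurable_EFinP; exact: measurable_int iu.
  apply: filterS (ae_integrable1 iu) => x ix _ /=.
  by rewrite /fubini_F fineK//; exact: integrable_fin_num.
by apply: complex_eq => /=; rewrite R1.
Qed.

End ComplexFubini.

(** * The semi-Hilbert space of square integrable functions *)

Section SquareIntegrable.
Context d (T : measurableType d) (R : realType).
Variable mu : {measure set T -> \bar R}.
Implicit Types (f g u : T -> R[i]).

(** The squared norm is an integral, so that Tonelli's theorem, Fatou's lemma and
    periodization apply to it directly; estimates are made on it rather than on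
    the norm. *)
Definition N2 f : \bar R := (\int[mu]_x (mod (f x) ^+ 2)%:E)%E.

Definition sqn f : R := fine (N2 f).

Lemma N2_ge0 f : (0 <= N2 f)%E.
Proof. by apply: integral_ge0 => x _; rewrite lee_fin sqr_ge0. Qed.

Lemma sqn_ge0 f : 0 <= sqn f.
Proof. by rewrite fine_ge0// N2_ge0. Qed.

Lemma L2normE f : (L2norm mu f = (N2 f) `^ 2^-1)%E.
Proof.
rewrite /L2norm unlock; congr (_ `^ _)%E; apply: eq_integral => x _.
by rewrite /cmod abse_EFin ger0_norm// poweR_EFin powR_mulrn.
Qed.

Lemma L2norm_sqr f : ((L2norm mu f) `^ 2 = N2 f)%E.
Proof. by rewrite L2normE -poweRrM mulVf// poweRe1// N2_ge0. Qed.

Lemma L2P f : L2 mu f <-> cmeasurable f /\ (N2 f < +oo)%E.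
Proof.
rewrite /L2 L2normE; split=> -[mf foo]; split=> //.
- by apply: lty_poweRy foo; rewrite invr_eq0 pnatr_eq0.
- exact: poweR_lty.
Qed.

Lemma L2norm_lt f (eps : R) : 0 < eps ->
  (L2norm mu f < eps%:E)%E <-> (N2 f < (eps ^+ 2)%:E)%E.
Proof.
move=> e0; rewrite L2normE.
case: (N2 f) (N2_ge0 f) => [r||] // r0; last by rewrite poweRyr ?invr_eq0 ?pnatr_eq0.
rewrite poweR_EFin !lte_fin powR12_sqrt//.
rewrite -{2}(sqr_sqrtr (r0 : 0 <= r)) ltr_pXn2r ?nnegrE ?sqrtr_ge0 ?ltW//.
Qed.

Lemma L2_meas f : L2 mu f -> cmeasurable f.
Proof. by case. Qed.

Lemma L2_fin f : L2 mu f -> N2 f = (sqn f)%:E.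
Proof. by move=> /L2P[_ h]; rewrite fineK// ge0_fin_numE// N2_ge0. Qed.

Lemma measurable_mod2 f : cmeasurable f ->
  measurable_fun setT (fun x => (mod (f x) ^+ 2)%:E).
Proof. by move=> mf; apply/measurable_EFinP/measurable_funX/measurable_mod. Qed.

Lemma N2_le f g : cmeasurable f -> cmeasurable g ->
  {ae mu, forall x, mod (f x) <= mod (g x)} -> (N2 f <= N2 g)%E.
Proof.
move=> mf mg fg; apply: ae_ge0_le_integral => //.
- by move=> x _; rewrite lee_fin sqr_ge0.
- exact: measurable_mod2.
- by move=> x _; rewrite lee_fin sqr_ge0.
- exact: measurable_mod2.
- by apply: filterS fg => x h _; rewrite lee_fin ler_pXn2r ?nnegrE.
Qed.

Lemma N2_ae_eq f g : cmeasurable f -> cmeasurable g ->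
  {ae mu, forall x, f x = g x} -> N2 f = N2 g.
Proof.
move=> mf mg fg; apply/eqP; rewrite eq_le; apply/andP; split.
- by apply: N2_le => //; apply: filterS fg => x ->.
- by apply: N2_le => //; apply: filterS fg => x ->.
Qed.

Lemma N2_eq0 f : cmeasurable f -> N2 f = 0%E -> {ae mu, forall x, f x = 0}.
Proof.
move=> mf f0.
have : (\int[mu]_x `|(mod (f x) ^+ 2)%:E| = 0)%E.
  by rewrite -[RHS]f0; apply: eq_integral => x _; rewrite gee0_abs// lee_fin sqr_ge0.
move/(ae_eq_integral_abs mu measurableT (measurable_mod2 mf)).
by apply: filterS => x /(_ I) [/eqP]; rewrite sqrf_eq0 => /eqP /mod_eq0.
Qed.

Lemma N2Z (c : R[i]) f : cmeasurable f ->
  N2 (fun x => c * f x) = ((mod c ^+ 2)%:E * N2 f)%E.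
Proof.
move=> mf; rewrite /N2 -ge0_integralZl//; do ?[exact: measurable_mod2].
- by apply: eq_integral => x _; rewrite modM exprMn EFinM.
- by move=> x _; rewrite lee_fin sqr_ge0.
- by rewrite lee_fin sqr_ge0.
Qed.

Lemma N2N f : N2 (- f) = N2 f.
Proof. by apply: eq_integral => x _; rewrite modN. Qed.

Lemma N2B f g : N2 (f - g) = N2 (g - f).
Proof. by rewrite -N2N opprB. Qed.

Lemma N2J f : N2 (fun x => conjc (f x)) = N2 f.
Proof. by apply: eq_integral => x _; rewrite modJ. Qed.

Lemma N2_0 : N2 0 = 0%E.
Proof. by rewrite /N2; under eq_integral do rewrite mod0 expr0n; rewrite integral0. Qed.

Lemma N2D_le f g : cmeasurable f -> cmeasurable g ->
  (N2 (f + g)%R <= 2%:E * N2 f + 2%:E * N2 g)%E.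
Proof.
move=> mf mg.
have sq0 (u : T -> R[i]) x : setT x -> (0 <= (mod (u x) ^+ 2)%:E)%E.
  by move=> _; rewrite lee_fin sqr_ge0.
have m2 u : cmeasurable u ->
    measurable_fun setT (fun x => 2%:E * (mod (u x) ^+ 2)%:E)%E.
  by move=> mu'; apply: measurable_funeM; exact: measurable_mod2.
rewrite -!ge0_integralZl//; do ?[exact: measurable_mod2]; do ?[exact: sq0].
rewrite -ge0_integralD//; do ?[exact: m2];
  do ?[by move=> x _; rewrite mule_ge0// sq0].
apply: ge0_le_integral => //; do ?[exact: sq0].
- by apply: measurable_mod2; exact: cmeasurableD.
- by apply: emeasurable_funD; exact: m2.
- by move=> x _; rewrite -!EFinM -EFinD lee_fin; exact: mod_sqrD.
Qed.

Lemma L2_0 : L2 mu 0.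
Proof. by apply/L2P; split; [exact: cmeasurable_cst|rewrite N2_0]. Qed.

Lemma L2D f g : L2 mu f -> L2 mu g -> L2 mu (f + g).
Proof.
move=> jf jg; have [mf mg] := (L2_meas jf, L2_meas jg).
apply/L2P; split; first exact: cmeasurableD.
by apply: le_lt_trans (N2D_le mf mg) _; rewrite !L2_fin// -!EFinM -EFinD ltry.
Qed.

Lemma L2Z (c : R[i]) f : L2 mu f -> L2 mu (fun x => c * f x).
Proof.
move=> jf; apply/L2P; split; first by apply: cmeasurableZ; exact: L2_meas.
by rewrite N2Z; [rewrite L2_fin// -EFinM ltry|exact: L2_meas].
Qed.

Lemma L2N f : L2 mu f -> L2 mu (- f).
Proof.
move=> jf; rewrite (_ : - f = fun x => -1 * f x); first exact: L2Z.
by apply/funext => x; rewrite mulN1r.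
Qed.

Lemma L2B f g : L2 mu f -> L2 mu g -> L2 mu (f - g).
Proof. by move=> jf jg; apply: L2D => //; exact: L2N. Qed.

Lemma L2J f : L2 mu f -> L2 mu (fun x => conjc (f x)).
Proof.
by move=> jf; apply/L2P; split; [apply: cmeasurableJ; exact: L2_meas|rewrite N2J L2_fin// ltry].
Qed.

Lemma L2_sum (I : Type) (r : seq I) (F : I -> T -> R[i]) :
  (forall i, L2 mu (F i)) -> L2 mu (\sum_(i <- r) F i).
Proof.
move=> jF; elim: r => [|i r IH]; first by rewrite big_nil; exact: L2_0.
by rewrite big_cons; apply: L2D.
Qed.

Lemma L2_le f g : cmeasurable f -> L2 mu g ->
  {ae mu, forall x, mod (f x) <= mod (g x)} -> L2 mu f.
Proof.
move=> mf jg fg; apply/L2P; split => //.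
by apply: le_lt_trans (N2_le mf (L2_meas jg) fg) _; rewrite L2_fin// ltry.
Qed.

Lemma L2Mbounded f g (c : R) : cmeasurable g -> (forall x, mod (g x) <= c) ->
  L2 mu f -> L2 mu (fun x => f x * g x).
Proof.
move=> mg gc jf; have c0 (x : T) : 0 <= c by exact: le_trans (mod_ge0 (g x)) (gc x).
apply: (L2_le _ (L2Z c%:C jf)); first by apply: cmeasurableM => //; exact: L2_meas.
by apply: nearW => x; rewrite !modM modR ger0_norm ?(c0 x)// mulrC ler_wpM2r.
Qed.

Lemma L2_indic (D : set T) : measurable D -> (mu D < +oo)%E ->
  L2 mu (fun x => (\1_D x : R)%:C).
Proof.
move=> mD Doo; apply/L2P; split; first exact: cmeasurable_indic.
rewrite /N2 (eq_integral (fun x => (\1_D x)%:E)) ?integral_indic ?setIT// => x _.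
by rewrite modR indicE; case: (_ \in _); rewrite ?normr1 ?normr0 ?expr1n ?expr0n.
Qed.

Lemma sqnZ (c : R[i]) f : L2 mu f -> sqn (fun x => c * f x) = mod c ^+ 2 * sqn f.
Proof. by move=> jf; rewrite /sqn N2Z ?L2_fin//; exact: L2_meas. Qed.

Lemma sqnN f : sqn (- f) = sqn f.
Proof. by rewrite /sqn N2N. Qed.

Lemma sqnD_le f g : L2 mu f -> L2 mu g -> sqn (f + g) <= 2 * sqn f + 2 * sqn g.
Proof.
move=> jf jg; have := N2D_le (L2_meas jf) (L2_meas jg).
by rewrite !L2_fin//; exact: L2D.
Qed.

Lemma sqnB_le f g u : L2 mu f -> L2 mu g -> L2 mu u ->
  sqn (f - g) <= 2 * sqn (f - u) + 2 * sqn (u - g).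
Proof.
move=> jf jg ju; rewrite (_ : f - g = (f - u) + (u - g)); last by rewrite addrA subrK.
by apply: sqnD_le; exact: L2B.
Qed.

(** ** The inner product *)

Lemma inner_cintegrable f g : L2 mu f -> L2 mu g ->
  cintegrable mu (fun x => f x * conjc (g x)).
Proof.
move=> jf jg; have [mf mg] := (L2_meas jf, L2_meas jg).
have mm : cmeasurable (fun x => f x * conjc (g x)).
  by apply: cmeasurableM => //; exact: cmeasurableJ.
split => //; apply: (@le_lt_trans _ _ (N2 f + N2 g)%E); last first.
  by rewrite !L2_fin// -EFinD ltry.
rewrite -ge0_integralD//; do ?[exact: measurable_mod2];
  do ?[by move=> x _; rewrite lee_fin sqr_ge0].
apply: ge0_le_integral => //; do ?[exact: measurable_cmod].
- by apply: emeasurable_funD; exact: measurable_mod2.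
- by move=> x _; rewrite /cmod -EFinD lee_fin mod_sqrM.
Qed.

Lemma innerDl f g u : L2 mu f -> L2 mu g -> L2 mu u ->
  inner mu (f + g) u = inner mu f u + inner mu g u.
Proof.
move=> jf jg ju; rewrite /inner -cintD; do ?[exact: inner_cintegrable].
by apply: eq_cint => x; rewrite mulrDl.
Qed.

Lemma innerZl (c : R[i]) f g : L2 mu f -> L2 mu g ->
  inner mu (fun x => c * f x) g = c * inner mu f g.
Proof.
move=> jf jg; rewrite /inner -cintZ; do ?[exact: inner_cintegrable].
by apply: eq_cint => x; rewrite mulrA.
Qed.

Lemma innerJ f g : L2 mu f -> L2 mu g -> inner mu g f = conjc (inner mu f g).
Proof.
move=> jf jg; rewrite /inner -cintJ; do ?[exact: inner_cintegrable].
by apply: eq_cint => x; rewrite conjcM conjcK mulrC.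
Qed.

Lemma innerNl f g : L2 mu f -> L2 mu g -> inner mu (- f) g = - inner mu f g.
Proof.
move=> jf jg; rewrite (_ : - f = fun x => -1 * f x); first by rewrite innerZl// mulN1r.
by apply/funext => x; rewrite mulN1r.
Qed.

Lemma innerBl f g u : L2 mu f -> L2 mu g -> L2 mu u ->
  inner mu (f - g) u = inner mu f u - inner mu g u.
Proof. by move=> jf jg ju; rewrite innerDl ?innerNl//; exact: L2N. Qed.

Lemma innerDr f g u : L2 mu f -> L2 mu g -> L2 mu u ->
  inner mu u (f + g) = inner mu u f + inner mu u g.
Proof.
move=> jf jg ju; rewrite innerJ//; last exact: L2D.
by rewrite innerDl// conjcD -!innerJ.
Qed.

Lemma innerZr (c : R[i]) f g : L2 mu f -> L2 mu g ->
  inner mu g (fun x => c * f x) = conjc c * inner mu g f.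
Proof.
move=> jf jg; rewrite innerJ//; last exact: L2Z.
by rewrite innerZl// conjcM -innerJ.
Qed.

Lemma inner0l g : inner mu 0 g = 0.
Proof. by rewrite /inner -[RHS](cint0 mu); apply: eq_cint => x; rewrite mul0r. Qed.

Lemma inner_suml (I : Type) (r : seq I) (F : I -> T -> R[i]) g :
  (forall i, L2 mu (F i)) -> L2 mu g ->
  inner mu (\sum_(i <- r) F i) g = \sum_(i <- r) inner mu (F i) g.
Proof.
move=> jF jg; elim: r => [|i r IH]; first by rewrite !big_nil inner0l.
by rewrite !big_cons innerDl ?IH//; exact: L2_sum.
Qed.

Lemma inner_sumr (I : Type) (r : seq I) (F : I -> T -> R[i]) g :
  (forall i, L2 mu (F i)) -> L2 mu g ->
  inner mu g (\sum_(i <- r) F i) = \sum_(i <- r) inner mu g (F i).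
Proof.
move=> jF jg; rewrite innerJ//; last exact: L2_sum.
rewrite inner_suml// rmorph_sum; apply: eq_bigr => i _.
by rewrite [RHS]innerJ.
Qed.

Lemma inner_ae_eq f g u : cmeasurable f -> cmeasurable g -> cmeasurable u ->
  {ae mu, forall x, f x = g x} -> inner mu f u = inner mu g u.
Proof.
move=> mf mg mu' fg; apply: cint_ae_eq.
- by apply: cmeasurableM => //; exact: cmeasurableJ.
- by apply: cmeasurableM => //; exact: cmeasurableJ.
- by apply: filterS fg => x ->.
Qed.

Lemma inner_self f : inner mu f f = (sqn f)%:C.
Proof.
rewrite /inner /sqn /N2 -[RHS]/((\int[mu]_x (mod (f x) ^+ 2))%:C) -cint_real.
by apply: eq_cint => x; rewrite mulcJ.
Qed.

Lemma sqnD f g : L2 mu f -> L2 mu g ->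
  sqn (f + g) = sqn f + 2 * complex.Re (inner mu f g) + sqn g.
Proof.
move=> jf jg; have jfg := L2D jf jg.
have := inner_self (f + g).
rewrite innerDl// !innerDr// !inner_self (innerJ jf jg).
case: (inner mu f g) => a b /(congr1 (@complex.Re _)).
by rewrite !cReD/=; lra.
Qed.

Lemma sqnB f g : L2 mu f -> L2 mu g ->
  sqn (f - g) = sqn f - 2 * complex.Re (inner mu f g) + sqn g.
Proof.
move=> jf jg; rewrite sqnD//; last exact: L2N.
rewrite sqnN (_ : inner mu f (- g) = - inner mu f g) ?cReN; first by rewrite mulrN.
by rewrite innerJ ?innerNl ?conjcN -?innerJ//; exact: L2N.
Qed.

Lemma cauchy_schwarz f g : L2 mu f -> L2 mu g ->
  mod (inner mu f g) ^+ 2 <= sqn f * sqn g.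
Proof.
move=> jf jg; set a := inner mu f g.
have key (t : R) : 0 <= sqn f - 2 * t * mod a ^+ 2 + t ^+ 2 * mod a ^+ 2 * sqn g.
  have := sqn_ge0 (f - (fun x => (t%:C * a) * g x)).
  rewrite sqnB//; last exact: L2Z.
  rewrite innerZr// sqnZ// -/a modM modR exprMn real_normK ?num_real//.
  rewrite conjcM conjc_real -mulrA [conjc a * a]mulrC mulcJ.
  rewrite (_ : complex.Re (t%:C * (mod a ^+ 2)%:C) = t * mod a ^+ 2); first by lra.
  by rewrite cReM /=; ring.
have [s0|s0] := eqVneq (sqn g) 0.
  rewrite s0 mulr0; have [a0|a0] := eqVneq (mod a ^+ 2) 0; first by rewrite a0.
  have := key ((sqn f + 1) / (2 * mod a ^+ 2)); rewrite s0 mulr0 addr0.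
  rewrite (_ : 2 * _ * _ = sqn f + 1); last by field; rewrite sqrf_eq0 in a0.
  by lra.
have sp : 0 < sqn g by rewrite lt_neqAle eq_sym s0 sqn_ge0.
have := key (sqn g)^-1.
rewrite (_ : _ - _ + _ = (sqn f * sqn g - mod a ^+ 2) / sqn g); last by field.
by rewrite pmulr_lge0 ?invr_gt0// subr_ge0.
Qed.

End SquareIntegrable.

(** * Completeness of the space of square integrable functions *)

Section RieszFischer.
Context d (T : measurableType d) (R : realType).
Variable mu : {measure set T -> \bar R}.

Lemma sum_halves_le (N : nat) : \sum_(0 <= k < N) (2^-1 : R) ^+ k <= 2.
Proof.
suff -> : \sum_(0 <= k < N) (2^-1 : R) ^+ k = 2 - 2 * 2^-1 ^+ N.
  by rewrite gerBl mulr_ge0// exprn_ge0// invr_ge0.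
elim: N => [|N IH]; first by rewrite big_nil expr0 mulr1 subrr.
by rewrite big_nat_recr//= IH exprS; field.
Qed.

Lemma nneseries_le_bound (u : nat -> \bar R) (c : \bar R) :
  (forall n, 0 <= u n)%E -> (forall N, \sum_(0 <= k < N) u k <= c)%E ->
  (\sum_(0 <= k <oo) u k <= c)%E.
Proof.
move=> u0 uc; apply: lime_le; first exact: is_cvg_nneseries.
exact: nearW.
Qed.

(** The sequence is a constant plus an absolutely convergent telescoping series. *)
Lemma bounded_variation_cvgn (u : nat -> R) (c : R) :
  (forall N, \sum_(0 <= k < N) `|u k.+1 - u k| <= c) -> cvgn u.
Proof.
move=> uc; rewrite (_ : u = cst (u 0) \+ series (telescope u)); last first.
  by apply/funext => n /=; rewrite {1}(eq_sum_telescope u n).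
apply: is_cvgD; first exact: is_cvg_cst.
apply: normed_cvg; rewrite -[X in cvgn X]/(fun N => \sum_(0 <= k < N) `|u k.+1 - u k|).
apply: nondecreasing_is_cvgn.
  by apply/nondecreasing_seqP => n; rewrite big_nat_recr//= lerDl.
by exists c => _ [n _ <-]; exact: uc.
Qed.

Lemma measurable_limC (F : nat -> T -> R[i]) : (forall n, cmeasurable (F n)) ->
  (forall x, cvgn (fun n => complex.Re (F n x)) /\ cvgn (fun n => complex.Im (F n x))) ->
  cmeasurable (fun x => limn (fun n => complex.Re (F n x)) +i*
                        limn (fun n => complex.Im (F n x))).
Proof.
move=> mF cF; split => /=.
- apply: (@measurable_fun_cvg _ _ _ _ (fun n x => complex.Re (F n x))) => //.
    by move=> n; case: (mF n).
  by move=> x _; have [] := cF x.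
- apply: (@measurable_fun_cvg _ _ _ _ (fun n x => complex.Im (F n x))) => //.
    by move=> n; case: (mF n).
  by move=> x _; have [] := cF x.
Qed.

(** Fatou's lemma bounds the distance to the pointwise limit. *)
Lemma N2_lim_le (F : nat -> T -> R[i]) (s g : T -> R[i]) (c : R) (n : nat) :
  (forall m, cmeasurable (F m)) -> cmeasurable g ->
  (forall x, complex.Re (F m x) @[m --> \oo] --> complex.Re (s x)) ->
  (forall x, complex.Im (F m x) @[m --> \oo] --> complex.Im (s x)) ->
  (forall m, (n <= m)%N -> (N2 mu (F m - g)%R <= c%:E)%E) -> (N2 mu (s - g)%R <= c%:E)%E.
Proof.
move=> mF mg cR cI h.
pose v m x := (mod ((F m - g) x) ^+ 2)%:E.
have mv m : measurable_fun setT (v m).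
  by apply: measurable_mod2; exact: cmeasurableB.
have v0 m x : setT x -> (0 <= v m x)%E by move=> _; rewrite lee_fin sqr_ge0.
have vl x : v m x @[m --> \oo] --> (mod ((s - g) x) ^+ 2)%:E.
  apply/fine_cvgP; split; first by apply: nearW.
  rewrite mod_sqr; rewrite (_ : _ \o _ = fun m => complex.Re ((F m - g) x) ^+ 2 +
    complex.Im ((F m - g) x) ^+ 2); last by apply/funext => m /=; rewrite mod_sqr.
  apply: cvgD; apply: (cvgM _ _).
  - by under eq_fun do rewrite cReD; rewrite cReD; apply: cvgD => //; exact: cvg_cst.
  - by under eq_fun do rewrite cReD; rewrite cReD; apply: cvgD => //; exact: cvg_cst.
  - by under eq_fun do rewrite cImD; rewrite cImD; apply: cvgD => //; exact: cvg_cst.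
  - by under eq_fun do rewrite cImD; rewrite cImD; apply: cvgD => //; exact: cvg_cst.
have := fatou mu measurableT mv v0.
rewrite (_ : (\int[mu]_x _ = N2 mu (s - g)%R)%E); last first.
  apply: eq_integral => x _.
  by rewrite (is_cvg_limn_einfE (cvgP _ (vl x))) (cvg_lim _ (vl x)).
move=> /le_trans; apply.
apply: (@le_trans _ _ (limn_einf (fun=> c%:E))); last first.
  have h0 : (fun _ : nat => c%:E) @ \oo --> c%:E by exact: cvg_cst.
  by have [-> _] := cvg_limn_einf_sup h0.
rewrite !limn_einf_lim; apply: lee_lim; [exact: is_cvg_einfs..|].
exists n => // k /= nk; apply: le_ereal_inf_tmp.
move=> _ [m /= km <-]; apply: le_trans (h m (leq_trans nk km)).
by apply: ereal_inf_lbound; exists m.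
Qed.

(** The increments are square summable with the weights 2^k, hence absolutely
    summable at almost every point. The pointwise limit is the limit in norm by
    Fatou's lemma. *)
Lemma riesz_fischer (f : nat -> T -> R[i]) : (forall n, L2 mu (f n)) ->
  (forall n m, (n <= m)%N -> (N2 mu (f m - f n)%R <= (4^-1 ^+ n)%:E)%E) ->
  exists s, L2 mu s /\ forall n, (N2 mu (s - f n)%R <= (4^-1 ^+ n)%:E)%E.
Proof.
move=> jf cauchy; have mf n := L2_meas (jf n).
(* the weight 2^k beats the rate 4^-k and makes the increments summable *)
pose w k x := ((2 ^+ k)%:E * (mod ((f k.+1 - f k)%R x) ^+ 2)%:E)%E.
have mw k : measurable_fun setT (w k).
  by apply: measurable_funeM; apply: measurable_mod2; exact: cmeasurableB.
have w0 k x : (0 <= w k x)%E.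
  by rewrite mule_ge0 ?lee_fin ?sqr_ge0 ?exprn_ge0.
pose W x := (\sum_(0 <= k <oo) w k x)%E.
have mW : measurable_fun setT W.
  by apply: (ge0_emeasurable_sum (P := xpredT)) => // k _.
have W0 x : (0 <= W x)%E by exact: nneseries_ge0.
have iW : (\int[mu]_x W x <= 2%:E)%E.
  rewrite integral_nneseries//; apply: nneseries_le_bound => [n|N].
    by apply: integral_ge0.
  apply: (@le_trans _ _ (\sum_(0 <= k < N) ((2^-1) ^+ k)%:E)%E); last first.
    by rewrite sumEFin lee_fin sum_halves_le.
  apply: lee_sum => k _; rewrite ge0_integralZl//; last 2 first.
  - by apply: measurable_mod2; exact: cmeasurableB.
  - by move=> x _; rewrite lee_fin sqr_ge0.
  apply: (@le_trans _ _ ((2 ^+ k)%:E * (4^-1 ^+ k)%:E)%E).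
    by apply: lee_wpmul2l; [rewrite lee_fin exprn_ge0|exact: cauchy].
  by rewrite -EFinM -exprMn lee_fin (_ : 2 * 4^-1 = 2^-1 :> R)//; field.
have Woo : {ae mu, forall x, (W x < +oo)%E}.
  have iiW : mu.-integrable setT W.
    apply/integrableP; split => //.
    by under eq_integral do rewrite gee0_abs//; exact: le_lt_trans iW (ltry _).
  by apply: filterS (integrable_ae measurableT iiW) => x /(_ I); rewrite ge0_fin_numE.
pose E := [set x | (W x < +oo)%E].
have mE : measurable E.
  have := emeasurable_fun_infty_o measurableT mW +oo%E.
  by rewrite setTI.
(* vanishing off E makes the sequence converge at every point *)
pose F n x := (\1_E x)%:C * f n x.
have mF n : cmeasurable (F n) by apply: cmeasurableM => //; exact: cmeasurable_indic.
have bv x : exists c, forall N, \sum_(0 <= k < N) mod (F k.+1 x - F k x) <= c.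
  have [xE|xE] := pselect (E x); last first.
    exists 0 => N; rewrite big1// => k _; rewrite /F indicE memNset// !mul0r subrr.
    exact: mod0.
  exists (2 + fine (W x)) => N.
  have FE k : F k x = f k x by rewrite /F indicE mem_set// mul1r.
  (* arithmetic-geometric mean inequality *)
  have dk k : mod (F k.+1 x - F k x) <= 2^-1 ^+ k + 2 ^+ k * mod ((f k.+1 - f k) x) ^+ 2.
    rewrite !FE; set a := mod _.
    have a0 : 0 <= a by exact: mod_ge0.
    have p0 : 0 < (2 : R) ^+ k by rewrite exprn_gt0.
    rewrite exprVn; set p := 2 ^+ k in p0 *.
    rewrite -(ler_pM2l p0) mulrDr mulfV ?gt_eqF//.
    have := sqr_ge0 (p * a - 1); have : 0 <= p * a by rewrite mulr_ge0// ltW.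
    by nra.
  apply: (le_trans (ler_sum _ (fun k _ => dk k))).
  rewrite big_split/= lerD ?sum_halves_le//.
  rewrite -lee_fin fineK ?ge0_fin_numE// -sumEFin.
  under eq_bigr do rewrite EFinM.
  by apply: nneseries_lim_ge => k _ _; exact: w0.
have cR x : cvgn (fun n => complex.Re (F n x)).
  have [c hc] := bv x; apply: (@bounded_variation_cvgn _ c) => N.
  apply: le_trans (hc N); apply: ler_sum => k _.
  by rewrite -cReN -cReD ler_Re_mod.
have cI x : cvgn (fun n => complex.Im (F n x)).
  have [c hc] := bv x; apply: (@bounded_variation_cvgn _ c) => N.
  apply: le_trans (hc N); apply: ler_sum => k _.
  by rewrite -cImN -cImD ler_Im_mod.
pose s x := limn (fun n => complex.Re (F n x)) +i* limn (fun n => complex.Im (F n x)).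
have ms : cmeasurable s by apply: measurable_limC.
have Ff n : {ae mu, forall x, F n x = f n x}.
  by apply: filterS Woo => x Wx; rewrite /F indicE mem_set// mul1r.
have sf n : (N2 mu (s - f n)%R <= (4^-1 ^+ n)%:E)%E.
  apply: (@N2_lim_le F s (f n) _ n) => // m nm.
  rewrite (@N2_ae_eq _ _ _ _ _ (f m - f n)); first exact: cauchy.
  - by apply: cmeasurableB.
  - by apply: cmeasurableB.
  - by apply: filterS (Ff m) => x h; rewrite -[LHS]/(F m x - f n x) h.
exists s; split => //; apply/L2P; split => //.
have j0 : L2 mu (s - f 0%N).
  apply/L2P; split; first exact: cmeasurableB.
  exact: le_lt_trans (sf 0%N) (ltry _).
by have /L2P[] := L2D j0 (jf 0%N); rewrite subrK.
Qed.

End RieszFischer.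

(** * Unconditional sums *)

Section FiniteSums.
Context {R : realType} {I : choiceType}.

Lemma big_fsetD_sub (V : zmodType) (u : I -> V) (A B : {fset I}) : fsubset A B ->
  \sum_(i <- B) u i = \sum_(i <- A) u i + \sum_(i <- fsetD B A) u i.
Proof.
move=> AB; rewrite (big_fsetID _ (mem A))/=; congr (_ + _).
- congr bigop; congr enum_fset; apply/fsetP => x; rewrite !inE/=.
  by apply/andP/idP => [[]//|xA]; split => //; exact: (fsubsetP AB).
- congr bigop; congr enum_fset; apply/fsetP => x; rewrite !inE/=.
  by rewrite andbC.
Qed.

Implicit Types a : I -> R.

Lemma esum_fset_ub a (F : {fset I}) : (forall i, 0 <= a i) ->
  ((\sum_(i <- F) a i)%:E <= \esum_(i in [set: I]) (a i)%:E)%E.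
Proof.
move=> a0; apply: esum_ge; exists [set` F]; first by split => //; exact: finite_fset.
by rewrite fsbig_finite//= set_fsetK sumEFin.
Qed.

Lemma esum_le_bound a (c : \bar R) : (forall F : {fset I}, ((\sum_(i <- F) a i)%:E <= c)%E) ->
  (\esum_(i in [set: I]) (a i)%:E <= c)%E.
Proof.
move=> ac; apply: ge_ereal_sup => _ [A [finA _] <-].
by rewrite fsbig_finite// sumEFin.
Qed.

Lemma esum_fset_approx a : (forall i, 0 <= a i) ->
  (\esum_(i in [set: I]) (a i)%:E < +oo)%E ->
  forall eps : R, 0 < eps -> exists F0 : {fset I}, forall F, fsubset F0 F ->
    fine (\esum_(i in [set: I]) (a i)%:E) - eps < \sum_(i <- F) a i.
Proof.
move=> a0 aoo eps e0.
have fin : (\esum_(i in [set: I]) (a i)%:E)%E \is a fin_num.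
  by rewrite ge0_fin_numE// esum_ge0// => i _; rewrite lee_fin.
have [_ [A [finA _] <-]] := ub_ereal_sup_adherent e0 fin.
rewrite -/(esum _ _) -{1}(fineK fin) -EFinB fsbig_finite// sumEFin lte_fin => h.
exists (fset_set A) => F AF; apply: lt_le_trans h _.
by rewrite (big_fsetD_sub _ AF) lerDl sumr_ge0.
Qed.

Lemma esum_tail a : (forall i, 0 <= a i) ->
  (\esum_(i in [set: I]) (a i)%:E < +oo)%E ->
  forall eps : R, 0 < eps -> exists F0 : {fset I}, forall F, fsubset F0 F ->
    forall G, fsubset F G -> \sum_(i <- fsetD G F) a i < eps.
Proof.
move=> a0 aoo eps e0; have [F0 h] := esum_fset_approx a0 aoo e0.
exists F0 => F F0F G FG.
have := esum_fset_ub G a0; have := h F F0F.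
rewrite (big_fsetD_sub _ FG) -[X in (_ <= X)%E -> _]fineK ?lee_fin; first by lra.
by rewrite ge0_fin_numE// esum_ge0// => i _; rewrite lee_fin.
Qed.

Lemma csums_to_unique (u : I -> R[i]) (s t : R[i]) :
  sums_to (fun z => (mod z)%:E) u s -> sums_to (fun z => (mod z)%:E) u t -> s = t.
Proof.
move=> us ut; apply/eqP; rewrite -subr_eq0; apply/eqP; apply: mod_eq0.
apply/eqP; rewrite eq_le mod_ge0 andbT leNgt; apply/negP => st0.
have [F hF] := us _ (divr_gt0 st0 (ltr0n _ 2)).
have [G hG] := ut _ (divr_gt0 st0 (ltr0n _ 2)).
have := hF (fsetU F G) (fsubsetUl _ _); have := hG (fsetU F G) (fsubsetUr _ _).
rewrite !lte_fin; set w := \sum_(i <- _) _ => h1 h2.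
have : mod (s - t) <= mod (s - w) + mod (t - w).
  by rewrite -(modN (t - w)) -[s - t](_ : (s - w) + - (t - w) = _) ?modD//; ring.
by lra.
Qed.

Lemma csumE (u : I -> R[i]) (s : R[i]) :
  sums_to (fun z => (mod z)%:E) u s -> csum u = s.
Proof.
by move=> us; rewrite /csum; case: xgetP => [t _ ut|/(_ s)//]; exact: csums_to_unique us.
Qed.

Lemma esum_sums_to a (t : R) : (forall i, 0 <= a i) ->
  sums_to (fun z => (mod z)%:E) (fun i => (a i)%:C) t%:C ->
  (\esum_(i in [set: I]) (a i)%:E = t%:E)%E.
Proof.
move=> a0 at_.
have sumE (F : {fset I}) : \sum_(i <- F) (a i)%:C = (\sum_(i <- F) a i)%:C.
  by rewrite rmorph_sum.
apply/eqP; rewrite eq_le; apply/andP; split.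
- apply: esum_le_bound => F; rewrite lee_fin; apply/ler_addgt0Pr => eps e0.
  have [F0 /(_ (fsetU F0 F) (fsubsetUl _ _))] := at_ _ e0.
  rewrite sumE -rmorphB modR lte_fin ltr_norml => /andP[+ _].
  rewrite (big_fsetD_sub _ (fsubsetUr F0 F)) => h.
  have : 0 <= \sum_(i <- fsetD (fsetU F0 F) F) a i by apply: sumr_ge0.
  by lra.
- apply/lee_addgt0Pr => eps e0.
  have [F0 /(_ F0 (fsubset_refl _))] := at_ _ e0.
  rewrite sumE -rmorphB modR lte_fin ltr_norml => /andP[_ h].
  apply: (@le_trans _ _ ((\sum_(i <- F0) a i)%:E + eps%:E)%E).
    by rewrite -EFinD lee_fin; lra.
  by rewrite leeD2r// esum_fset_ub.
Qed.

Definition l2 (c : I -> R[i]) : Prop :=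
  (\esum_(i in [set: I]) (mod (c i) ^+ 2)%:E < +oo)%E.

Lemma l2_bound (c : I -> R[i]) (K : R) :
  (forall F : {fset I}, \sum_(i <- F) mod (c i) ^+ 2 <= K) -> l2 c.
Proof.
move=> h; apply: (@le_lt_trans _ _ K%:E); last by rewrite ltry.
by apply: esum_le_bound => F; rewrite lee_fin.
Qed.

Lemma l2_fset_ub (c : I -> R[i]) (F : {fset I}) : l2 c ->
  \sum_(i <- F) mod (c i) ^+ 2 <= fine (\esum_(i in [set: I]) (mod (c i) ^+ 2)%:E).
Proof.
move=> c2; have sq0 i : 0 <= mod (c i) ^+ 2 by exact: sqr_ge0.
rewrite -lee_fin fineK; first exact: esum_fset_ub.
by rewrite ge0_fin_numE// esum_ge0// => i _; rewrite lee_fin.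
Qed.

Lemma l2D (c c' : I -> R[i]) : l2 c -> l2 c' -> l2 (fun i => c i + c' i).
Proof.
move=> lc lc'; apply: (l2_bound (K := 2 * fine (\esum_(i in [set: I]) (mod (c i) ^+ 2)%:E) +
   2 * fine (\esum_(i in [set: I]) (mod (c' i) ^+ 2)%:E))) => F.
apply: (@le_trans _ _ (\sum_(i <- F) (2 * mod (c i) ^+ 2 + 2 * mod (c' i) ^+ 2))).
  by apply: ler_sum => i _; exact: mod_sqrD.
by rewrite big_split/= -!mulr_sumr lerD// ler_wpM2l// l2_fset_ub.
Qed.

Lemma fset_sum_pred1 (V : zmodType) (j : I) (v : V) (F : {fset I}) :
  \sum_(i <- F) (if i == j then v else 0) = if j \in F then v else 0.
Proof.
case: ifP => jF.
  rewrite (big_fsetD1 j)//= eqxx big1_seq ?addr0// => i /andP[_].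
  by rewrite !inE => /andP[/negbTE ->].
by rewrite big1_seq// => i /andP[_ iF]; case: eqP => // ij; rewrite -ij iF in jF.
Qed.

Lemma l2_pred1 (j : I) (v : R[i]) : l2 (fun i => if i == j then v else 0).
Proof.
apply: (l2_bound (K := mod v ^+ 2)) => F.
rewrite (eq_bigr (fun i => if i == j then mod v ^+ 2 else 0)); last first.
  by move=> i _; case: ifP => // _; rewrite mod0 expr0n.
by rewrite fset_sum_pred1; case: ifP => // _; rewrite sqr_ge0.
Qed.

End FiniteSums.

Section SumsInL2.
Context d (T : measurableType d) (R : realType).
Variable mu : {measure set T -> \bar R}.
Context {I : choiceType}.
Implicit Types (w u : I -> T -> R[i]) (s f g : T -> R[i]) (c : I -> R[i]).

Lemma sums_to_N2 w s : sums_to (L2norm mu) w s <->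
  forall eps : R, 0 < eps -> exists F0 : {fset I}, forall F, fsubset F0 F ->
    (N2 mu (s - \sum_(i <- F) w i)%R < eps%:E)%E.
Proof.
split => h eps e0.
- have [|F0 hF0] := h (Num.sqrt eps); first by rewrite sqrtr_gt0.
  exists F0 => F /hF0 /L2norm_lt; rewrite sqrtr_gt0 sqr_sqrtr ?ltW//; exact.
- have [|F0 hF0] := h (eps ^+ 2); first by rewrite exprn_gt0.
  by exists F0 => F /hF0 hF; apply/L2norm_lt.
Qed.

Lemma sums_to_ae_eq w s s' : (forall i, L2 mu (w i)) -> L2 mu s -> cmeasurable s' ->
  {ae mu, forall x, s x = s' x} -> sums_to (L2norm mu) w s -> sums_to (L2norm mu) w s'.
Proof.
move=> jw js ms' ss' /sums_to_N2 h; apply/sums_to_N2 => eps /h[F0 hF0].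
exists F0 => F /hF0; rewrite (@N2_ae_eq _ _ _ _ _ (s' - \sum_(i <- F) w i))//.
- by apply: cmeasurableB; [exact: L2_meas js|exact/L2_meas/L2_sum].
- by apply: cmeasurableB; [|exact/L2_meas/L2_sum].
- by apply: filterS ss' => x h'; rewrite -[LHS]/(s x - _) h'.
Qed.

Lemma sums_to_L2_unique w s s' : (forall i, L2 mu (w i)) -> L2 mu s -> L2 mu s' ->
  sums_to (L2norm mu) w s -> sums_to (L2norm mu) w s' -> {ae mu, forall x, s x = s' x}.
Proof.
move=> jw js js' /sums_to_N2 h /sums_to_N2 h'.
have jss := L2B js js'.
have [|e0] := eqVneq (sqn mu (s - s')) 0.
  move=> e0; have : N2 mu (s - s') = 0%E by rewrite L2_fin// e0.
  move=> /(N2_eq0 (L2_meas jss)); apply: filterS => x /eqP.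
  by rewrite subr_eq0 => /eqP.
have ep : 0 < sqn mu (s - s') / 4 by rewrite divr_gt0// lt_neqAle eq_sym e0 sqn_ge0.
have [F hF] := h _ ep; have [G hG] := h' _ ep.
have := hF _ (fsubsetUl F G); have := hG _ (fsubsetUr F G).
have jS : L2 mu (\sum_(i <- fsetU F G) w i) by exact: L2_sum.
rewrite N2B !L2_fin; do ?[exact: L2B]; rewrite !lte_fin => h1 h2.
by have := sqnB_le js js' jS; lra.
Qed.

Lemma sums_toD w w' s s' : (forall i, L2 mu (w i)) -> (forall i, L2 mu (w' i)) ->
  L2 mu s -> L2 mu s' ->
  sums_to (L2norm mu) w s -> sums_to (L2norm mu) w' s' ->
  sums_to (L2norm mu) (fun i => w i + w' i) (s + s').
Proof.
move=> jw jw' js js' /sums_to_N2 h /sums_to_N2 h'; apply/sums_to_N2 => eps e0.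
have ep : 0 < eps / 4 by rewrite divr_gt0.
have [F hF] := h _ ep; have [G hG] := h' _ ep.
exists (fsetU F G) => K; rewrite fsubUset => /andP[/hF + /hG].
have jS v (K' : {fset I}) : (forall i, L2 mu (v i)) -> L2 mu (\sum_(i <- K') v i).
  by move=> ?; exact: L2_sum.
rewrite big_split/= opprD addrACA !L2_fin;
  do ?[by repeat (first [apply: L2B|apply: L2D|exact: jS])].
rewrite !lte_fin => h1 h2.
have := sqnD_le (L2B js (jS _ K jw)) (L2B js' (jS _ K jw')); lra.
Qed.

Lemma sums_toN w s : sums_to (L2norm mu) w s -> sums_to (L2norm mu) (fun i => - w i) (- s).
Proof.
move=> /sums_to_N2 h; apply/sums_to_N2 => eps /h[F0 hF0]; exists F0 => F /hF0.
by rewrite sumrN -opprD N2N.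
Qed.

Lemma sums_to_pred1 (j : I) (v : T -> R[i]) :
  sums_to (L2norm mu) (fun i => if i == j then v else 0) v.
Proof.
apply/sums_to_N2 => eps e0; exists (fset1 j) => F; rewrite fsub1set => jF.
by rewrite fset_sum_pred1 jF subrr N2_0 lte_fin.
Qed.

Lemma eq_sums_to (V : zmodType) (N : V -> \bar R) (w w' : I -> V) (s : V) :
  (forall i, w i = w' i) -> sums_to N w s -> sums_to N w' s.
Proof. by move=> ww'; rewrite (_ : w = w')//; apply/funext. Qed.

Lemma sums_to_inner w s f : (forall i, L2 mu (w i)) -> L2 mu s -> L2 mu f ->
  sums_to (L2norm mu) w s ->
  sums_to (fun z => (mod z)%:E) (fun i => inner mu (w i) f) (inner mu s f).
Proof.
move=> jw js jf /sums_to_N2 h eps e0.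
have fp : 0 < sqn mu f + 1 by rewrite ltr_wpDl// sqn_ge0.
have [|F0 hF0] := h (eps ^+ 2 / (sqn mu f + 1)); first by rewrite divr_gt0// exprn_gt0.
exists F0 => F /hF0.
have jS : L2 mu (\sum_(i <- F) w i) by exact: L2_sum.
rewrite -inner_suml// -innerBl// L2_fin ?lte_fin; last exact: L2B.
rewrite ltr_pdivlMr// => h1.
rewrite -(ltr_pXn2r (n := 2)) ?nnegrE// ?ltW//.
apply: le_lt_trans h1; apply: le_trans (cauchy_schwarz (L2B js jS) jf) _.
by rewrite ler_wpM2l ?sqn_ge0// lerDl.
Qed.

(** A bound of the partial sums by those of a convergent series makes the net of
    partial sums Cauchy; it converges along an increasing sequence of finite sets
    that capture the tails, hence unconditionally. *)
Lemma sums_to_exists w (a : I -> R) (B : R) : 0 <= B -> (forall i, 0 <= a i) ->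
  (forall i, L2 mu (w i)) ->
  (forall F : {fset I}, (N2 mu (\sum_(i <- F) w i)%R <= (B * \sum_(i <- F) a i)%:E)%E) ->
  (\esum_(i in [set: I]) (a i)%:E < +oo)%E ->
  exists s, L2 mu s /\ sums_to (L2norm mu) w s.
Proof.
move=> B0 a0 jw wB aoo.
have B1 : 0 < B + 1 by rewrite ltr_wpDl.
have q0 n : 0 < (4^-1 : R) ^+ n by rewrite exprn_gt0// invr_gt0.
have tail n : exists F0 : {fset I}, forall F, fsubset F0 F ->
    forall G, fsubset F G -> \sum_(i <- fsetD G F) a i < 4^-1 ^+ n / (B + 1).
  by apply: esum_tail => //; rewrite divr_gt0.
have [G hG] := choice tail.
pose fix K n := if n is n'.+1 then fsetU (K n') (G n) else G 0%N.
have GK n : fsubset (G n) (K n) by case: n => [|n] /=; rewrite ?fsubsetUr// fsubset_refl.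
have Kmono n m : (n <= m)%N -> fsubset (K n) (K m).
  move=> /subnK <-; elim: (m - n)%N => [|k IH]; first exact: fsubset_refl.
  by rewrite addSn; apply: (fsubset_trans IH); exact: fsubsetUl.
have small n F : fsubset (K n) F ->
    (N2 mu (\sum_(i <- F) w i - \sum_(i <- K n) w i)%R <= (4^-1 ^+ n)%:E)%E.
  move=> KF; rewrite (big_fsetD_sub _ KF) addrAC subrr add0r.
  apply: le_trans (wB _) _; rewrite lee_fin.
  have := hG n (K n) (GK n) F KF; rewrite ltr_pdivlMr// => h.
  apply: le_trans (ltW h); rewrite mulrC ler_wpM2l ?lerDl//.
  by apply: sumr_ge0.
have [|n m nm|s [js hs]] := @riesz_fischer _ _ _ mu (fun n => \sum_(i <- K n) w i).
- by move=> n; exact: L2_sum.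
- exact/small/Kmono.
exists s; split => //; apply/sums_to_N2 => eps e0.
(* both distances to the sum over K n are at most 4^-n, and each counts twice in
   the squared triangle inequality *)
have [n hn] : exists n, 4 * 4^-1 ^+ n < eps.
  have : 4 * (4^-1 : R) ^+ n @[n --> \oo] --> (4 * 0 : R).
    by apply: cvgM; [exact: cvg_cst|apply: cvg_expr; rewrite ger0_norm// invf_lt1// ltr1n].
  rewrite mulr0 => /cvgrPdist_lt/(_ _ e0)[n _ /(_ n (leqnn _))] /=.
  rewrite sub0r normrN => h; exists n; exact: le_lt_trans (ler_norm _) h.
exists (K n) => F KF.
have jS (F' : {fset I}) : L2 mu (\sum_(i <- F') w i) by exact: L2_sum.
have := hs n; have := small n F KF.
rewrite [X in (X <= _)%E -> _]N2B !L2_fin; do ?[exact: L2B].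
rewrite !lee_fin lte_fin => h1 h2; have := sqnB_le js (jS F) (jS (K n)); lra.
Qed.

End SumsInL2.

(** * Orthogonal expansions *)

Section OrthogonalFamily.
Context d (T : measurableType d) (R : realType).
Variable mu : {measure set T -> \bar R}.
Context {I : choiceType}.
Variables (u : I -> T -> R[i]) (v : R).
Hypothesis u_L2 : forall i, L2 mu (u i).
Hypothesis v_gt0 : 0 < v.
Hypothesis u_orth : forall i j, inner mu (u i) (u j) = if i == j then v%:C else 0.
Implicit Types (f g s : T -> R[i]) (c : I -> R[i]).

Let cu_L2 c i : L2 mu (fun x => c i * u i x). Proof. exact: L2Z. Qed.

Lemma inner_orthogonal_sum c (F : {fset I}) j :
  inner mu (\sum_(i <- F) (fun x => c i * u i x)) (u j) =
  if j \in F then c j * v%:C else 0.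
Proof.
rewrite inner_suml// -(fset_sum_pred1 j (c j * v%:C) F); apply: eq_bigr => i _.
by rewrite innerZl// u_orth; case: eqP => [->//|_]; rewrite mulr0.
Qed.

Lemma sqn_orthogonal_sum c (F : {fset I}) :
  sqn mu (\sum_(i <- F) (fun x => c i * u i x)) = v * \sum_(i <- F) mod (c i) ^+ 2.
Proof.
apply: complexI; rewrite -inner_self inner_sumr//; last exact: L2_sum.
rewrite mulr_sumr rmorph_sum; apply: eq_big_seq => i iF.
rewrite innerZr//; last exact: L2_sum.
by rewrite inner_orthogonal_sum iF mulrA [conjc _ * _]mulrC mulcJ mulrC -rmorphM.
Qed.

Lemma inner_orthogonal_expansion c s j : L2 mu s ->
  sums_to (L2norm mu) (fun i x => c i * u i x) s -> inner mu s (u j) = c j * v%:C.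
Proof.
move=> js cs; have h := sums_to_inner (cu_L2 c) js (u_L2 j) cs.
apply: csums_to_unique h _ => eps e0; exists (fset1 j) => F; rewrite fsub1set => jF.
by rewrite -inner_suml// inner_orthogonal_sum jF subrr mod0 lte_fin.
Qed.

Lemma sqn_orthogonal_expansion c s : L2 mu s ->
  sums_to (L2norm mu) (fun i x => c i * u i x) s ->
  (\esum_(i in [set: I]) (v * mod (c i) ^+ 2)%:E)%E = N2 mu s.
Proof.
move=> js cs; rewrite L2_fin//; apply: esum_sums_to.
  by move=> i; rewrite mulr_ge0 ?sqr_ge0// ltW.
rewrite -inner_self; apply: eq_sums_to (sums_to_inner (cu_L2 c) js js cs) => i.
rewrite innerZl// (innerJ js (u_L2 i)) (inner_orthogonal_expansion _ js cs).
by rewrite conjcM conjc_real mulrA mulcJ -rmorphM mulrC.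
Qed.

Lemma bessel f (F : {fset I}) : L2 mu f ->
  \sum_(i <- F) mod (inner mu f (u i) / v%:C) ^+ 2 <= sqn mu f / v.
Proof.
move=> jf; set c := fun i => inner mu f (u i) / v%:C.
have v0 : v%:C != 0 :> R[i] by rewrite realC_neq0// gt_eqF.
have jS : L2 mu (\sum_(i <- F) (fun x => c i * u i x)) by exact: L2_sum.
have := sqn_ge0 mu (f - \sum_(i <- F) (fun x => c i * u i x)).
rewrite sqnB// sqn_orthogonal_sum inner_sumr//.
rewrite (_ : \sum_(i <- F) _ = (v * \sum_(i <- F) mod (c i) ^+ 2)%:C); last first.
  rewrite mulr_sumr rmorph_sum; apply: eq_bigr => i _.
  rewrite innerZr// -[inner mu f (u i)](divfK v0) -/(c i) mulrA [conjc _ * _]mulrC.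
  by rewrite mulcJ mulrC -rmorphM.
by rewrite /= ler_pdivlMr// [_ * v]mulrC; lra.
Qed.

Lemma l2_fourier f : L2 mu f -> l2 (fun i => inner mu f (u i) / v%:C).
Proof. by move=> jf; apply: (@l2_bound _ _ _ (sqn mu f / v)) => F; exact: bessel. Qed.

Lemma orthogonal_sums_to c : l2 c ->
  exists s, L2 mu s /\ sums_to (L2norm mu) (fun i x => c i * u i x) s.
Proof.
move=> c2; apply: (@sums_to_exists _ _ _ _ _ _ (fun i => mod (c i) ^+ 2) v) => //.
- exact: ltW.
- by move=> i; exact: sqr_ge0.
- by move=> F; rewrite L2_fin ?sqn_orthogonal_sum//; exact: L2_sum.
Qed.

(* The exponentials are total among the functions supported in one period only,
   hence the support conditions. *)
Variable D : set T.
Hypothesis mD : measurable D.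
Hypothesis u_supp : forall i x, ~ D x -> u i x = 0.
Hypothesis u_total : forall f, L2 mu f -> (forall x, ~ D x -> f x = 0) ->
  (forall i, inner mu f (u i) = 0) -> {ae mu, forall x, f x = 0}.

Lemma orthogonal_sums_to_supp c : l2 c ->
  exists s, [/\ L2 mu s, forall x, ~ D x -> s x = 0 &
    sums_to (L2norm mu) (fun i x => c i * u i x) s].
Proof.
move=> c2; have [s [js hs]] := orthogonal_sums_to c2.
have mi : cmeasurable (fun x => (\1_D x : R)%:C) by exact: cmeasurable_indic.
have mi1 x : mod ((\1_D x : R)%:C) <= 1.
  by rewrite modR indicE; case: (_ \in _); rewrite ?normr1 ?normr0.
have js' := L2Mbounded mi mi1 js.
exists (fun x => s x * (\1_D x)%:C); split => //.
  by move=> x xD; rewrite indicE memNset// mulr0.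
move: hs => /sums_to_N2 hs; apply/sums_to_N2 => eps /hs[F0 hF0]; exists F0 => F /hF0.
apply: le_lt_trans; apply: N2_le.
- by apply: cmeasurableB; [exact: L2_meas js'|apply/L2_meas/L2_sum => i; exact: L2Z].
- by apply: cmeasurableB; [exact: L2_meas js|apply/L2_meas/L2_sum => i; exact: L2Z].
- apply: nearW => x; rewrite -[X in mod X]/(s x * _ - _ x) -[X in _ <= mod X]/(s x - _ x).
  rewrite indicE; have [xD|xD] := pselect (D x); first by rewrite mem_set// mulr1.
  rewrite memNset// mulr0 (_ : (\sum_(i <- F) _) x = 0); first by rewrite subr0 mod0.
  by rewrite fct_sumE big1// => i _; rewrite u_supp// mulr0.
Qed.

(** The difference between [f] and the sum of its Fourier series is orthogonal to
    a total family. *)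
Lemma orthogonal_expansion f : L2 mu f -> (forall x, ~ D x -> f x = 0) ->
  sums_to (L2norm mu) (fun i x => (inner mu f (u i) / v%:C) * u i x) f.
Proof.
move=> jf fD; have [s [js sD hs]] := orthogonal_sums_to_supp (l2_fourier jf).
have v0 : v%:C != 0 :> R[i] by rewrite realC_neq0// gt_eqF.
apply: (sums_to_ae_eq (cu_L2 _) js (L2_meas jf) _ hs).
have : {ae mu, forall x, (f - s) x = 0}.
  apply: u_total; first exact: L2B.
  - by move=> x xD; rewrite -[LHS]/(f x - s x) fD// sD// subrr.
  - by move=> j; rewrite innerBl// (inner_orthogonal_expansion _ js hs) divfK// subrr.
by apply: filterS => x /eqP; rewrite subr_eq0 => /eqP ->.
Qed.

Lemma parseval f : L2 mu f -> (forall x, ~ D x -> f x = 0) ->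
  (\esum_(i in [set: I]) (mod (inner mu f (u i)) ^+ 2 / v)%:E)%E = N2 mu f.
Proof.
move=> jf fD; rewrite -(sqn_orthogonal_expansion jf (orthogonal_expansion jf fD)).
apply: eq_esum => i _; congr EFin.
rewrite modM -rmorphV ?unitfE ?gt_eqF// modR ger0_norm ?invr_ge0 ?ltW//.
by field; rewrite gt_eqF.
Qed.

End OrthogonalFamily.

(** * Least squares approximation by l^2 combinations *)

Section NormalEquations.
Context d (T : measurableType d) (R : realType).
Variable mu : {measure set T -> \bar R}.
Context {I : choiceType}.
Variable u : I -> T -> R[i].
Hypothesis u_L2 : forall i, L2 mu (u i).
Implicit Types (f g s : T -> R[i]) (c : I -> R[i]).

(** A relation, not a function of [c], as the sum is determined up to a null set
    only. *)
Definition expands c s : Prop :=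
  L2 mu s /\ sums_to (L2norm mu) (fun i x => c i * u i x) s.

Lemma expandsD c c' s s' : expands c s -> expands c' s' ->
  expands (fun i => c i + c' i) (s + s').
Proof.
move=> [js hs] [js' hs']; split; first exact: L2D.
apply: eq_sums_to (sums_toD _ _ js js' hs hs') => [i|i|i]; do ?[exact: L2Z].
by apply/funext => x; rewrite mulrDl.
Qed.

Lemma expandsN c s : expands c s -> expands (fun i => - c i) (- s).
Proof.
move=> [js hs]; split; first exact: L2N.
by apply: eq_sums_to (sums_toN hs) => i; apply/funext => x; rewrite mulNr.
Qed.

Lemma expands_pred1 j (a : R[i]) :
  expands (fun i => if i == j then a else 0) (fun x => a * u j x).
Proof.
split; first exact: L2Z.
apply: eq_sums_to (sums_to_pred1 mu j (fun x => a * u j x)) => i.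
by apply/funext => x; case: eqP => [->//|_]; rewrite mul0r.
Qed.

Lemma expands_orth c s g : L2 mu g -> expands c s ->
  (forall i, inner mu g (u i) = 0) -> inner mu g s = 0.
Proof.
move=> jg [js hs] g0; rewrite innerJ// -conjc0; congr conjc.
have h := sums_to_inner (fun i => L2Z (c i) (u_L2 i)) js jg hs.
apply: csums_to_unique h _ => eps e0; exists fset0 => F _.
rewrite big1 ?subr0 ?mod0 ?lte_fin// => i _.
by rewrite innerZl// (innerJ jg (u_L2 i)) g0 conjc0 mulr0.
Qed.

(** Perturbing one coefficient in the direction of the residual shows that a
    minimizer has its residual orthogonal to every [u i]; the converse is
    Pythagoras. *)
Lemma normal_equations f c s : L2 mu f -> l2 c -> expands c s ->
  (forall c' s', l2 c' -> expands c' s' -> sqn mu (f - s) <= sqn mu (f - s')) <->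
  (forall i, inner mu (f - s) (u i) = 0).
Proof.
move=> jf c2 es; have js := es.1; have jr := L2B jf js.
split=> [best i|orth c' s' _ es'].
- set a := inner mu (f - s) (u i).
  have key (t : R) : 0 <= - 2 * t * mod a ^+ 2 + t ^+ 2 * mod a ^+ 2 * sqn mu (u i).
    have jt := L2Z (t%:C * a) (u_L2 i).
    have := best _ _ (l2D c2 (l2_pred1 i (t%:C * a))) (expandsD es (expands_pred1 i _)).
    rewrite opprD addrA (sqnB jr jt) innerZr// sqnZ// -/a.
    rewrite modM modR exprMn real_normK ?num_real//.
    rewrite conjcM conjc_real -mulrA [conjc a * a]mulrC mulcJ -rmorphM /=.
    by lra.
  have U0 := sqn_ge0 mu (u i).
  apply: mod_eq0; apply/eqP; rewrite -sqrf_eq0; apply/eqP.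
  (* a step small with respect to the squared norm of u i; adding 1 covers the
     case in which that norm vanishes *)
  have := key ((sqn mu (u i) + 1)^-1).
  set U := sqn mu (u i) in U0 *; set z := mod a ^+ 2.
  have z0 : 0 <= z by rewrite sqr_ge0.
  have U1 : U + 1 != 0 by rewrite gt_eqF// ltr_wpDl.
  rewrite (_ : _ + _ = - z * (U + 2) / (U + 1) ^+ 2); last by field.
  rewrite pmulr_lge0 ?invr_gt0 ?exprn_gt0 ?ltr_wpDl// => h.
  by apply/eqP; rewrite eq_le z0 andbT; nra.
- have ed := expandsD es (expandsN es').
  rewrite (_ : f - s' = (f - s) + (s - s')); last by rewrite addrA subrK.
  by rewrite (sqnD jr ed.1) (expands_orth jr ed orth) /= mulr0 addr0 lerDl sqn_ge0.
Qed.

End NormalEquations.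

(** * Uniqueness of Fourier coefficients *)

Section StepPolynomials.
Context {R : realType}.
Implicit Types t v : R.

Lemma bernoulli_ge t n : 0 <= t -> 1 + n%:R * t <= (1 + t) ^+ n.
Proof.
move=> t0; elim: n => [|n IH]; first by rewrite expr0 mul0r addr0.
rewrite exprS; apply: (@le_trans _ _ ((1 + t) * (1 + n%:R * t))).
  rewrite -[n.+1%:R]natr1; have : 0 <= n%:R * t * t by rewrite !mulr_ge0.
  by lra.
by rewrite ler_wpM2l// addr_ge0.
Qed.

Lemma bernoulli_le t n : 0 <= t <= 1 -> 1 - n%:R * t <= (1 - t) ^+ n.
Proof.
move=> /andP[t0 t1]; elim: n => [|n IH]; first by rewrite expr0 mul0r subr0.
rewrite exprS; apply: (@le_trans _ _ ((1 - t) * (1 - n%:R * t))).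
  rewrite -[n.+1%:R]natr1; have : 0 <= n%:R * t * t by rewrite !mulr_ge0.
  by lra.
by rewrite ler_wpM2l// subr_ge0.
Qed.

(** These polynomials map the unit interval to itself and tend to a step at 1/2,
    by Bernoulli's inequality. *)
Definition step_poly n v : R := (1 - v ^+ n) ^+ (2 ^ n).

Lemma step_poly_itv n v : 0 <= v <= 1 -> 0 <= step_poly n v <= 1.
Proof.
move=> /andP[v0 v1]; have /andP[w0 w1] : 0 <= v ^+ n <= 1.
  by rewrite exprn_ge0//= exprn_ile1.
by rewrite exprn_ge0 ?exprn_ile1 ?subr_ge0//= ?lerBlDr ?lerDl.
Qed.

Lemma step_poly_cvg1 v : 0 <= v < 2^-1 -> step_poly n v @[n --> \oo] --> (1 : R).
Proof.
move=> /andP[v0 v1]; have v1' : v <= 1 by lra.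
apply: (squeeze_cvgr (f := fun n => 1 - (2 * v) ^+ n) (h := fun=> 1)).
- apply: nearW => n.
  have /andP[_ ->] := step_poly_itv n (introT andP (conj v0 v1')).
  rewrite andbT /step_poly exprMn -natrX.
  by apply: bernoulli_le; rewrite exprn_ge0//= exprn_ile1.
- rewrite -[X in _ --> X]subr0; apply: cvgB; first exact: cvg_cst.
  by apply: cvg_expr; rewrite ger0_norm ?mulr_ge0//; lra.
- exact: cvg_cst.
Qed.

Lemma step_poly_cvg0 v : 2^-1 < v <= 1 -> step_poly n v @[n --> \oo] --> (0 : R).
Proof.
move=> /andP[v0 v1]; have vp : 0 < v by lra.
apply: (squeeze_cvgr (f := fun=> 0) (h := fun n => ((2 * v)^-1) ^+ n)).
- apply: nearW => n.
  have v01 : 0 <= v <= 1 by rewrite v1 ltW.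
  have /andP[q0 _] := step_poly_itv n v01; rewrite q0 /=.
  have p0 : 0 < (2 * v) ^+ n by rewrite exprn_gt0// mulr_gt0.
  rewrite exprVn -[leLHS](mulfK (lt0r_neq0 p0)) ler_piMl ?invr_ge0 ?(ltW p0)//.
  have w0 : 0 <= v ^+ n by rewrite exprn_ge0// (ltW vp).
  have w1 : v ^+ n <= 1 by rewrite exprn_ile1// (ltW vp).
  apply: (@le_trans _ _ (step_poly n v * (1 + v ^+ n) ^+ (2 ^ n))).
    rewrite ler_wpM2l//; apply: le_trans (bernoulli_ge _ w0).
    by rewrite exprMn -natrX lerDr.
  rewrite /step_poly -exprMn exprn_ile1//.
    by rewrite mulr_ge0 ?subr_ge0 ?addr_ge0.
  by have := sqr_ge0 (v ^+ n); lra.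
- exact: cvg_cst.
- apply: cvg_expr; rewrite ger0_norm ?invr_ge0 ?mulr_ge0 ?(ltW vp)// invf_lt1 ?mulr_gt0//.
  by lra.
Qed.

End StepPolynomials.

(** Class inference does not look through the constants [leb] and [leb2]. *)
#[global] Instance ae_leb_filter {R : realType} :
  Filter (nbhs (almost_everywhere (@leb R))).
Proof. exact: ae_filter_ringOfSetsType. Qed.

#[global] Instance ae_leb2_filter {R : realType} :
  Filter (nbhs (almost_everywhere (@leb2 R))).
Proof. exact: ae_filter_ringOfSetsType. Qed.

Section FourierUniqueness.
Context {R : realType}.
Variable w : R.
Hypothesis w_gt0 : 0 < w.

Let D : set R := `[0, w^-1[%classic.
Local Notation fexp k x := (expi (2 * pi * (k%:~R * w * x))).

Lemma cmeasurable_expi_mul (c : R) :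
  @cmeasurable _ (measurableTypeR R) R (fun x => expi (c * x)).
Proof. by apply: cmeasurable_expi; exact: mulrl_measurable. Qed.

Lemma cmeasurable_fexp (k : int) :
  @cmeasurable _ (measurableTypeR R) R (fun x => fexp k x).
Proof. by under eq_fun do rewrite mulrA; exact: cmeasurable_expi_mul. Qed.

Lemma cint_limit0 d (T : measurableType d) (mu : {measure set T -> \bar R})
    (F : nat -> T -> R[i]) (g h : T -> R[i]) :
  (forall n, cmeasurable (F n)) -> cmeasurable g -> cintegrable mu h ->
  (forall n x, mod (F n x) <= mod (h x)) ->
  {ae mu, forall x, complex.Re (F n x) @[n --> \oo] --> complex.Re (g x)} ->
  {ae mu, forall x, complex.Im (F n x) @[n --> \oo] --> complex.Im (g x)} ->
  (forall n, cint mu (F n) = 0) -> cint mu g = 0.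
Proof.
move=> mF mg jh Fh cR cI F0.
have ih : mu.-integrable setT (cmod h).
  apply/integrableP; split; first exact: measurable_cmod jh.1.
  by under eq_integral do rewrite gee0_abs//; exact: jh.2.
have part (p : R[i] -> R) : (forall f : T -> R[i], cmeasurable f -> measurable_fun setT (p \o f)) ->
    (forall z, `|p z| <= mod z) ->
    {ae mu, forall x, p (F n x) @[n --> \oo] --> p (g x)} ->
    (forall n, \int[mu]_x p (F n x) = 0) -> \int[mu]_x p (g x) = 0.
  move=> mp p1 pc p0.
  have mFp n : measurable_fun setT (EFin \o (p \o F n)).
    by apply/measurable_EFinP; exact: mp.
  have mgp : measurable_fun setT (EFin \o (p \o g)).
    by apply/measurable_EFinP; exact: mp.
  have [||ig _] := dominated_convergence measurableT mFp mgp _ ih.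
  - by apply: filterS pc => x h' _; apply/fine_cvgP; split; [exact: nearW|exact: h'].
  - apply: nearW => x n _; rewrite /cmod /= lee_fin; exact: le_trans (p1 _) (Fh n x).
  have iFn n : (\int[mu]_x (EFin \o (p \o F n)) x = 0)%E.
    have fin : mu.-integrable setT (EFin \o (p \o F n)).
      apply: (le_integrable measurableT (mFp n) _ ih) => x _.
      by rewrite /cmod /= lee_fin [leRHS]ger0_norm//; exact: le_trans (p1 _) (Fh n x).
    by rewrite -(fineK (integrable_fin_num measurableT fin)) -[fine _]/(\int[mu]_x p (F n x)) p0.
  rewrite (_ : [sequence _]_n = fun=> 0%E); last by apply/funext => n; exact: iFn.
  move=> /(cvg_lim _) /=; rewrite lim_cst// => /(_ (@ereal_hausdorff _)) h0.
  by rewrite /Rintegral -[X in fine X]h0.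
apply: complex_eq; rewrite /cint /=.
- apply: (part (@complex.Re R)) => //; first by move=> f [].
  + exact: ler_Re_mod.
  + by move=> n; have /(congr1 (@complex.Re R)) := F0 n.
- apply: (part (@complex.Im R)) => //; first by move=> f [].
  + exact: ler_Im_mod.
  + by move=> n; have /(congr1 (@complex.Im R)) := F0 n.
Qed.

Section Annihilator.
Variable f : R -> R[i].
Hypothesis f_int : cintegrable leb f.

(* As all frequencies k are quantified over, this class of multipliers is stable
   under multiplication by trigonometric polynomials. *)
Let kill (g : R -> R[i]) : Prop :=
  [/\ @cmeasurable _ (measurableTypeR R) R g, exists c, forall x, mod (g x) <= c &
      forall k : int, cint leb (fun x => f x * g x * fexp k x) = 0].

Let jfg g k : kill g -> cintegrable leb (fun x => f x * g x * fexp k x).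
Proof.
move=> [mg [c gc] _].
apply: (@cintegrableMbounded _ _ _ _ _ _ 1); last exact: cintegrableMbounded mg gc f_int.
  exact: cmeasurable_fexp.
by move=> x; rewrite mod_expi.
Qed.

Let killD g g' (a b : R[i]) : kill g -> kill g' -> kill (fun x => a * g x + b * g' x).
Proof.
move=> kg kg'; have [mg [c gc] g0] := kg; have [mg' [c' gc'] g0'] := kg'; split.
- by apply: cmeasurableD; exact: cmeasurableZ.
- exists (mod a * c + mod b * c') => x; apply: le_trans (modD _ _) _.
  by rewrite !modM lerD// ler_wpM2l.
- move=> k.
  rewrite (@eq_cint _ _ _ leb _ (fun x => a * (f x * g x * fexp k x) + b * (f x * g' x * fexp k x))).
    rewrite cintD; do ?[by apply: cintegrableZ; exact: jfg].
    by rewrite !cintZ ?g0 ?g0' ?mulr0 ?addr0//; exact: jfg.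
  by move=> x; ring.
Qed.

Let kill_expi g (j : int) : kill g -> kill (fun x => fexp j x * g x).
Proof.
move=> [mg [c gc] g0]; split.
- apply: cmeasurableM => //.
  exact: cmeasurable_fexp.
- by exists c => x; rewrite modM mod_expi mul1r.
- move=> k; rewrite -(g0 (j + k)); apply: eq_cint => x.
  rewrite (_ : 2 * pi * ((j + k)%:~R * w * x) =
    2 * pi * (j%:~R * w * x) + 2 * pi * (k%:~R * w * x)); last by rewrite intrD; ring.
  by rewrite expiD; ring.
Qed.

Variable y : R.
Hypothesis y_gt0 : 0 < y.
Hypothesis y_le : y <= w^-1.

(* A trigonometric polynomial that lies below 1/2 on ]0, y[ and above 1/2 on the
   rest of the period: the difference of cosines is
   2 sin(pi w x) sin(pi w (y - x)). *)
Let level x : R := 2^-1 - (cos (2 * pi * w * x - pi * w * y) - cos (pi * w * y)) / 4.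

Let level_itv (x : R) : 0 <= level x <= 1.
Proof.
rewrite /level.
have := cos_le1 (2 * pi * w * x - pi * w * y).
have := cos_geN1 (2 * pi * w * x - pi * w * y).
have := cos_le1 (pi * w * y); have := cos_geN1 (pi * w * y).
by move=> *; apply/andP; split; lra.
Qed.

Let level_sin (x : R) : level x = 2^-1 - sin (pi * w * x) * sin (pi * w * (y - x)) / 2.
Proof.
rewrite /level (_ : 2 * pi * w * x - _ = pi * w * x - pi * w * (y - x)); last by ring.
rewrite (_ : pi * w * y = pi * w * x + pi * w * (y - x)); last by ring.
by rewrite cosB cosD; field.
Qed.

Let sin_pos (t : R) : 0 < t < w^-1 -> 0 < sin (pi * w * t).
Proof.
move=> /andP[t0 t1]; apply: sin_gt0_pi; rewrite !mulr_gt0 ?pi_gt0//=.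
rewrite -mulrA gtr_pMr ?pi_gt0//.
by rewrite -ltr_pdivlMl// mulr1.
Qed.

Let level_lt (x : R) : 0 < x < y -> level x < 2^-1.
Proof.
move=> /andP[x0 xy]; rewrite level_sin.
have s1 := sin_pos (introT andP (conj x0 (lt_le_trans xy y_le))).
have yx : 0 < y - x < w^-1.
  by rewrite subr_gt0 xy /= (lt_le_trans _ y_le)// ltrBlDr ltrDl.
by have := mulr_gt0 s1 (sin_pos yx); lra.
Qed.

Let level_gt (x : R) : y < x < w^-1 -> 2^-1 < level x.
Proof.
move=> /andP[x0 xy]; rewrite level_sin.
have xx : 0 < x < w^-1 by rewrite xy andbT; exact: lt_trans y_gt0 x0.
have yx : 0 < x - y < w^-1.
  by rewrite subr_gt0 x0 /= (lt_trans _ xy)// ltrBlDr ltrDl.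
have := mulr_gt0 (sin_pos xx) (sin_pos yx).
by rewrite -opprB mulrN sinN; lra.
Qed.

Let kill_level g : kill g -> kill (fun x => (level x)%:C * g x).
Proof.
move=> kg.
pose a : R[i] := (2^-1 + cos (pi * w * y) / 4)%:C.
pose b : R[i] := - (8^-1)%:C * expi (- (pi * w * y)).
have k1 := killD a 1 kg (killD b (conjc b) (kill_expi 1 kg) (kill_expi (-1) kg)).
move: k1; congr kill; apply/funext => x.
rewrite mul1r !mulrA -!mulrDl; congr (_ * _).
rewrite (_ : 2 * pi * 1%:~R * w * x = 2 * pi * w * x); last by rewrite mulr1z; ring.
rewrite (_ : 2 * pi * (-1)%:~R * w * x = - (2 * pi * w * x)); last by rewrite mulrN1z; ring.
rewrite /level /a /b cosB.
by apply: complex_eq; rewrite /= ?cosN ?sinN; field.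
Qed.

Let kill_pow g n : kill g -> kill (fun x => ((level x) ^+ n)%:C * g x).
Proof.
move=> kg; elim: n => [|n IH].
  by move: kg; congr kill; apply/funext => x; rewrite expr0 mul1r.
move: (kill_level IH); congr kill; apply/funext => x.
by rewrite exprS mulrA -rmorphM.
Qed.

Let kill_step g n m : kill g -> kill (fun x => ((1 - level x ^+ n) ^+ m)%:C * g x).
Proof.
move=> kg; elim: m => [|m IH].
  by move: kg; congr kill; apply/funext => x; rewrite expr0 mul1r.
move: (killD 1 (-1) IH (kill_pow n IH)); congr kill; apply/funext => x.
rewrite exprS rmorphM rmorphB /=; ring.
Qed.

Hypothesis f_supp : forall x, ~ D x -> f x = 0.
Hypothesis f_coef : forall k : int, cint leb (fun x => f x * fexp k x) = 0.

(** The trigonometric polynomials [step_poly n \o level] tend boundedly to the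
    indicator of the interval. *)
Lemma cint_interval_eq0 : cint leb (fun x => f x * (\1_(`]0, y[%classic) x)%:C) = 0.
Proof.
have k1 : kill (fun=> 1).
  split; [exact: cmeasurable_cst|by exists 1 => x; rewrite mod1|move=> k].
  by rewrite -[RHS](f_coef k); apply: eq_cint => x; rewrite mulr1.
have kn n : cint leb (fun x => f x * (step_poly n (level x))%:C) = 0.
  have [_ _ /(_ 0)] := kill_step n (2 ^ n) k1.
  rewrite (@eq_cint _ _ _ leb _ (fun x => f x * (step_poly n (level x))%:C))// => x.
  by rewrite mul0r mul0r mulr0 expi0 !mulr1.
have mlevel : @measurable_fun _ _ (measurableTypeR R) (measurableTypeR R) setT level.
  apply: measurable_funB; first exact: measurable_cst.
  apply: measurable_funM; last exact: measurable_cst.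
  apply: measurable_funB; last exact: measurable_cst.
  apply: (@measurableT_comp _ _ _ _ _ _ (@cos R)).
    by apply: continuous_measurable_fun; exact: continuous_cos.
  by apply: measurable_funB; [exact: mulrl_measurable|exact: measurable_cst].
have lim (x : R) : x != 0 -> x != y ->
    f x = 0 \/ step_poly n (level x) @[n --> \oo] --> (\1_(`]0, y[%classic) x : R).
  move=> x0 xy; have [Dx|/f_supp ->] := pselect (D x); last by left.
  right; have /andP[xge0 xw] : 0 <= x < w^-1 by move: Dx; rewrite /D /= in_itv.
  have x_gt0 : 0 < x by rewrite lt_neqAle eq_sym x0.
  have /andP[l0 l1] := level_itv x.
  have [yx|yx|yx] := ltgtP x y; last by rewrite yx eqxx in xy.
  + rewrite indicE mem_set/=; last by rewrite in_itv /= x_gt0.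
    by apply: step_poly_cvg1; rewrite l0 level_lt// x_gt0.
  + rewrite indicE memNset/=; last by rewrite in_itv /= [x < y]lt_gtF// andbF.
    by apply: step_poly_cvg0; rewrite l1 andbT level_gt// yx.
have mstep n : @cmeasurable _ (measurableTypeR R) R (fun x => (step_poly n (level x))%:C).
  apply: cmeasurable_real; apply: measurable_funX; apply: measurable_funB => //.
  exact: measurable_funX.
have neq (c : R) : {ae leb, forall x, x != c}.
  exists [set c]; split; [exact: measurable_set1|exact: lebesgue_measure_set1|].
  by move=> x /= /negP; rewrite negbK => /eqP.
apply: (@cint_limit0 _ (measurableTypeR R) leb (fun n x => f x * (step_poly n (level x))%:C) _ f) => //.
- by move=> n; apply: cmeasurableM => //; case: f_int.
- by apply: cmeasurableM; [case: f_int|apply: cmeasurable_indic; exact: measurable_itv].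
- move=> n x; rewrite modM modR ler_piMr//.
  by have /andP[q0 q1] := step_poly_itv n (level_itv x); rewrite ger0_norm.
- apply: filterS2 (neq 0) (neq y) => x x0 xy; have [->|h] := lim x x0 xy.
    by under eq_fun do rewrite mul0r; rewrite mul0r; exact: cvg_cst.
  by under eq_fun do rewrite cReMr; rewrite cReMr; apply: cvgM => //; exact: cvg_cst.
- apply: filterS2 (neq 0) (neq y) => x x0 xy; have [->|h] := lim x x0 xy.
    by under eq_fun do rewrite mul0r; rewrite mul0r; exact: cvg_cst.
  by under eq_fun do rewrite cImMr; rewrite cImMr; apply: cvgM => //; exact: cvg_cst.
Qed.

End Annihilator.

(** By Lebesgue's differentiation theorem the function is almost everywhere the
    derivative of its primitive. *)
Lemma primitive_eq0 (r : R -> R) : (leb.-integrable setT (EFin \o r)) ->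
  (forall x : R, \int[leb]_(t in `]-oo, x]) r t = 0) -> {ae leb, forall x, r x = 0}.
Proof.
move=> ir r0.
have loc : locally_integrable [set: R] r.
  by apply: open_integrable_locally; [exact: openT|exact: ir].
have iry (x : R) : (@lebesgue_measure R).-integrable `]-oo, x] (EFin \o r).
  by apply: integrableS ir => //; exact: measurable_itv.
apply: filterS (FTC1Ny iry loc) => x /= [_ <-].
by rewrite (_ : (fun _ => _) = cst 0) ?derive1_cst//; apply/funext => t; exact: r0.
Qed.

(** The integrals over all the intervals that start at 0 vanish by
    [cint_interval_eq0], hence so does the primitive. *)
Lemma fourier_unique (f : R -> R[i]) : cintegrable leb f ->
  (forall x, ~ D x -> f x = 0) ->
  (forall k : int, cint leb (fun x => f x * fexp k x) = 0) ->
  {ae leb, forall x, f x = 0}.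
Proof.
move=> jf f_supp f_coef.
have [iR iI] : leb.-integrable setT (fun x => (complex.Re (f x))%:E) /\
   leb.-integrable setT (fun x => (complex.Im (f x))%:E) by exact/cintegrableP.
have neq (c : R) : {ae leb, forall x, x != c}.
  exists [set c]; split; [exact: measurable_set1|exact: lebesgue_measure_set1|].
  by move=> x /= /negP; rewrite negbK => /eqP.
have w1 : 0 < w^-1 by rewrite invr_gt0.
have prim (p : R[i] -> R) : p 0 = 0 -> (forall z (r : R), p (z * r%:C) = p z * r) ->
   leb.-integrable setT (fun x => (p (f x))%:E) ->
   (forall y : R, 0 < y -> y <= w^-1 ->
     \int[leb]_t p (f t * (\1_(`]0, y[%classic) t)%:C) = 0) ->
   {ae leb, forall x, p (f x) = 0}.
  move=> p0 pM ip py; apply: primitive_eq0 => // x.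
  have mp : measurable_fun setT (fun x => (p (f x))%:E) by exact: measurable_int ip.
  have mP (A : set R) : measurable A ->
      measurable_fun setT (fun t => (p (f t) * \1_A t)%:E).
    move=> mA; apply/measurable_EFinP; apply: measurable_funM.
      exact/measurable_EFinP.
    exact: measurable_indic.
  rewrite Rintegral_mkcond.
  rewrite (_ : _ \_ _ = fun t => p (f t) * \1_(`]-oo, x]%classic) t); last first.
    by apply/funext => t; rewrite patchE indicE; case: ifP => _; rewrite ?mulr1 ?mulr0.
  have [x0|x0] := leP x 0.
    rewrite /Rintegral (ae_eq_integral (cst 0%E)) ?integral0//; first exact: mP.
    apply: filterS (neq 0) => t t0 _; congr EFin; rewrite indicE.
    have [tx|tx] := leP t x; last first.
      by rewrite memNset ?mulr0//= in_itv /= leNgt tx.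
    rewrite f_supp ?p0 ?mul0r// /D /= in_itv /= => /andP[t1 _].
    by move/negP: t0; apply; rewrite eq_le t1 (le_trans tx).
  (* beyond the period the primitive is constant *)
  have m0 : 0 < Num.min x w^-1 by rewrite lt_min x0.
  have mw : Num.min x w^-1 <= w^-1 by rewrite ge_min lexx orbT.
  rewrite -[RHS](py _ m0 mw) /Rintegral; congr fine; apply: ae_eq_integral => //.
  - exact: mP.
  - by under eq_fun do rewrite pM; exact: mP.
  apply: filterS2 (neq 0) (neq x) => t t0 tx _; congr EFin; rewrite pM !indicE.
  have [Dt|/f_supp ->] := pselect (D t); last by rewrite p0 !mul0r.
  have /andP[tge tw] : 0 <= t < w^-1 by move: Dt; rewrite /D /= in_itv.
  congr (_ * (nat_of_bool _)%:R); apply/idP/idP; rewrite !inE /= !in_itv /= => h.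
  - by rewrite lt_min tw andbT; apply/andP; split; rewrite lt_neqAle ?tx ?h// eq_sym t0.
  - by move: h => /andP[_]; rewrite lt_min => /andP[/ltW].
have R0 : {ae leb, forall x, complex.Re (f x) = 0}.
  apply: (prim (@complex.Re R)) => //; first by move=> z r; rewrite cReMr.
  move=> y y0 yw; have /(congr1 (@complex.Re R)) := cint_interval_eq0 jf y0 yw f_supp f_coef.
  by [].
have I0 : {ae leb, forall x, complex.Im (f x) = 0}.
  apply: (prim (@complex.Im R)) => //; first by move=> z r; rewrite cImMr.
  move=> y y0 yw; have /(congr1 (@complex.Im R)) := cint_interval_eq0 jf y0 yw f_supp f_coef.
  by [].
by apply: filterS2 R0 I0 => x h1 h2; exact: complex_eq.
Qed.

End FourierUniqueness.

(** * Orthogonal bases of exponentials *)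

Section PeriodIntegrals.
Context {R : realType}.

Lemma FTC2_smooth (f F : R -> R) (a b : R) : a < b -> continuous f ->
  (forall x : R, is_derive x (1 : R) F (f x)) ->
  (\int[@lebesgue_measure R]_(x in `[a, b]) (f x)%:E = (F b - F a)%:E)%E.
Proof.
move=> ab cf dF; rewrite EFinB; apply: continuous_FTC2 => //.
- exact: continuous_subspaceT.
- have cF x : {for x, continuous F}.
    by apply: differentiable_continuous; apply/derivable1_diffP; apply: ex_derive.
  split; first by move=> x _; apply: ex_derive.
  + exact/cvg_at_right_filter/cF.
  + exact/cvg_at_left_filter/cF.
- by move=> x _; rewrite derive1E; apply: derive_val.
Qed.

Lemma continuous_mull (c : R) : continuous (fun x : R => c * x).
Proof. by move=> x; apply: cvgM; [exact: cvg_cst|exact: cvg_id]. Qed.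

Lemma is_derive_scaled (F f : R -> R) (c a x : R) : c != 0 ->
  is_derive (c * x) (1 : R) F (f (c * x)) ->
  is_derive x (1 : R) (fun x => a / c * F (c * x)) (a * f (c * x)).
Proof.
move=> c0 dF.
have h1 : is_derive x (1 : R) (fun x : R => c * x) c.
  have := @is_deriveZ _ _ _ id c x 1 1 (is_derive_id x 1).
  by rewrite -[X in is_derive _ _ _ X]/(c * 1) mulr1.
have h2 := @is_derive1_comp _ F (fun x : R => c * x) x _ _ dF h1.
have := @is_deriveZ _ _ _ _ (a / c) x 1 _ h2.
rewrite (_ : (a / c) *: (_ : R^o) = a * f (c * x))//.
by rewrite -[LHS]/(a / c * (f (c * x) * c)); field.
Qed.

Lemma integral_cos (c b : R) : 0 < b -> c != 0 ->
  (\int[@lebesgue_measure R]_(x in `[0%R, b]) (cos (c * x))%:E = (sin (c * b) / c)%:E)%E.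
Proof.
move=> b0 c0.
have cf : continuous (fun x => 1 * cos (c * x)).
  move=> x; apply: cvgM; first exact: cvg_cst.
  by apply: (@continuous_comp _ _ _ (fun x => c * x) cos);
    [exact: continuous_mull|exact: continuous_cos].
have := FTC2_smooth b0 cf (fun x => is_derive_scaled 1 c0 (is_derive_sin (c * x))).
under eq_integral do rewrite mul1r.
by move=> ->; rewrite mulr0 sin0 mulr0 subr0 mul1r mulrC.
Qed.

Lemma integral_sin (c b : R) : 0 < b -> c != 0 ->
  (\int[@lebesgue_measure R]_(x in `[0%R, b]) (sin (c * x))%:E = ((1 - cos (c * b)) / c)%:E)%E.
Proof.
move=> b0 c0.
have cf : continuous (fun x => -1 * - sin (c * x)).
  move=> x; apply: cvgM; first exact: cvg_cst.
  by apply: cvgN; apply: (@continuous_comp _ _ _ (fun x => c * x) sin);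
    [exact: continuous_mull|exact: continuous_sin].
have := FTC2_smooth b0 cf
  (fun x => is_derive_scaled (f := fun x => - sin x) (-1) c0 (is_derive_cos (c * x))).
under eq_integral do rewrite mulN1r opprK.
by move=> ->; rewrite mulr0 cos0; congr EFin; field.
Qed.

Lemma cint_indic_itvco (f : R -> R[i]) (b : R) :
  @cmeasurable _ (measurableTypeR R) R f ->
  cint leb (fun x => f x * (\1_(`[0, b[%classic) x)%:C) =
  fine (\int[@lebesgue_measure R]_(x in `[0%R, b]) (complex.Re (f x))%:E) +i*
  fine (\int[@lebesgue_measure R]_(x in `[0%R, b]) (complex.Im (f x))%:E).
Proof.
move=> [mR mI].
have part (p : R[i] -> R) : (forall z (r : R), p (z * r%:C) = p z * r) ->
    @measurable_fun _ _ (measurableTypeR R) (measurableTypeR R) setT (p \o f) ->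
    \int[leb]_x p (f x * (\1_(`[0, b[%classic) x)%:C) =
    fine (\int[@lebesgue_measure R]_(x in `[0%R, b]) (p (f x))%:E)%E.
  move=> pM mp; rewrite -integral_itv_bndo_bndc; last first.
    by apply/measurable_EFinP; apply: measurable_funTS.
  rewrite /Rintegral [in RHS]integral_mkcond; congr fine; apply: eq_integral => x _.
  by rewrite pM patchE indicE; case: ifP => _; rewrite ?mulr1 ?mulr0.
apply: complex_eq; rewrite /cint /=.
- by apply: (part (@complex.Re R)) => // z r; rewrite cReMr.
- by apply: (part (@complex.Im R)) => // z r; rewrite cImMr.
Qed.

Lemma cint_expi_period (w : R) (k : int) : 0 < w ->
  cint leb (fun x => expi (2 * pi * (k%:~R * w * x)) * (\1_(`[0, w^-1[%classic) x)%:C) =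
  if k == 0 then w^-1%:C else 0.
Proof.
move=> w0; have w1 : 0 < w^-1 by rewrite invr_gt0.
rewrite cint_indic_itvco; last exact: cmeasurable_fexp.
case: eqP => [->|/eqP k0].
- apply: complex_eq => /=.
  + under eq_integral do rewrite mul0r mul0r mulr0 cos0.
    by rewrite integral_cst//= mul1e lebesgue_measure_itv /= lte_fin w1 oppr0 addr0.
  + under eq_integral do rewrite mul0r mul0r mulr0 sin0.
    by rewrite integral0.
- have c0 : 2 * pi * (k%:~R * w) != 0 :> R.
    by rewrite !mulf_neq0 ?intr_eq0 ?pnatr_eq0 ?(lt0r_neq0 w0) ?(lt0r_neq0 (pi_gt0 R)).
  have kw : 2 * pi * (k%:~R * w) * w^-1 = 2 * pi * k%:~R.
    by rewrite mulrA mulfK ?gt_eqF.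
  have := expi_int (R := R) k; rewrite /expi => -[ck sk].
  apply: complex_eq => /=.
  + under eq_integral do rewrite mulrA.
    by rewrite integral_cos// kw sk mul0r.
  + under eq_integral do rewrite mulrA.
    by rewrite integral_sin// kw ck subrr mul0r.
Qed.

End PeriodIntegrals.

Section TensorProducts.
Context {R : realType}.
Implicit Types f g : R -> R[i].

Lemma cmeasurable_fst f : @cmeasurable _ (measurableTypeR R) R f ->
  @cmeasurable _ (measurableTypeR R * measurableTypeR R)%type R (fun z => f z.1).
Proof. by move=> mf; apply: cmeasurable_comp mf; exact: measurable_fst. Qed.

Lemma cmeasurable_snd f : @cmeasurable _ (measurableTypeR R) R f ->
  @cmeasurable _ (measurableTypeR R * measurableTypeR R)%type R (fun z => f z.2).
Proof. by move=> mf; apply: cmeasurable_comp mf; exact: measurable_snd. Qed.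

Lemma measurable_integral_leb (f : R * R -> \bar R) :
  @measurable_fun _ _ (measurableTypeR R * measurableTypeR R)%type _ setT f ->
  (forall z, (0 <= f z)%E) ->
  @measurable_fun _ _ (measurableTypeR R) _ setT (fun x => \int[leb]_y f (x, y))%E.
Proof.
move=> mf f0.
exact: (@measurable_fun_fubini_tonelli_F _ _ _ _ _ (@lebesgue_measure R) f mf f0).
Qed.

Lemma ge0_integral_leb2 (f : R * R -> \bar R) :
  @measurable_fun _ _ (measurableTypeR R * measurableTypeR R)%type _ setT f ->
  (forall z, (0 <= f z)%E) ->
  (\int[leb2]_z f z = \int[leb]_x \int[leb]_y f (x, y))%E.
Proof. by move=> mf f0; rewrite /leb2 /leb fubini_tonelli1. Qed.

Lemma ge0_integral_leb2_swap (f : R * R -> \bar R) :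
  @measurable_fun _ _ (measurableTypeR R * measurableTypeR R)%type _ setT f ->
  (forall z, (0 <= f z)%E) ->
  (\int[leb2]_z f z = \int[leb]_y \int[leb]_x f (x, y))%E.
Proof. by move=> mf f0; rewrite /leb2 /leb fubini_tonelli2. Qed.

Lemma cint_leb2 (f : R * R -> R[i]) : cintegrable leb2 f ->
  cint leb2 f = cint leb (fun x => cint leb (fun y => f (x, y))).
Proof. exact: cfubini1. Qed.

Lemma cmeasurable_cint_leb (f : R * R -> R[i]) :
  @cmeasurable _ (measurableTypeR R * measurableTypeR R)%type R f ->
  @cmeasurable _ (measurableTypeR R) R (fun x => cint leb (fun y => f (x, y))).
Proof. exact: (cmeasurable_cint2 (@lebesgue_measure R)). Qed.

Lemma N2_tensor f g : L2 leb f -> L2 leb g ->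
  (N2 leb2 (fun z => f z.1 * g z.2)%R = N2 leb f * N2 leb g)%E.
Proof.
move=> jf jg; have [mf mg] := (L2_meas jf, L2_meas jg).
have mfg : @cmeasurable _ (measurableTypeR R * measurableTypeR R)%type R
    (fun z => f z.1 * g z.2).
  by apply: cmeasurableM; [exact: cmeasurable_fst|exact: cmeasurable_snd].
rewrite /N2 ge0_integral_leb2; last 2 first.
- exact: measurable_mod2.
- by move=> z; rewrite lee_fin sqr_ge0.
rewrite -/(N2 leb g) (L2_fin jg) -ge0_integralZr//; first last.
- by rewrite lee_fin sqn_ge0.
- by move=> x _; rewrite lee_fin sqr_ge0.
- exact: measurable_mod2.
apply: eq_integral => x _; rewrite -(L2_fin jg) -ge0_integralZl//; first last.
- by rewrite lee_fin sqr_ge0.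
- by move=> y _; rewrite lee_fin sqr_ge0.
- exact: measurable_mod2.
by apply: eq_integral => y _; rewrite modM exprMn EFinM.
Qed.

Lemma L2_tensor f g : L2 leb f -> L2 leb g -> L2 leb2 (fun z => f z.1 * g z.2).
Proof.
move=> jf jg; apply/L2P; split.
  by apply: cmeasurableM; [exact: cmeasurable_fst (L2_meas jf)|exact: cmeasurable_snd (L2_meas jg)].
by rewrite N2_tensor// (L2_fin jf) (L2_fin jg) -EFinM ltry.
Qed.

Lemma inner_tensor f g f' g' : L2 leb f -> L2 leb g -> L2 leb f' -> L2 leb g' ->
  inner leb2 (fun z => f z.1 * g z.2) (fun z => f' z.1 * g' z.2) =
  inner leb f f' * inner leb g g'.
Proof.
move=> jf jg jf' jg'; have jF := L2_tensor jf jg; have jF' := L2_tensor jf' jg'.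
rewrite /inner cint_leb2; last exact: inner_cintegrable.
rewrite mulrC -cintZ; last exact: inner_cintegrable.
apply: eq_cint => x; rewrite mulrC -cintZ; last exact: inner_cintegrable.
by apply: eq_cint => y /=; rewrite conjcM; ring.
Qed.

End TensorProducts.

Section ExponentialBases.
Context {R : realType}.

Definition cexp (w : R) (k : int) (x : R) : R[i] :=
  expi (2 * pi * (k%:~R * w * x)) * (\1_(`[0, w^-1[%classic) x)%:C.

Lemma L2_indic_itvco (b : R) : 0 < b -> L2 leb (fun x : R => (\1_(`[0, b[%classic) x : R)%:C).
Proof.
move=> b0; apply: (@L2_indic _ (measurableTypeR R) R leb); first exact: measurable_itv.
suff : (lebesgue_measure `[0%R, b[%classic < +oo)%E by [].
by rewrite lebesgue_measure_itv /=; case: ifP => _; rewrite -?EFinD ltry.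
Qed.

Variable w : R.
Hypothesis w_gt0 : 0 < w.

Lemma cexp_L2 k : L2 leb (cexp w k).
Proof.
rewrite /cexp; under eq_fun do rewrite mulrC.
apply: (@L2Mbounded _ _ _ _ _ _ 1); last by apply: L2_indic_itvco; rewrite invr_gt0.
- exact: cmeasurable_fexp.
- by move=> x; rewrite mod_expi.
Qed.

Lemma cexp_supp k x : ~ `[0, w^-1[%classic x -> cexp w k x = 0.
Proof. by move=> h; rewrite /cexp indicE memNset// mulr0. Qed.

Lemma cexp_orth j k : inner leb (cexp w j) (cexp w k) = if j == k then w^-1%:C else 0.
Proof.
rewrite -subr_eq0 -(cint_expi_period _ w_gt0); apply: eq_cint => x.
rewrite /cexp conjcM conjc_real conjc_expi mulrACA -expiD -rmorphM; congr (expi _ * _%:C).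
  by rewrite intrB; ring.
by rewrite indicE; case: (_ \in _); rewrite ?mulr1 ?mulr0.
Qed.

Lemma cexp_total f : L2 leb f -> (forall x, ~ `[0, w^-1[%classic x -> f x = 0) ->
  (forall k, inner leb f (cexp w k) = 0) -> {ae leb, forall x, f x = 0}.
Proof.
move=> jf f_supp f0.
have f1 x : f x = f x * (\1_(`[0, w^-1[%classic) x)%:C.
  rewrite indicE; have [xD|xD] := pselect (`[0, w^-1[%classic x).
    by rewrite mem_set// mulr1.
  by rewrite f_supp// mul0r.
apply: (fourier_unique w_gt0) => //.
- have wi : 0 < w^-1 by rewrite invr_gt0.
  have := inner_cintegrable jf (L2_indic_itvco wi).
  congr cintegrable; apply/funext => x.
  by rewrite conjc_real -f1.
- move=> k; rewrite -[RHS](f0 (- k)); apply: eq_cint => x.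
  rewrite [in LHS]f1 /cexp conjcM conjc_real conjc_expi mulrNz.
  rewrite (_ : - (2 * pi * (- k%:~R * w * x)) = 2 * pi * (k%:~R * w * x)); last by ring.
  by rewrite -mulrA [(_)%:C * _]mulrC.
Qed.

End ExponentialBases.

Section CellBasis.
Context {R : realType}.
Variables b0 nu0 : R.
Hypotheses (b0_gt0 : 0 < b0) (nu0_gt0 : 0 < nu0).

Lemma measurable_cell :
  @measurable _ (measurableTypeR R * measurableTypeR R)%type (cell b0 nu0).
Proof. by apply: measurableX; exact: measurable_itv. Qed.

Definition cellexp (p : int * int) (z : R * R) : R[i] :=
  expi (2 * pi * (p.2%:~R * nu0 * z.1 - p.1%:~R * b0 * z.2)) * (\1_(cell b0 nu0) z)%:C.

(** The sign of the symplectic form is absorbed by the second frequency, which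
    leaves a tensor product. *)
Lemma cellexpE p : cellexp p = fun z => cexp nu0 p.2 z.1 * cexp b0 (- p.1) z.2.
Proof.
apply/funext => -[x y]; rewrite /cellexp /cexp /= mulrACA -expiD -rmorphM.
congr (expi _ * _%:C); first by rewrite mulrNz; ring.
by rewrite !indicE in_setX /=; case: (x \in _); case: (y \in _); rewrite /= ?mulr0 ?mulr1.
Qed.

Lemma cellexp_L2 p : L2 leb2 (cellexp p).
Proof. by rewrite cellexpE; apply: L2_tensor; exact: cexp_L2. Qed.

Lemma cellexp_supp p z : ~ cell b0 nu0 z -> cellexp p z = 0.
Proof. by move=> h; rewrite /cellexp indicE memNset// mulr0. Qed.

Lemma cellexp_orth p q :
  inner leb2 (cellexp p) (cellexp q) = if p == q then (nu0^-1 * b0^-1)%:C else 0.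
Proof.
rewrite !cellexpE inner_tensor; do ?[exact: cexp_L2].
rewrite !cexp_orth// eqr_opp; case: p q => [p1 p2] [q1 q2] /=.
rewrite xpair_eqE [in RHS]andbC; case: eqP => _; case: eqP => _ //=;
  by rewrite ?mulr0 ?mul0r // rmorphM.
Qed.

Lemma ae_forall_int d (T : measurableType d) (mu : {measure set T -> \bar R})
    (P : int -> T -> Prop) :
  (forall k, {ae mu, forall x, P k x}) -> {ae mu, forall x, forall k, P k x}.
Proof.
move=> aeP; have h1 := ae_foralln (fun n : nat => aeP (Posz n)).
have h2 := ae_foralln (fun n : nat => aeP (Negz n)).
by apply: filterS2 h1 h2 => x h1 h2 [n|n].
Qed.

(** Uniqueness of Fourier coefficients in the first variable, applied to the
    partial coefficients in the second one, and then in the second variable. *)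
Lemma cellexp_total f : L2 leb2 f -> (forall z, ~ cell b0 nu0 z -> f z = 0) ->
  (forall p, inner leb2 f (cellexp p) = 0) -> {ae leb2, forall z, f z = 0}.
Proof.
move=> jf f_supp f0.
have jc : cintegrable leb2 f.
  have := inner_cintegrable jf (cellexp_L2 (0, 0)); congr cintegrable.
  apply/funext => z; rewrite /cellexp (_ : 2 * pi * _ = 0); last by rewrite /= mulr0z; ring.
  rewrite expi0 mul1r conjc_real indicE.
  have [zD|zD] := pselect (cell b0 nu0 z); first by rewrite mem_set// mulr1.
  by rewrite f_supp// mul0r.
have jfc k l : cintegrable leb2
    (fun z => f z * (expi (2 * pi * (k%:~R * nu0 * z.1)) * expi (2 * pi * (l%:~R * b0 * z.2)))).
  apply: (@cintegrableMbounded _ _ _ _ _ _ 1) => //.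
    apply: cmeasurableM.
    - by apply: (cmeasurable_fst (f := fun x => expi (2 * pi * (k%:~R * nu0 * x))));
        exact: cmeasurable_fexp.
    - by apply: (cmeasurable_snd (f := fun x => expi (2 * pi * (l%:~R * b0 * x))));
        exact: cmeasurable_fexp.
  by move=> z; rewrite modM !mod_expi mulr1.
pose F l x := cint leb (fun y => f (x, y) * expi (2 * pi * (l%:~R * b0 * y))).
have jF l : cintegrable leb2 (fun z => f z * expi (2 * pi * (l%:~R * b0 * z.2))).
  have := jfc 0 l; congr cintegrable; apply/funext => z.
  by rewrite (_ : 2 * pi * (0%:~R * nu0 * z.1) = 0) ?expi0 ?mul1r// mulr0z; ring.
have F0 l : {ae leb, forall x, F l x = 0}.
  apply: (fourier_unique nu0_gt0); first exact: (cintegrable_cint2 (jF l)).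
  - move=> x xD; rewrite /F -[RHS](cint0 leb); apply: eq_cint => y.
    by rewrite f_supp ?mul0r// => -[].
  - move=> k; rewrite -[RHS](f0 (l, - k)) /inner.
    transitivity (cint leb2 (fun z => f z *
      (expi (2 * pi * (k%:~R * nu0 * z.1)) * expi (2 * pi * (l%:~R * b0 * z.2))))); last first.
      apply: eq_cint => z; rewrite /cellexp conjcM conjc_real conjc_expi /= -expiD indicE.
      have [zD|zD] := pselect (cell b0 nu0 z); last by rewrite f_supp// !mul0r.
      by rewrite mem_set// mulr1; congr (_ * expi _); rewrite mulrNz; ring.
    rewrite cint_leb2//; apply: cint_ae_eq.
    + apply: cmeasurableM; last exact: cmeasurable_fexp.
      exact: (cmeasurable_cint_leb (jF l).1).
    + exact: (cmeasurable_cint_leb (jfc k l).1).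
    + have := ae_cintegrable_section1 (jF l); apply: filterS => x jx.
      rewrite mulrC -cintZ//; apply: eq_cint => y /=; ring.
have := ae_forall_int F0; have := ae_cintegrable_section1 jc.
have mf2 := measurable_mod2 (L2_meas jf).
move=> jcx F0x; apply: (N2_eq0 (L2_meas jf)).
rewrite /N2 ge0_integral_leb2//; last by move=> z; rewrite lee_fin sqr_ge0.
have mm : @measurable_fun _ _ (measurableTypeR R) _ setT
    (fun x => \int[leb]_y (mod (f (x, y)) ^+ 2)%:E)%E.
  by apply: (measurable_integral_leb mf2) => z; rewrite lee_fin sqr_ge0.
rewrite (ae_eq_integral (cst 0%E)) ?integral0//.
apply: filterS2 jcx F0x => x jx Fx _ /=.
have fx0 : {ae leb, forall y, f (x, y) = 0}.
  apply: (fourier_unique b0_gt0) => //.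
  - by move=> y yD; apply: f_supp => -[].
have := @N2_ae_eq _ _ _ leb (fun y => f (x, y)) (fun=> 0)
  (cmeasurable_section1 x (L2_meas jf)) (cmeasurable_cst _ _) fx0.
rewrite (_ : N2 leb (fun=> 0) = 0%E); last exact: N2_0.
by move=> h; exact: h.
Qed.

End CellBasis.

(** * Periodization *)

Section CountableIndexes.

Lemma nat_enum (I : countType) (i0 : I) (f : nat -> I) : injective f ->
  exists phi : nat -> I, bijective phi.
Proof.
move=> finj; pose J : pointedType := HB.pack_for pointedType I (isPointed.Build I i0).
have : ([set: nat] #= [set: J])%card.
  rewrite card_eq_le; apply/andP; split; last exact: (countableP (T := I)).
  by apply/pcard_leTP/injPex; exists f => m n _ _; exact: finj.
move=> /card_set_bijP[phi]; rewrite setTT_bijective => bphi; by exists phi.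
Qed.

Lemma nat_enum_int : exists phi : nat -> int, bijective phi.
Proof. by apply: (@nat_enum _ 0 Posz) => m n []. Qed.

Lemma nat_enum_int2 : exists phi : nat -> int * int, bijective phi.
Proof. by apply: (@nat_enum _ (0, 0) (fun n => (Posz n, 0))) => m n []. Qed.

End CountableIndexes.

(** The counting measure on the natural numbers, packaged as a sigma-finite
    measure so that it can be a factor of a product measure. *)
Definition nat_counting (R : realType) : set nat -> \bar R := @counting nat R.

HB.instance Definition _ (R : realType) := Measure.on (@nat_counting R).

HB.instance Definition _ (R : realType) :=
  @Measure_isSigmaFinite.Build _ _ _ (@nat_counting R) (sigma_finite_counting R).

Section SeriesAsIntegrals.
Context {R : realType}.

Local Notation count := (@nat_counting R).

Lemma integral_nat_counting (a : nat -> \bar R) : (forall k, 0 <= a k)%E ->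
  (\int[count]_n a n = \sum_(0 <= n <oo) a n)%E.
Proof. exact: ge0_integral_count. Qed.

(** The sum of an absolutely summable sequence, as an integral against the
    counting measure, which makes Fubini's theorem available for series. *)
Definition psum (u : nat -> R[i]) : R[i] := cint count u.

Lemma measurable_nat d (T : measurableType d) (u : nat -> T) : measurable_fun setT u.
Proof. by move=> _ Y _; exact: I. Qed.

Lemma cmeasurable_nat (u : nat -> R[i]) : cmeasurable u.
Proof. by split; exact: measurable_nat. Qed.

Lemma measurable_prod_nat d1 d2 (T1 : measurableType d1) (T2 : measurableType d2)
    (h : T1 * nat -> T2) :
  (forall n, measurable_fun setT (fun x => h (x, n))) -> measurable_fun setT h.
Proof.
move=> mh _ Y mY; rewrite setTI.
rewrite (_ : h @^-1` Y = \bigcup_n (((fun x => h (x, n)) @^-1` Y) `*` [set n])).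
  apply: bigcupT_measurable => n; apply: measurableX => //.
  by have := mh n measurableT Y mY; rewrite setTI.
apply/seteqP; split => [[x n] /= hY|[x n] [m _ [/= hY ->]]//].
by exists n.
Qed.

Lemma counting_set1 (n : nat) : (count [set n] = 1)%E.
Proof. by rewrite /nat_counting /counting asboolT// fset_set1 cardfs1. Qed.

Lemma psum_esum (I : choiceType) (phi : nat -> I) (a : I -> \bar R) : bijective phi ->
  (forall i, 0 <= a i)%E ->
  (\int[count]_n a (phi n) = \esum_(i in [set: I]) a i)%E.
Proof.
move=> bphi a0; rewrite integral_nat_counting// nneseries_esumT//.
by rewrite (@reindex_esum _ _ _ setT setT phi)// setTT_bijective.
Qed.

(** The finite set depends on the dominating family only. This uniformity turns
    pointwise sums of functions into sums in norm. *)
Lemma psum_tail (I : choiceType) (phi : nat -> I) (a : I -> R) : bijective phi ->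
  (forall i, 0 <= a i) -> (\esum_(i in [set: I]) (a i)%:E < +oo)%E ->
  forall eps : R, 0 < eps -> exists F0 : {fset I}, forall F, fsubset F0 F ->
    forall u : I -> R[i], (forall i, mod (u i) <= a i) ->
    mod (psum (fun n => u (phi n)) - \sum_(i <- F) u i) < eps.
Proof.
move=> bphi a0 aoo eps e0.
have [F0 hF0] := esum_tail a0 aoo (divr_gt0 e0 (ltr0n _ 2)).
exists F0 => F F0F u ua.
have ju : cintegrable count (fun n => u (phi n)).
  split; first exact: cmeasurable_nat.
  rewrite (psum_esum (a := fun i => (mod (u i))%:E) bphi); last first.
    by move=> i; rewrite lee_fin.
  by apply: le_lt_trans aoo; apply: le_esum => i _; rewrite lee_fin.
pose v i := if i \in F then u i else 0.
have [psi phiK psiK] := bphi.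
have sumv : cintegrable count (fun n => v (phi n)) /\
    psum (fun n => v (phi n)) = \sum_(i <- F) u i.
  have -> : (fun n => v (phi n)) =
      (\sum_(i <- F) (fun n => if phi n == i then u i else 0)).
    apply/funext => n; rewrite fct_sumE /v.
    under eq_bigr do rewrite eq_sym.
    rewrite (eq_bigr (fun i => if i == phi n then u (phi n) else 0)) ?fset_sum_pred1//.
    by move=> i _; case: eqP => // ->.
  have single i : cintegrable count (fun n => if phi n == i then u i else 0) /\
      psum (fun n => if phi n == i then u i else 0) = u i.
    have E n : (if phi n == i then u i else 0) = u i * (\1_[set psi i] n)%:C.
      rewrite indicE; case: eqP => [<-|ni]; first by rewrite phiK mem_set// mulr1.
      by rewrite memNset ?mulr0// => /= h; apply: ni; rewrite h psiK.
    have ji : cintegrable count (fun n => (\1_[set psi i] n : R)%:C).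
      apply: cintegrable_real; apply/integrableP; split; first exact: measurable_nat.
      under eq_integral do rewrite gee0_abs ?lee_fin//.
      by rewrite integral_indic// setIT [X in (X < _)%E]counting_set1 ltry.
    have -> : (fun n => if phi n == i then u i else 0) = (fun n => u i * (\1_[set psi i] n)%:C).
      by apply/funext => n; exact: E.
    split; first exact: cintegrableZ.
    rewrite /psum cintZ// cint_real /Rintegral integral_indic// setIT.
    by rewrite [X in fine X]counting_set1 mulr1.
  move: (enum_fset F) => r; elim: r => [|i r [IH1 IH2]].
    by rewrite !big_nil; split; [exact: cintegrable0|exact: cint0].
  rewrite !big_cons; have [s1 s2] := single i; split; first exact: cintegrableD.
  by rewrite /psum cintD// -/(psum _) s2; congr (_ + _).
have [jv <-] := sumv; rewrite /psum -cintB//.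
rewrite -lte_fin; apply: (@le_lt_trans _ _ (eps / 2)%:E); last by rewrite lte_fin; lra.
apply: le_trans (mod_cint_le (cintegrableB ju jv)) _.
rewrite (psum_esum (a := fun i => (mod (u i - v i))%:E) bphi); last first.
  by move=> i; rewrite lee_fin.
apply: esum_le_bound => G; rewrite lee_fin; apply/ltW.
apply: le_lt_trans (hF0 F F0F (fsetU F G) (fsubsetUl _ _)).
have w0 i : 0 <= mod (u i - v i) by [].
apply: (@le_trans _ _ (\sum_(i <- fsetU F G) mod (u i - v i))).
  by rewrite (big_fsetD_sub _ (fsubsetUr F G)) lerDl sumr_ge0.
rewrite (big_fsetD_sub _ (fsubsetUl F G)) [X in X + _]big1_seq ?add0r.
  rewrite big_seq [leRHS]big_seq; apply: ler_sum => i.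
  by rewrite inE => /andP[iF _]; rewrite /v (negbTE iF) subr0.
by move=> i /andP[_ iF]; rewrite /v iF subrr mod0.
Qed.

Lemma esum_mod_lty (I : choiceType) (phi : nat -> I) (u : I -> R[i]) : bijective phi ->
  cintegrable count (fun n => u (phi n)) ->
  (\esum_(i in [set: I]) (mod (u i))%:E < +oo)%E.
Proof.
by move=> bphi ju; rewrite -(psum_esum bphi) => [|i]; [case: ju|rewrite lee_fin].
Qed.

Lemma psum_sums_to (I : choiceType) (phi : nat -> I) (u : I -> R[i]) : bijective phi ->
  cintegrable count (fun n => u (phi n)) ->
  sums_to (fun z => (mod z)%:E) u (psum (fun n => u (phi n))).
Proof.
move=> bphi ju eps e0; have mod0' i : 0 <= mod (u i) by [].
have [F0 hF0] := psum_tail bphi mod0' (esum_mod_lty bphi ju) e0.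
by exists F0 => F F0F; rewrite lte_fin; exact: hF0.
Qed.

Lemma csum_psum (I : choiceType) (phi : nat -> I) (u : I -> R[i]) : bijective phi ->
  cintegrable count (fun n => u (phi n)) -> csum u = psum (fun n => u (phi n)).
Proof. by move=> bphi ju; apply: csumE; exact: psum_sums_to. Qed.

End SeriesAsIntegrals.

Section Tilings.
Context d (T : measurableType d) (R : realType).
Variable mu : {sigma_finite_measure set T -> \bar R}.
Variables (D : set T) (tau tau' : nat -> T -> T).

(** The measure preserving bijections [tau n], with inverses [tau' n], move [D] to
    copies of itself that are disjoint and cover the space. *)
Record tiles : Prop := Tiles {
  tile_measurable : measurable D;
  tile_shift_measurable : forall n, measurable_fun setT (tau n);
  tile_unshift_measurable : forall n, measurable_fun setT (tau' n);
  tile_shiftK : forall n, cancel (tau n) (tau' n);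
  tile_invariant : forall n (f : T -> \bar R), measurable_fun setT f ->
    (forall z, 0 <= f z)%E -> (\int[mu]_z f (tau n z) = \int[mu]_z f z)%E;
  tile_cover : forall z, exists n, forall m, D (tau' m z) <-> m = n }.

Hypothesis tiled : tiles.

Let mD := tile_measurable tiled.
Let m_tau := tile_shift_measurable tiled.
Let m_tau' := tile_unshift_measurable tiled.

Local Notation count := (@nat_counting R).

Let ind z : R := \1_D z.

Let ind_ge0 z : 0 <= ind z. Proof. by rewrite /ind indicE. Qed.

Let m_ind : measurable_fun setT (EFin \o ind).
Proof. by apply/measurable_EFinP; exact: measurable_indic. Qed.

(** The indicators of the copies of [D] sum to 1; insert this sum and move each
    copy back to [D]. *)
Lemma periodize_ge0 (f : T -> \bar R) : measurable_fun setT f -> (forall z, 0 <= f z)%E ->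
  (\int[mu]_z f z = \int[mu]_z ((ind z)%:E * \int[count]_n f (tau n z)))%E.
Proof.
move=> mf f0.
have mft n : measurable_fun setT (fun z => f (tau n z)).
  exact: measurableT_comp mf (m_tau n).
have ft0 n z : (0 <= (ind z)%:E * f (tau n z))%E by rewrite mule_ge0// lee_fin.
have one z : (\sum_(0 <= n <oo) (ind (tau' n z))%:E = 1 :> \bar R)%E.
  have [n hn] := tile_cover tiled z.
  rewrite -integral_nat_counting => [|k]; last by rewrite lee_fin.
  rewrite (eq_integral (fun m => (\1_[set n] m)%:E)); last first.
    move=> m _; rewrite /ind !indicE; congr ((nat_of_bool _)%:R%:E).
    by apply/idP/idP; rewrite !inE => /hn.
  by rewrite integral_indic// setIT; exact: counting_set1.
transitivity (\int[mu]_z \sum_(0 <= n <oo) ((ind (tau' n z))%:E * f z))%E.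
  apply: eq_integral => z _; rewrite -[LHS]mul1e -(one z).
  rewrite -!integral_nat_counting; do ?[by move=> n; rewrite ?mule_ge0// lee_fin].
  by rewrite ge0_integralZr// => n _; rewrite lee_fin.
rewrite integral_nneseries//; first last.
- by move=> n z _; rewrite mule_ge0// lee_fin.
- by move=> n; apply: emeasurable_funM => //; exact: (measurableT_comp m_ind (m_tau' n)).
transitivity (\int[mu]_z \sum_(0 <= n <oo) ((ind z)%:E * f (tau n z)))%E; last first.
  apply: eq_integral => z _; rewrite integral_nat_counting//.
  by rewrite nneseriesZl// => n _; exact: ft0.
rewrite (@integral_nneseries _ T R mu setT measurableT (fun n z => (ind z)%:E * f (tau n z))%E); first last.
- by move=> n z _; exact: ft0.
- by move=> n; exact: emeasurable_funM.
congr (limn _); apply/funext => N; apply: eq_bigr => n _.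
rewrite -(tile_invariant tiled n); first last.
- by move=> z; rewrite mule_ge0// lee_fin.
- by apply: emeasurable_funM => //; exact: (measurableT_comp m_ind (m_tau' n)).
by apply: eq_integral => z _; rewrite (tile_shiftK tiled).
Qed.

Variable f : T -> R[i].
Hypothesis f_int : cintegrable mu f.

Let G (q : T * nat) : R[i] := (ind q.1)%:C * f (tau q.2 q.1).

Let m_tau2 : measurable_fun setT (fun q : T * nat => tau q.2 q.1).
Proof. by apply: measurable_prod_nat => n; exact: m_tau. Qed.

Let mind1 : measurable_fun setT (fun q : T * nat => ind q.1).
Proof. by apply: (measurableT_comp (measurable_indic mD)); exact: measurable_fst. Qed.

Let mG : cmeasurable G.
Proof.
apply: cmeasurableM; first exact: cmeasurable_real.
exact: cmeasurable_comp m_tau2 f_int.1.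
Qed.

Let transfer (g : T -> \bar R) : measurable_fun setT g -> (forall z, 0 <= g z)%E ->
  (\int[mu]_z g z = \int[mu \x count]_q ((ind q.1)%:E * g (tau q.2 q.1)))%E.
Proof.
move=> mg g0; rewrite fubini_tonelli1; first last.
- by move=> q; rewrite mule_ge0// lee_fin.
- apply: emeasurable_funM; first by apply/measurable_EFinP.
  exact: measurableT_comp mg m_tau2.
rewrite periodize_ge0//; apply: eq_integral => z _.
by rewrite /fubini_F -ge0_integralZl// ?lee_fin//; exact: measurable_nat.
Qed.

Lemma periodize_cintegrable : cintegrable (mu \x count)%E G.
Proof.
split; first exact: mG.
have := f_int.2; rewrite transfer//; last exact: measurable_cmod f_int.1.
congr (_ < _)%E; apply: eq_integral => q _.
by rewrite /cmod /G modM modR ger0_norm// EFinM.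
Qed.

Lemma periodize_cint_prod : cint mu f = cint (mu \x count)%E G.
Proof.
have part (p : R[i] -> R) : (forall (r : R) z, p (r%:C * z) = r * p z) ->
    mu.-integrable setT (fun z => (p (f z))%:E) ->
    \int[mu]_z p (f z) = \int[(mu \x count)%E]_q p (G q).
  move=> pM ip; have mp := measurable_int mu ip.
  rewrite /Rintegral; congr fine; rewrite [LHS]integralE [RHS]integralE.
  rewrite !transfer; do ?[exact: measurable_funepos]; do ?[exact: measurable_funeneg];
    do ?[by move=> z; exact: funepos_ge0]; do ?[by move=> z; exact: funeneg_ge0].
  congr (_ - _)%E; apply: eq_integral => q _.
  - rewrite !funeposE /G pM /ind indicE; case: (_ \in _); rewrite /= ?mul1r ?mul0r ?mul1e ?mul0e//.
    by rewrite maxxx.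
  - rewrite !funenegE /G pM /ind indicE; case: (_ \in _); rewrite /= ?mul1r ?mul0r ?mul1e ?mul0e//.
    by rewrite [X in maxe X _](_ : _ = 0%E) ?maxxx//; congr EFin; rewrite oppr0.
have /cintegrableP[iR iI] := f_int.
apply: complex_eq; rewrite /cint /=.
- by apply: (part (@complex.Re R)) => // r z; rewrite mulrC cReMr mulrC.
- by apply: (part (@complex.Im R)) => // r z; rewrite mulrC cImMr mulrC.
Qed.

Lemma psum_cutoff z : psum (fun n => G (z, n)) = (ind z)%:C * psum (fun n => f (tau n z)).
Proof.
rewrite /G /ind /= indicE; case: (z \in D).
- by rewrite mul1r; apply: eq_cint => n; rewrite mul1r.
- by rewrite mul0r -[RHS](cint0 count); apply: eq_cint => n; rewrite mul0r.
Qed.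

Lemma periodize_cint : cint mu f = cint mu (fun z => (ind z)%:C * psum (fun n => f (tau n z))).
Proof.
rewrite periodize_cint_prod (cfubini1 periodize_cintegrable).
by apply: eq_cint => z; rewrite -psum_cutoff.
Qed.

Lemma periodization_cintegrable :
  cintegrable mu (fun z => (ind z)%:C * psum (fun n => f (tau n z))).
Proof.
have := cintegrable_cint2 periodize_cintegrable; congr cintegrable.
by apply/funext => z; exact: psum_cutoff.
Qed.

Lemma ae_periodize_cintegrable :
  {ae mu, forall z, D z -> cintegrable count (fun n => f (tau n z))}.
Proof.
apply: filterS (ae_cintegrable_section1 periodize_cintegrable) => z jz Dz.
move: jz; congr cintegrable; apply/funext => n.
by rewrite /G /ind indicE /= mem_set// mul1r.
Qed.

End Tilings.

(** * Tilings of the line and of the plane *)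

Section Translations.
Context {R : realType}.

Local Notation L := (measurableTypeR R).
Local Notation L2d := (measurableTypeR R * measurableTypeR R)%type.

Lemma measurable_shift (c : R) : @measurable_fun _ _ L L setT (fun x => x + c).
Proof. by apply: measurable_funD; [exact: measurable_id|exact: measurable_cst]. Qed.

Lemma leb_shift (c : R) (A : set L) : measurable A ->
  pushforward (@lebesgue_measure R) (fun x : L => (x + c : L)) A = lebesgue_measure A.
Proof.
move=> mA; apply/esym/lebesgue_measure_unique => //=; first exact: measurable_shift.
move=> _ _ [[a b]] _ <-; rewrite /pushforward.
rewrite [X in _ = lebesgue_measure X](_ : _ = `]a - c, b - c]%classic); last first.
  by apply/seteqP; split => x; rewrite /= !in_itv /= ltrBlDr lerBrDr.
by rewrite !lebesgue_measure_itv /= !lte_fin ltrD2r -!EFinB opprD opprK addrACA addNr addr0.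
Qed.

Lemma ge0_integral_shift (c : R) (f : L -> \bar R) : measurable_fun setT f ->
  (forall x, 0 <= f x)%E -> (\int[leb]_x f (x + c)%R = \int[leb]_x f x)%E.
Proof.
move=> mf f0.
have h := @ge0_integral_pushforward _ _ L L R _ (measurable_shift c) leb setT f
  measurableT mf (fun y _ => f0 y).
rewrite preimage_setT in h; rewrite -[LHS]h.
apply: eq_measure_integral; first exact: measurable_shift.
by move=> mc A mA _; exact: leb_shift.
Qed.

Lemma ge0_integral_opp (f : L -> \bar R) : measurable_fun setT f ->
  (forall x, 0 <= f x)%E -> (\int[leb]_x f (- x)%R = \int[leb]_x f x)%E.
Proof.
move=> mf f0.
have h := @ge0_integral_pushforward _ _ L L R _ (oppr_measurable (D := setT)) leb setT f
  measurableT mf (fun y _ => f0 y).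
rewrite preimage_setT in h; rewrite -[LHS]h.
by apply: eq_measure_integral => A mA _; exact: lebesgue_measureN.
Qed.

Lemma ge0_integral_reflect (c : R) (f : L -> \bar R) : measurable_fun setT f ->
  (forall x, 0 <= f x)%E -> (\int[leb]_x f (c - x)%R = \int[leb]_x f x)%E.
Proof.
move=> mf f0; rewrite -(ge0_integral_shift c mf f0).
rewrite -(ge0_integral_opp (f := fun x => f (x + c)%R))//.
- by apply: eq_integral => x _; rewrite addrC.
- exact: measurableT_comp mf (measurable_shift c).
Qed.

Lemma measurable_shift2 (c d : R) :
  @measurable_fun _ _ L2d L2d setT (fun z => (z.1 + c, z.2 + d)).
Proof.
apply: measurable_fun_pair.
- exact: measurableT_comp (measurable_shift c) measurable_fst.
- exact: measurableT_comp (measurable_shift d) measurable_snd.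
Qed.

Lemma ge0_integral_shift2 (c d : R) (f : L2d -> \bar R) : measurable_fun setT f ->
  (forall z, 0 <= f z)%E -> (\int[leb2]_z f (z.1 + c, z.2 + d)%R = \int[leb2]_z f z)%E.
Proof.
move=> mf f0; rewrite !ge0_integral_leb2//; last first.
  exact: measurableT_comp mf (measurable_shift2 c d).
have mi := measurable_integral_leb mf f0.
rewrite -(ge0_integral_shift c mi); last by move=> x; exact: integral_ge0.
apply: eq_integral => x _ /=.
apply: (ge0_integral_shift d (f := fun y => f (x + c, y))) => //.
exact: measurableT_comp mf (pair1_measurable _).
Qed.

End Translations.

Section LineTiling.
Context {R : realType}.
Variables (w : R) (phi : nat -> int).
Hypothesis w_gt0 : 0 < w.
Hypothesis phi_bij : bijective phi.

Local Notation L := (measurableTypeR R).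

Definition line_shift (n : nat) (x : R) : R := x + (phi n)%:~R / w.
Definition line_unshift (n : nat) (x : R) : R := x + - ((phi n)%:~R / w).

Lemma measurable_line_shift n : @measurable_fun _ _ L L setT (line_shift n).
Proof. exact: measurable_shift. Qed.

Lemma measurable_line_unshift n : @measurable_fun _ _ L L setT (line_unshift n).
Proof. exact: measurable_shift. Qed.

Lemma line_shiftK n : cancel (line_shift n) (line_unshift n).
Proof. by move=> x; rewrite /line_shift /line_unshift addrK. Qed.

Lemma period_floor (x : R) (k : int) :
  `[0, w^-1[%classic (x - k%:~R / w) <-> k = Num.floor (x * w).
Proof.
have wk : w^-1 + k%:~R / w = (k + 1)%:~R / w by rewrite intrD mulrDl mul1r addrC.
rewrite /= in_itv /= subr_ge0 ltrBlDr wk ler_pdivrMr// ltr_pdivlMr//.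
split=> [h|->]; last by have := floor_itv (x * w).
by apply/esym/floor_def.
Qed.

Lemma line_tiling x : exists n, forall m, `[0, w^-1[%classic (line_unshift m x) <-> m = n.
Proof.
have [psi phiK psiK] := phi_bij; exists (psi (Num.floor (x * w))) => m.
split=> [/period_floor <-|->]; first by rewrite phiK.
by apply/period_floor; rewrite psiK.
Qed.

Lemma line_invariant n (f : L -> \bar R) : measurable_fun setT f ->
  (forall x, 0 <= f x)%E -> (\int[leb]_x f (line_shift n x) = \int[leb]_x f x)%E.
Proof. exact: ge0_integral_shift. Qed.

Lemma line_tiles : tiles (@lebesgue_measure R) `[0, w^-1[%classic line_shift line_unshift.
Proof.
by split; [exact: measurable_itv|exact: measurable_line_shift|exact: measurable_line_unshift
  |exact: line_shiftK|exact: line_invariant|exact: line_tiling].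
Qed.

End LineTiling.

Section PlaneTiling.
Context {R : realType}.
Variables (b0 nu0 : R) (phi : nat -> int * int).
Hypotheses (b0_gt0 : 0 < b0) (nu0_gt0 : 0 < nu0).
Hypothesis phi_bij : bijective phi.

Local Notation L2d := (measurableTypeR R * measurableTypeR R)%type.

Definition plane_shift n (z : R * R) : R * R := dual_shift b0 nu0 z (phi n).
Definition plane_unshift n (z : R * R) : R * R :=
  (z.1 + - ((phi n).1%:~R / nu0), z.2 + - ((phi n).2%:~R / b0)).

Lemma measurable_plane_shift n : @measurable_fun _ _ L2d L2d setT (plane_shift n).
Proof. exact: measurable_shift2. Qed.

Lemma measurable_plane_unshift n : @measurable_fun _ _ L2d L2d setT (plane_unshift n).
Proof. exact: measurable_shift2. Qed.

Lemma plane_shiftK n : cancel (plane_shift n) (plane_unshift n).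
Proof. by move=> [x y]; rewrite /plane_shift /plane_unshift /= !addrK. Qed.

Lemma plane_tiling z : exists n, forall m, cell b0 nu0 (plane_unshift m z) <-> m = n.
Proof.
have [psi phiK psiK] := phi_bij.
exists (psi (Num.floor (z.1 * nu0), Num.floor (z.2 * b0))) => m.
split=> [[/(period_floor nu0_gt0) h1 /(period_floor b0_gt0) h2]|->].
  by rewrite -h1 -h2 -surjective_pairing phiK.
by split; [apply/(period_floor nu0_gt0)|apply/(period_floor b0_gt0)]; rewrite psiK.
Qed.

Lemma plane_invariant n (f : L2d -> \bar R) : measurable_fun setT f ->
  (forall z, 0 <= f z)%E -> (\int[leb2]_z f (plane_shift n z) = \int[leb2]_z f z)%E.
Proof. exact: ge0_integral_shift2. Qed.

End PlaneTiling.

(** * The Plancherel identity *)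

Section Plancherel.
Context {R : realType}.

Local Notation L := (measurableTypeR R).
Local Notation count := (@nat_counting R).
(* written with 1^-1 to match the support of cexp 1 *)
Local Notation D := (`[0, 1^-1[%classic : set R).

Definition fourier (F : R -> R[i]) (nu : R) : R[i] :=
  cint leb (fun t => F t * expi (- (2 * pi * nu * t))).

Variable phi : nat -> int.
Hypothesis phi_bij : bijective phi.

Local Notation shift n t := (line_shift (1 : R) phi n t).

Lemma cintegrable_expi_nat (c : nat -> R[i]) (r : nat -> R) : cintegrable count c ->
  cintegrable count (fun n => c n * expi (r n)).
Proof.
move=> jc; apply: (@cintegrableMbounded _ _ _ _ _ _ 1) => //.
by move=> n; rewrite mod_expi.
Qed.

Section Zak.
Variable F : R -> R[i].
Hypothesis F_int : cintegrable leb F.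

(** The Zak transform, up to a phase. *)
Definition zak (nu t : R) : R[i] :=
  psum (fun n => F (shift n t) * expi (- (2 * pi * nu * shift n t))).

Let ind (t : R) : R[i] := (\1_D t : R)%:C.

Let ind_idem t : ind t * ind t = ind t.
Proof. by rewrite /ind indicE -rmorphM; case: (_ \in _); rewrite ?mulr1 ?mulr0. Qed.

Let ind_out t : ~ D t -> ind t = 0.
Proof. by move=> Dt; rewrite /ind indicE memNset. Qed.

Let mind : @cmeasurable _ L R ind.
Proof. by apply: cmeasurable_indic; exact: measurable_itv. Qed.

Lemma cmeasurable_zak :
  @cmeasurable _ (L * L)%type R (fun z => zak z.1 z.2).
Proof.
pose h (q : (L * L) * nat) := F (shift q.2 q.1.2) * expi (- (2 * pi * q.1.1 * shift q.2 q.1.2)).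
suff mh : cmeasurable h by exact: (cmeasurable_cint2 count mh).
have ms n : @measurable_fun _ _ (L * L)%type L setT (fun z => shift n z.2).
  exact: measurableT_comp (measurable_line_shift 1 phi n) measurable_snd.
have mn n : @cmeasurable _ (L * L)%type R
    (fun z => F (shift n z.2) * expi (- (2 * pi * z.1 * shift n z.2))).
  apply: cmeasurableM; first exact: cmeasurable_comp (ms n) F_int.1.
  apply: cmeasurable_expi; apply: measurable_funN; apply: measurable_funM; last exact: ms.
  by apply: measurable_funM; [exact: measurable_cst|exact: measurable_fst].
by split; apply: measurable_prod_nat => n; case: (mn n).
Qed.

Let mzak1 nu : @cmeasurable _ L R (zak nu).
Proof. exact: (cmeasurable_section1 nu cmeasurable_zak). Qed.

Let mzak2 t : @cmeasurable _ L R (zak ^~ t).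
Proof. exact: (cmeasurable_section2 t cmeasurable_zak). Qed.

Let F_mod_int (nu : R) : cintegrable leb (fun t => F t * expi (- (2 * pi * nu * t))).
Proof.
apply: (@cintegrableMbounded _ _ _ _ _ _ 1) => //.
- by apply: cmeasurable_expi; apply: measurable_funN; exact: mulrl_measurable.
- by move=> t; rewrite mod_expi.
Qed.

Let tiled := line_tiles (@ltr01 R) phi_bij.

(** Integer shifts do not change the exponential of frequency [k], which therefore
    factors out of the periodization. *)
Lemma fourier_zak (nu : R) (k : int) :
  fourier F (nu + k%:~R / 1) = inner leb (fun t => ind t * zak nu t) (cexp 1 k).
Proof.
rewrite /fourier (periodize_cint tiled (F_mod_int _)); apply: cint_ae_eq.
- exact: (periodization_cintegrable tiled (F_mod_int _)).1.
- apply: cmeasurableM; first exact: cmeasurableM.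
  exact/cmeasurableJ/L2_meas/cexp_L2.
apply: filterS (ae_periodize_cintegrable tiled F_int) => t jt.
have [Dt|Dt] := pselect (D t); last by rewrite -/(ind t) ind_out// !mul0r.
have jnu := cintegrable_expi_nat (fun n => - (2 * pi * nu * shift n t)) (jt Dt).
rewrite /cexp conjcM conjc_real conjc_expi -/(ind t).
transitivity (ind t * (expi (- (2 * pi * (k%:~R * 1 * t))) * zak nu t)); last first.
  by rewrite -[in LHS]ind_idem; ring.
congr (_ * _); rewrite /zak /psum -cintZ//; apply: eq_cint => n.
rewrite mulrCA; congr (_ * _); rewrite -expiD.
rewrite -[RHS]mul1r -(expi_int (- (k * phi n))) -expiD; congr expi.
by rewrite /line_shift !divr1 mulrNz intrM; ring.
Qed.

(** At fixed [t], the Zak transform is an absolutely convergent Fourier series in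
    [nu] with coefficients the values of [F] on [t + Z]. *)
Lemma N2_zak (t : R) : cintegrable count (fun n => F (shift n t)) ->
  N2 leb (fun nu => ind nu * zak nu t) = (\int[count]_n (mod (F (shift n t)) ^+ 2)%:E)%E.
Proof.
move=> jt.
pose u n : R -> R[i] := cexp 1 (- phi n).
pose c n := F (shift n t).
pose S nu := psum (fun n => c n * u n nu).
have phi_inj : injective phi by exact: bij_inj.
have uL2 n : L2 leb (u n) by exact: cexp_L2.
have u_orth n m : inner leb (u n) (u m) = if n == m then 1%:C else 0.
  by rewrite cexp_orth// eqr_opp (inj_eq phi_inj) invr1.
have mod_u n nu : mod (u n nu) <= 1.
  by rewrite modM mod_expi mul1r -/(ind nu) /ind indicE modR; case: (_ \in _);
     rewrite ?normr1 ?normr0.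
have u_out n nu : ~ D nu -> u n nu = 0 by exact: cexp_supp.
have S_out nu : ~ D nu -> S nu = 0.
  move=> h; rewrite /S /psum -[RHS](cint0 count); apply: eq_cint => n.
  by rewrite u_out// mulr0.
have jcu nu : cintegrable count (fun n => c n * u n nu).
  by apply: (cintegrableMbounded (cmeasurable_nat _) (mod_u ^~ nu)).
have mS : @cmeasurable _ L R S.
  have mh : cmeasurable (fun q : L * nat => c q.2 * u q.2 q.1).
    have mn n : @cmeasurable _ L R (fun x => c n * u n x).
      by apply: cmeasurableZ; exact: L2_meas.
    by split; apply: measurable_prod_nat => n; case: (mn n).
  exact: (cmeasurable_cint2 count mh).
have idb : bijective (@idfun nat) by exists idfun.
have c0 n : 0 <= mod (c n) by [].
have coo := esum_mod_lty (phi := idfun) idb (jt : cintegrable count (fun n => c (idfun n))).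
have wi : 0 < (1 : R)^-1 by rewrite invr1.
have jind := L2_indic_itvco wi.
have tail (eps : R) : 0 < eps -> exists F0 : {fset nat}, forall K, fsubset F0 K ->
    {ae leb, forall nu, mod ((S - \sum_(n <- K) (fun x => c n * u n x)) nu) <= mod (eps%:C * ind nu)}.
  move=> e0; have [F0 hF0] := psum_tail idb c0 coo e0; exists F0 => K F0K.
  apply: nearW => nu.
  rewrite -[X in mod X <= _]/(S nu - (\sum_(n <- K) (fun x => c n * u n x)) nu) fct_sumE.
  have [Dnu|Dnu] := pselect (D nu); last first.
    rewrite S_out// big1 ?subr0 ?mod0// => n _.
    by rewrite u_out// mulr0.
  rewrite /ind indicE mem_set// mulr1 modR ger0_norm ?(ltW e0)//.
  apply: ltW; apply: hF0 => // n.
  by rewrite modM ler_piMr.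
have jcuL n : L2 leb (fun x => c n * u n x) by exact: L2Z.
have cS : sums_to (L2norm leb) (fun n x => c n * u n x) S.
  apply/sums_to_N2 => eps e0.
  have sp : 0 < sqn leb ind + 1 by rewrite ltr_wpDl// sqn_ge0.
  have r0 : 0 < eps / (sqn leb ind + 1) by rewrite divr_gt0.
  have [|F0 hF0] := tail (Num.sqrt (eps / (sqn leb ind + 1))); first by rewrite sqrtr_gt0.
  exists F0 => K /hF0 hK; apply: le_lt_trans (N2_le _ _ hK) _.
  - by apply: cmeasurableB => //; apply/L2_meas/L2_sum.
  - exact: cmeasurableZ.
  rewrite N2Z// modR real_normK ?num_real// sqr_sqrtr ?(ltW r0)// (L2_fin jind) -EFinM lte_fin.
  rewrite -mulrA gtr_pMr// mulrC ltr_pdivrMr// mul1r -/ind.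
  by rewrite ltrDl.
have jS : L2 leb S.
  have [F0 /(_ F0 (fsubset_refl _)) hF0] := tail 1 ltr01.
  have jSum : L2 leb (\sum_(n <- F0) (fun x => c n * u n x)) by exact: L2_sum.
  have jd : L2 leb (S - \sum_(n <- F0) (fun x => c n * u n x)).
    apply: (L2_le _ (L2Z (1%:C) jind) hF0).
    by apply: cmeasurableB => //; exact: L2_meas jSum.
  by have := L2D jd jSum; rewrite subrK.
rewrite (psum_esum (phi := idfun) (a := fun n => (mod (c n) ^+ 2)%:E) idb); last first.
  by move=> n; rewrite lee_fin sqr_ge0.
have := sqn_orthogonal_expansion uL2 ltr01 u_orth jS cS.
under eq_esum do rewrite mul1r.
move=> ->; apply: eq_integral => nu _; congr (_ ^+ 2)%:E.
have [Dnu|Dnu] := pselect (D nu); last by rewrite S_out// ind_out// mul0r.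
rewrite /ind indicE mem_set// mul1r.
have -> : S nu = expi (2 * pi * nu * t) * zak nu t.
  have jz := cintegrable_expi_nat (fun n => - (2 * pi * nu * shift n t)) jt.
  rewrite /S /zak /psum -cintZ//; apply: eq_cint => n.
  rewrite /u /cexp -/(ind nu) /ind indicE mem_set// mulr1 [RHS]mulrCA; congr (_ * _).
  rewrite -expiD; congr expi; rewrite /line_shift divr1 mulrNz; ring.
by rewrite modM mod_expi mul1r.
Qed.

(** Parseval's identity is applied to the Zak transform twice: in [t] at fixed
    [nu], and in [nu] at fixed [t]. *)
Lemma plancherel_int : (N2 leb F < +oo)%E -> N2 leb (fourier F) = N2 leb F.
Proof.
move=> F2.
pose Z (z : L * L) := ind z.1 * ind z.2 * zak z.1 z.2.
have mZ : cmeasurable Z.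
  apply: cmeasurableM cmeasurable_zak; apply: cmeasurableM.
  - exact: cmeasurable_fst.
  - exact: cmeasurable_snd.
have mZ2 := measurable_mod2 mZ.
have Z0 z : (0 <= (mod (Z z) ^+ 2)%:E)%E by rewrite lee_fin sqr_ge0.
have mF2 := measurable_mod2 F_int.1.
have F0 t : (0 <= (mod (F t) ^+ 2)%:E)%E by rewrite lee_fin sqr_ge0.
have ind2 t (r : R[i]) : (mod (ind t * r) ^+ 2)%:E = ((\1_D t)%:E * (mod r ^+ 2)%:E)%E.
  by rewrite modM exprMn EFinM /ind modR indicE; case: (_ \in _);
     rewrite ?normr1 ?normr0 ?expr1n ?expr0n.
have ZF : (\int[leb2]_z (mod (Z z) ^+ 2)%:E = N2 leb F)%E.
  rewrite ge0_integral_leb2_swap// /N2 (periodize_ge0 tiled mF2 F0).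
  apply: ae_eq_integral => //.
  - apply: (@measurable_integral_leb _ (fun z => (mod (Z (z.2, z.1)) ^+ 2)%:E)) => //.
    exact: measurableT_comp mZ2 (@measurable_swap _ _ L L).
  - apply: emeasurable_funM.
      by apply/measurable_EFinP; apply: measurable_indic; exact: measurable_itv.
    have mq : measurable_fun setT (fun q : L * nat => (mod (F (shift q.2 q.1)) ^+ 2)%:E).
      apply: measurable_prod_nat => n.
      exact: measurableT_comp mF2 (measurable_line_shift 1 phi n).
    exact: (@measurable_fun_fubini_tonelli_F _ _ _ _ _ count _ mq).
  apply: filterS (ae_periodize_cintegrable tiled F_int) => t jt _.
  have ZE x : (mod (Z (x, t)) ^+ 2)%:E = ((\1_D t)%:E * (mod (ind x * zak x t) ^+ 2)%:E)%E.
    by rewrite -ind2 (_ : Z (x, t) = ind t * (ind x * zak x t))// /Z /=; ring.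
  under eq_integral do rewrite ZE.
  have [Dt|Dt] := pselect (D t); last first.
    rewrite indicE memNset// mul0e; under eq_integral do rewrite mul0e.
    by rewrite integral0.
  rewrite indicE mem_set// mul1e; under eq_integral do rewrite mul1e.
  exact: N2_zak (jt Dt).
have mfF : @cmeasurable _ L R (fourier F).
  have mh : @cmeasurable _ (L * L)%type R (fun z => F z.2 * expi (- (2 * pi * z.1 * z.2))).
    apply: cmeasurableM; first exact: cmeasurable_snd F_int.1.
    apply: cmeasurable_expi; apply: measurable_funN; apply: measurable_funM.
      by apply: measurable_funM; [exact: measurable_cst|exact: measurable_fst].
    exact: measurable_snd.
  exact: (cmeasurable_cint_leb mh).
have mfF2 := measurable_mod2 mfF.
have fF0 t : (0 <= (mod (fourier F t) ^+ 2)%:E)%E by rewrite lee_fin sqr_ge0.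
rewrite -ZF /N2 (periodize_ge0 tiled mfF2 fF0) ge0_integral_leb2//.
have mZi := measurable_integral_leb mZ2 Z0.
have Zfin : {ae leb, forall nu, (\int[leb]_t (mod (Z (nu, t)) ^+ 2)%:E < +oo)%E}.
  have iZ : leb.-integrable setT (fun nu => \int[leb]_t (mod (Z (nu, t)) ^+ 2)%:E)%E.
    apply/integrableP; split => //.
    under eq_integral do rewrite gee0_abs ?integral_ge0//.
    by move: F2; rewrite -ZF ge0_integral_leb2.
  apply: filterS (integrable_ae measurableT iZ) => nu /(_ I).
  by rewrite ge0_fin_numE// integral_ge0.
apply: ae_eq_integral => //.
- apply: emeasurable_funM.
    by apply/measurable_EFinP; apply: measurable_indic; exact: measurable_itv.
  have mq : measurable_fun setT (fun q : L * nat => (mod (fourier F (shift q.2 q.1)) ^+ 2)%:E).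
    apply: measurable_prod_nat => n.
    exact: measurableT_comp mfF2 (measurable_line_shift 1 phi n).
  exact: (@measurable_fun_fubini_tonelli_F _ _ _ _ _ count _ mq).
apply: filterS Zfin => nu Znu _.
have [Dnu|Dnu] := pselect (D nu); last first.
  have ZE t : (mod (Z (nu, t)) ^+ 2)%:E = 0%E.
    by rewrite (_ : Z (nu, t) = 0) ?mod0 ?expr0n// /Z /= ind_out// !mul0r.
  by rewrite indicE memNset// mul0e; under eq_integral do rewrite ZE; rewrite integral0.
have ZE : (\int[leb]_t (mod (Z (nu, t)) ^+ 2)%:E = N2 leb (fun t => ind t * zak nu t)%R)%E.
  apply: eq_integral => t _; rewrite (_ : Z (nu, t) = ind t * zak nu t)// /Z.
  by rewrite [ind (nu, t).1](_ : _ = 1) ?mul1r// /ind indicE mem_set.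
have jz : L2 leb (fun t => ind t * zak nu t).
  by apply/L2P; split; [exact: cmeasurableM|rewrite -ZE].
rewrite ZE indicE mem_set// mul1e.
have w1 : 0 < (1 : R) by [].
have vp : 0 < (1 : R)^-1 by rewrite invr1.
rewrite -(@parseval _ L R leb _ (cexp 1) 1^-1 (cexp_L2 w1) vp (cexp_orth w1) D
  (measurable_itv _) (@cexp_supp _ 1) (cexp_total w1) _ jz); last first.
  by move=> t Dt; rewrite ind_out// mul0r.
rewrite -(psum_esum (a := fun k => (mod (inner leb (fun t => ind t * zak nu t) (cexp 1 k)) ^+ 2 / 1^-1)%:E) phi_bij); last first.
  by move=> k; rewrite lee_fin invr1 divr1 sqr_ge0.
by apply: eq_integral => n _; rewrite invr1 divr1 -fourier_zak.
Qed.

End Zak.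
End Plancherel.

Lemma plancherel {R : realType} (F : R -> R[i]) : cintegrable leb F -> L2 leb F ->
  N2 leb (fourier F) = N2 leb F.
Proof.
move=> jF /L2P[_ F2]; have [phi phi_bij] := nat_enum_int.
exact: (plancherel_int phi_bij jF F2).
Qed.

(** * The spreading function of a kernel *)

(** The squared norms at the multiples 1, -1, i and -i determine the pairing. *)
Lemma polarization d1 d2 (T1 : measurableType d1) (T2 : measurableType d2) (R : realType)
    (m1 : {measure set T1 -> \bar R}) (m2 : {measure set T2 -> \bar R})
    (f g : T1 -> R[i]) (F G : T2 -> R[i]) :
  L2 m1 f -> L2 m1 g -> L2 m2 F -> L2 m2 G ->
  (forall c : R[i], sqn m2 (F + (fun x => c * G x)) = sqn m1 (f + (fun x => c * g x))) ->
  inner m2 F G = inner m1 f g.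
Proof.
move=> jf jg jF jG h.
have key (c : R[i]) : complex.Re (conjc c * inner m2 F G) - complex.Re (conjc c * inner m1 f g) =
   ((sqn m1 f - sqn m2 F) + mod c ^+ 2 * (sqn m1 g - sqn m2 G)) / 2.
  have := h c; rewrite !sqnD; do ?[by [|exact: L2Z]].
  by rewrite !innerZr// !sqnZ//; lra.
have := key 1; have := key (-1); have := key 'i; have := key (- 'i).
rewrite !modN mod1 (_ : mod 'i = 1); last by rewrite /= expr0n expr1n add0r sqrtr1.
case: (inner m2 F G) => a b; case: (inner m1 f g) => a' b' /= h1 h2 h3 h4.
by apply: complex_eq => /=; lra.
Qed.

Section ComplexTranslation.
Context {R : realType}.
Local Notation L := (measurableTypeR R).

Lemma cint_shift (c : R) (f : R -> R[i]) : @cmeasurable _ L R f ->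
  cint leb (fun x => f (x + c)) = cint leb f.
Proof.
have part (u : R -> R) : @measurable_fun _ _ L L setT u ->
    \int[leb]_x u (x + c) = \int[leb]_x u x.
  move=> mu; have mE : @measurable_fun _ _ L _ setT (EFin \o u) by exact/measurable_EFinP.
  rewrite /Rintegral; congr fine; rewrite [LHS]integralE [RHS]integralE.
  rewrite -(ge0_integral_shift c (measurable_funepos mE))//.
  rewrite -(ge0_integral_shift c (measurable_funeneg mE))//.
  congr (_ - _)%E; apply: eq_integral => x _.
  - by rewrite !funeposE.
  - by rewrite !funenegE.
move=> [mR mI]; apply: complex_eq.
- exact: (part (fun x => complex.Re (f x)) mR).
- exact: (part (fun x => complex.Im (f x)) mI).
Qed.

Lemma L2_shift (c : R) (f : R -> R[i]) : L2 leb f -> L2 leb (fun x => f (x + c)).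
Proof.
move=> jf; have mf := L2_meas jf; apply/L2P; split.
  exact: cmeasurable_comp (measurable_shift c) mf.
rewrite /N2 (ge0_integral_shift c (measurable_mod2 mf)).
  by rewrite -/(N2 leb f) (L2_fin jf) ltry.
by move=> x; rewrite lee_fin sqr_ge0.
Qed.

Lemma L2_expiM (r : R -> R) (f : R -> R[i]) : @measurable_fun _ _ L L setT r ->
  L2 leb f -> L2 leb (fun x => expi (r x) * f x).
Proof.
move=> mr jf; under eq_fun do rewrite mulrC.
apply: (@L2Mbounded _ _ _ _ _ _ 1) => //; first exact: cmeasurable_expi.
by move=> x; rewrite mod_expi.
Qed.

Lemma L2_tfshift (z : R * R) (f : R -> R[i]) : L2 leb f -> L2 leb (tfshift z f).
Proof.
by move=> jf; apply: L2_expiM; [exact: mulrl_measurable|exact: L2_shift].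
Qed.

Lemma ae_leb2_fst (P : R -> Prop) : {ae leb, forall x, P x} -> {ae leb2, forall z, P z.1}.
Proof.
move=> [N [mN N0 NP]]; exists (N `*` setT); split.
- exact: measurableX.
- have := @product_measure1E _ _ L L R (@lebesgue_measure R) (@lebesgue_measure R) N setT mN measurableT.
  by move=> E; rewrite [LHS]E; apply: (etrans (congr1 (fun x => x * _)%E N0)); rewrite mul0e.
- by move=> z /= nP; split => //; apply: NP.
Qed.

End ComplexTranslation.

Section Spreading.
Context {R : realType}.
Local Notation L := (measurableTypeR R).
Implicit Types kappa : R * R -> R[i].

Definition spr kappa (z : R * R) : R[i] :=
  fourier (fun t => kappa (t, t - z.1)) z.2.

(** For these kernels the spreading function is a genuine integral, with no limit
    to take. Kernels truncated in the first variable and rank one kernels are of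
    this kind. *)
Definition sprdom kappa : Prop :=
  L2 leb2 kappa /\ {ae leb, forall b, cintegrable leb (fun t => kappa (t, t - b))}.

Lemma measurable_shear : @measurable_fun _ _ (L * L)%type (L * L)%type setT
  (fun z => (z.2, z.2 - z.1)).
Proof.
apply: measurable_fun_pair; first exact: measurable_snd.
by apply: measurable_funB; [exact: measurable_snd|exact: measurable_fst].
Qed.

Lemma shear_ge0 (f : R * R -> \bar R) : @measurable_fun _ _ (L * L)%type _ setT f ->
  (forall z, 0 <= f z)%E ->
  (\int[leb]_b \int[leb]_t f (t, t - b)%R = \int[leb2]_z f z)%E.
Proof.
move=> mf f0; have mfs := measurableT_comp mf measurable_shear.
have f0s z : (0 <= (f \o (fun z : L * L => (z.2, z.2 - z.1)%R)) z)%E by exact: f0.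
rewrite -(ge0_integral_leb2 mfs f0s) (ge0_integral_leb2_swap mfs f0s) ge0_integral_leb2//.
apply: eq_integral => t _; apply: (ge0_integral_reflect t (f := fun s => f (t, s))) => //.
exact: measurableT_comp mf (pair1_measurable t).
Qed.

Lemma N2_slices kappa : L2 leb2 kappa ->
  (\int[leb]_b N2 leb (fun t => kappa (t, t - b)%R) = N2 leb2 kappa)%E.
Proof.
by move=> jk; apply: (shear_ge0 (measurable_mod2 (L2_meas jk))) => z; rewrite lee_fin sqr_ge0.
Qed.

Lemma cmeasurable_slice2 kappa : @cmeasurable _ (L * L)%type R kappa ->
  @cmeasurable _ (L * L)%type R (fun z => kappa (z.2, z.2 - z.1)).
Proof. exact: cmeasurable_comp measurable_shear. Qed.

Lemma ae_L2_row kappa : L2 leb2 kappa -> {ae leb, forall t, L2 leb (fun s => kappa (t, s))}.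
Proof.
move=> jk; have mk := L2_meas jk; have m2 := measurable_mod2 mk.
have k0 z : (0 <= (mod (kappa z) ^+ 2)%:E)%E by rewrite lee_fin sqr_ge0.
have ik : leb.-integrable setT (fun t => N2 leb (fun s => kappa (t, s))).
  apply/integrableP; split; first exact: measurable_integral_leb m2 k0.
  under eq_integral do rewrite gee0_abs ?N2_ge0//.
  by rewrite -(ge0_integral_leb2 m2 k0) -/(N2 leb2 kappa) (L2_fin jk) ltry.
apply: filterS (integrable_ae measurableT ik) => t /(_ I).
rewrite ge0_fin_numE ?N2_ge0// => h; apply/L2P; split => //.
exact: (cmeasurable_section1 t mk).
Qed.

Lemma ae_L2_slice kappa : L2 leb2 kappa ->
  {ae leb, forall b, L2 leb (fun t => kappa (t, t - b))}.
Proof.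
move=> jk; apply: (ae_L2_row (kappa := fun z => kappa (z.2, z.2 - z.1))).
have mk := cmeasurable_slice2 (L2_meas jk); apply/L2P; split => //.
have k0 z : (0 <= (mod (kappa (z.2, z.2 - z.1)) ^+ 2)%:E)%E by rewrite lee_fin sqr_ge0.
rewrite /N2 (ge0_integral_leb2 (measurable_mod2 mk) k0).
by move: (N2_slices jk); rewrite /N2 => ->; rewrite -/(N2 leb2 kappa) (L2_fin jk) ltry.
Qed.

Lemma cmeasurable_spr kappa : @cmeasurable _ (L * L)%type R kappa ->
  @cmeasurable _ (L * L)%type R (spr kappa).
Proof.
move=> mk.
pose h (q : (L * L) * L) := kappa (q.2, q.2 - q.1.1) * expi (- (2 * pi * q.1.2 * q.2)).
suff mh : cmeasurable h by exact: (cmeasurable_cint2 (@lebesgue_measure R) mh).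
have m11 : @measurable_fun _ _ ((L * L) * L)%type L setT (fun q => q.1.1).
  exact: measurableT_comp measurable_fst measurable_fst.
have m12 : @measurable_fun _ _ ((L * L) * L)%type L setT (fun q => q.1.2).
  exact: measurableT_comp measurable_snd measurable_fst.
apply: cmeasurableM.
- apply: (cmeasurable_comp (f := kappa) (phi := fun q : (L * L) * L => (q.2, q.2 - q.1.1))) => //.
  apply: measurable_fun_pair; first exact: measurable_snd.
  by apply: measurable_funB => //; exact: measurable_snd.
- apply: cmeasurable_expi; apply: measurable_funN; apply: measurable_funM; last exact: measurable_snd.
  by apply: measurable_funM => //; exact: measurable_cst.
Qed.

(** Plancherel on almost every slice. *)
Lemma N2_spr kappa : sprdom kappa -> N2 leb2 (spr kappa) = N2 leb2 kappa.
Proof.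
move=> [jk ik]; have mk := L2_meas jk.
have ms2 := measurable_mod2 (cmeasurable_spr mk).
have s0 z : (0 <= (mod (spr kappa z) ^+ 2)%:E)%E by rewrite lee_fin sqr_ge0.
apply: etrans (ge0_integral_leb2 ms2 s0) _; apply: etrans (N2_slices jk).
apply: ae_eq_integral => //.
- exact: measurable_integral_leb ms2 s0.
- apply: (measurable_integral_leb (measurable_mod2 (cmeasurable_slice2 mk))) => z.
  by rewrite lee_fin sqr_ge0.
by apply: filterS2 ik (ae_L2_slice jk) => b ib jb _; exact: (plancherel ib jb).
Qed.

Lemma L2_spr kappa : sprdom kappa -> L2 leb2 (spr kappa).
Proof.
move=> dk; apply/L2P; split; first exact: cmeasurable_spr (L2_meas dk.1).
by rewrite N2_spr// (L2_fin dk.1) ltry.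
Qed.

Lemma sprdomDZ kappa kappa' (c : R[i]) : sprdom kappa -> sprdom kappa' ->
  sprdom (kappa + (fun z => c * kappa' z)).
Proof.
move=> [jk ik] [jk' ik']; split; first by apply: L2D => //; exact: L2Z.
apply: filterS2 ik ik' => b ib ib'; apply: cintegrableD => //.
exact: cintegrableZ.
Qed.

Lemma sprDZ kappa kappa' (c : R[i]) : sprdom kappa -> sprdom kappa' ->
  {ae leb2, forall z, spr (kappa + (fun z => c * kappa' z)) z =
                      spr kappa z + c * spr kappa' z}.
Proof.
move=> [jk ik] [jk' ik'].
apply: filterS2 (ae_leb2_fst ik) (ae_leb2_fst ik') => -[b nu] /= ib ib'.
have E f : cintegrable leb f -> cintegrable leb (fun t => f t * expi (- (2 * pi * nu * t))).
  move=> jf; apply: (@cintegrableMbounded _ _ _ _ _ _ 1) => //.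
  - by apply: cmeasurable_expi; apply: measurable_funN; exact: mulrl_measurable.
  - by move=> t; rewrite mod_expi.
rewrite /spr /fourier /= -cintZ; last exact: E.
rewrite -cintD; [|exact: E|by apply: cintegrableZ; exact: E].
by apply: eq_cint => t; rewrite -[X in X * _]/(kappa (t, t - b) + c * kappa' (t, t - b)); ring.
Qed.

Lemma inner_spr kappa kappa' : sprdom kappa -> sprdom kappa' ->
  inner leb2 (spr kappa) (spr kappa') = inner leb2 kappa kappa'.
Proof.
move=> dk dk'; apply: polarization; [exact: dk.1|exact: dk'.1|exact: L2_spr..|] => c.
rewrite /sqn -(N2_spr (sprdomDZ c dk dk')); congr fine; apply: N2_ae_eq.
- apply: L2_meas; apply: L2D; [exact: L2_spr|apply: L2Z; exact: L2_spr].
- by apply: L2_meas; apply: L2_spr; exact: sprdomDZ.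
- by apply: filterS (sprDZ c dk dk') => z ->.
Qed.

Definition truncate (r : R) kappa (z : R * R) : R[i] := (\1_(`[- r, r]%classic) z.1)%:C * kappa z.

Let mod_ind (A : set R) (x : R) : mod ((\1_A x : R)%:C) <= 1.
Proof. by rewrite modR indicE; case: (_ \in _); rewrite ?normr1 ?normr0. Qed.

Lemma sprdom_truncate r kappa : L2 leb2 kappa -> sprdom (truncate r kappa).
Proof.
move=> jk.
have mI : @cmeasurable _ L R (fun x => (\1_(`[- r, r]%classic) x : R)%:C).
  by apply: cmeasurable_indic; exact: measurable_itv.
split.
  rewrite /truncate; under eq_fun do rewrite mulrC.
  apply: (@L2Mbounded _ _ _ _ _ _ 1) => //; first exact: cmeasurable_fst mI.
apply: filterS (ae_L2_slice jk) => b jb.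
have jI : L2 leb (fun x : R => (\1_(`[- r, r]%classic) x : R)%:C).
  apply: (@L2_indic _ L R leb); first exact: measurable_itv.
  suff : (lebesgue_measure `[(- r)%R, r]%classic < +oo)%E by [].
  by rewrite lebesgue_measure_itv /=; case: ifP => _; rewrite -?EFinD ltry.
have := inner_cintegrable jI (L2J jb); congr cintegrable; apply/funext => t.
by rewrite conjcK.
Qed.

Lemma truncated_spreadingE kappa r : truncated_spreading kappa r = spr (truncate r kappa).
Proof.
apply/funext => z; rewrite /truncated_spreading /spr /fourier; apply: eq_cint => t.
by rewrite /truncate mulrA.
Qed.

Lemma truncate_cvg kappa : L2 leb2 kappa ->
  N2 leb2 (kappa - truncate n%:R kappa) @[n --> \oo] --> (0 : \bar R).
Proof.
move=> jk; have mk := L2_meas jk.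
have mt n : @cmeasurable _ (L * L)%type R (truncate n%:R kappa) by exact: L2_meas (sprdom_truncate _ jk).1.
have mn n : @measurable_fun _ _ (L * L)%type _ setT
    (fun z => (mod ((kappa - truncate n%:R kappa) z) ^+ 2)%:E).
  by apply: measurable_mod2; exact: cmeasurableB.
have ik : leb2.-integrable setT (fun z => (mod (kappa z) ^+ 2)%:E).
  apply/integrableP; split; first exact: measurable_mod2.
  under eq_integral do rewrite gee0_abs ?lee_fin ?sqr_ge0//.
  by rewrite -/(N2 leb2 kappa) (L2_fin jk) ltry.
have tE n z : (kappa - truncate n%:R kappa) z = kappa z - (\1_(`[- n%:R, n%:R]%classic) z.1)%:C * kappa z.
  by [].
have [||_ _] := dominated_convergence measurableT mn (measurable_cst (0%E : \bar R)) _ ik.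
- apply: nearW => z _; apply: cvg_near_cst.
  near=> n; rewrite tE indicE mem_set ?mul1r ?subrr ?mod0 ?expr0n//=.
  rewrite in_itv /= -ler_norml; near: n.
  exact: nbhs_infty_ger.
- apply: nearW => z n _; rewrite abse_EFin lee_fin ger0_norm ?sqr_ge0//.
  rewrite ler_pXn2r ?nnegrE// tE indicE; case: (_ \in _).
  + by rewrite mul1r subrr mod0.
  + by rewrite mul0r subr0.
by rewrite integral0.
Unshelve. all: by end_near. Qed.

(** [inner_spr] transports the pairing with a truncated kernel, and both sides are
    continuous along the limit that defines the spreading function. *)
Lemma inner_spreading kappa eta kappa' : L2 leb2 kappa -> L2 leb2 eta -> sprdom kappa' ->
  L2norm leb2 (eta - truncated_spreading kappa r) @[r --> +oo] --> (0 : \bar R) ->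
  inner leb2 eta (spr kappa') = inner leb2 kappa kappa'.
Proof.
move=> jk je dk' hlim; have jk' := dk'.1; have js' := L2_spr dk'.
apply/eqP; rewrite -subr_eq0; apply/eqP/mod_eq0/eqP.
rewrite eq_le mod_ge0 andbT; apply/ler_addgt0Pl => eps e0; rewrite addr0.
set K := sqn leb2 kappa' + 1.
have Kp : 0 < K by rewrite ltr_wpDl// sqn_ge0.
have sK : sqn leb2 (spr kappa') = sqn leb2 kappa' by rewrite /sqn N2_spr.
(* with this d, Cauchy-Schwarz bounds each of the two error terms by eps / 2 *)
set d := (eps / 2) ^+ 2 / K.
have dp : 0 < d by rewrite divr_gt0// exprn_gt0// divr_gt0.
have [n [hn1 hn2]] : exists n : nat, (N2 leb2 (eta - spr (truncate n%:R kappa))%R < d%:E)%E /\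
    (N2 leb2 (kappa - truncate n%:R kappa)%R < d%:E)%E.
  have sd0 : 0 < Num.sqrt d by rewrite sqrtr_gt0.
  have h1 : \forall r \near +oo, (L2norm leb2 (eta - truncated_spreading kappa r)%R < (Num.sqrt d)%:E)%E.
    exact: hlim _ (nbhs_open_ereal_lt (f := fun=> Num.sqrt d) sd0).
  have h2 : \forall n \near \oo, (N2 leb2 (kappa - truncate n%:R kappa)%R < d%:E)%E.
    exact: (truncate_cvg jk) _ (nbhs_open_ereal_lt (f := fun=> d) dp).
  have [M [_ hM]] := h1.
  have h3 : \forall n \near \oo, M < (n%:R : R) by exact: nbhs_infty_gtr.
  have [n [hn1 hn2]] : exists n : nat, M < (n%:R : R) /\ (N2 leb2 (kappa - truncate n%:R kappa)%R < d%:E)%E.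
    by near \oo => n; exists n; split; near: n.
  exists n; split => //; have := hM _ hn1.
  by rewrite truncated_spreadingE L2norm_lt ?(ltW sd0)// sqr_sqrtr// (ltW dp).
have dn := sprdom_truncate n%:R jk; have jn := dn.1; have jsn := L2_spr dn.
have bound (u v : R * R -> R[i]) : L2 leb2 u -> L2 leb2 v -> (N2 leb2 u < d%:E)%E ->
    sqn leb2 v = sqn leb2 kappa' -> mod (inner leb2 u v) <= eps / 2.
  move=> ju jv hu hv; rewrite -(@ler_pXn2r _ 2)// ?nnegrE ?mod_ge0 ?(ltW (divr_gt0 _ _))//.
  apply: le_trans (cauchy_schwarz ju jv) _.
  rewrite hv (_ : (eps / 2) ^+ 2 = d * K); last by rewrite /d divfK// gt_eqF.
  apply: ler_pM; rewrite ?sqn_ge0//; last by rewrite lerDl.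
  by rewrite -lee_fin -(L2_fin ju) ltW.
have -> : inner leb2 eta (spr kappa') - inner leb2 kappa kappa' =
    inner leb2 (eta - spr (truncate n%:R kappa)) (spr kappa') -
    inner leb2 (kappa - truncate n%:R kappa) kappa'.
  by rewrite !innerBl// inner_spr//; ring.
apply: le_trans (modD _ _) _; rewrite modN [leRHS]splitr; apply: lerD; apply: bound => //.
- exact: L2B.
- exact: L2B.
Unshelve. all: by end_near. Qed.

End Spreading.

(** * Integral operators *)

Section Kernels.
Context {R : realType}.
Local Notation L := (measurableTypeR R).
Implicit Types (kappa : R * R -> R[i]) (f g h : R -> R[i]).

Definition kernel_op kappa f (t : R) : R[i] := cint leb (fun s => kappa (t, s) * f s).

Lemma kernel_opE kappa f t :
  kernel_op kappa f t = inner leb (fun s => kappa (t, s)) (fun s => conjc (f s)).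
Proof. by apply: eq_cint => s; rewrite conjcK. Qed.

Lemma cmeasurable_kernel_op kappa f : @cmeasurable _ (L * L)%type R kappa ->
  @cmeasurable _ L R f -> @cmeasurable _ L R (kernel_op kappa f).
Proof.
move=> mk mf; apply: (cmeasurable_cint_leb (f := fun z => kappa z * f z.2)).
by apply: cmeasurableM => //; exact: cmeasurable_snd.
Qed.

Lemma N2_rows kappa : L2 leb2 kappa ->
  (\int[leb]_t N2 leb (fun s => kappa (t, s)) = N2 leb2 kappa)%E.
Proof.
move=> jk; apply/esym; apply: (ge0_integral_leb2 (measurable_mod2 (L2_meas jk))) => z.
by rewrite lee_fin sqr_ge0.
Qed.

Lemma N2_kernel_op kappa f : L2 leb2 kappa -> L2 leb f ->
  (N2 leb (kernel_op kappa f) <= N2 leb f * N2 leb2 kappa)%E.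
Proof.
move=> jk jf; have mk := L2_meas jk; have m2 := measurable_mod2 mk.
have k0 z : (0 <= (mod (kappa z) ^+ 2)%:E)%E by rewrite lee_fin sqr_ge0.
rewrite -(N2_rows jk) (L2_fin jf) -ge0_integralZl//; first last.
- by rewrite lee_fin sqn_ge0.
- by move=> t _; exact: N2_ge0.
- exact: measurable_integral_leb m2 k0.
apply: ae_ge0_le_integral => //.
- by move=> t _; rewrite lee_fin sqr_ge0.
- exact: measurable_mod2 (cmeasurable_kernel_op mk (L2_meas jf)).
- by move=> t _; rewrite mule_ge0 ?N2_ge0// lee_fin sqn_ge0.
- by apply: measurable_funeM; exact: measurable_integral_leb m2 k0.
apply: filterS (ae_L2_row jk) => t jt _; rewrite kernel_opE (L2_fin jt) -EFinM lee_fin mulrC.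
have <- : sqn leb (fun s => conjc (f s)) = sqn leb f by rewrite /sqn N2J.
exact: cauchy_schwarz jt (L2J jf).
Qed.

Lemma L2_kernel_op kappa f : L2 leb2 kappa -> L2 leb f -> L2 leb (kernel_op kappa f).
Proof.
move=> jk jf; apply/L2P; split; first exact: cmeasurable_kernel_op (L2_meas jk) (L2_meas jf).
by apply: le_lt_trans (N2_kernel_op jk jf) _; rewrite (L2_fin jk) (L2_fin jf) -EFinM ltry.
Qed.

Lemma kernel_opB kappa kappa' f : L2 leb2 kappa -> L2 leb2 kappa' -> L2 leb f ->
  {ae leb, forall t, kernel_op (kappa - kappa') f t = kernel_op kappa f t - kernel_op kappa' f t}.
Proof.
move=> jk jk' jf; apply: filterS2 (ae_L2_row jk) (ae_L2_row jk') => t jt jt'.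
by rewrite !kernel_opE -innerBl//; exact: L2J.
Qed.

End Kernels.

Section HilbertSchmidtNorm.
Context {R : realType}.
Local Notation L := (measurableTypeR R).
Implicit Types (e : nat -> R -> R[i]) (f : R -> R[i]).

(** Convergence of the expansions gives totality: a function orthogonal to the
    basis is the limit of zero sums. *)
Lemma orthonormal_basis_parseval e f : orthonormal_basis e -> L2 leb f ->
  (\sum_(0 <= n <oo) (mod (inner leb f (e n)) ^+ 2)%:E = N2 leb f)%E.
Proof.
move=> [je oe ce] jf.
have oe' i j : inner leb (e i) (e j) = if i == j then (1 : R)%:C else 0.
  by rewrite oe; case: (i == j).
have te k : L2 leb k -> (forall x, ~ setT x -> k x = 0) ->
    (forall i, inner leb k (e i) = 0) -> {ae leb, forall x, k x = 0}.
  move=> jk _ k0; apply: (N2_eq0 (L2_meas jk)).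
  have /cvg_lim := ce k jk; rewrite (_ : (fun N => _) = fun=> L2norm leb k); last first.
    apply/funext => N; congr (L2norm leb _); apply/funext => x.
    rewrite -[LHS]/(k x - _) [X in _ - X](_ : _ = 0) ?subr0// fct_sumE big1// => i _.
    by rewrite k0 mul0r.
  rewrite lim_cst// => k00; rewrite -L2norm_sqr k00// poweR0r//.
have e_supp (i : nat) (x : L) : ~ [set: L] x -> e i x = 0 by move=> /(_ I).
have f_supp (x : L) : ~ [set: L] x -> f x = 0 by move=> /(_ I).
rewrite -(@parseval _ L R leb _ e 1 je ltr01 oe' setT measurableT e_supp te f jf f_supp).
rewrite nneseries_esumT; first by apply: eq_esum => n _; rewrite divr1.
by move=> n; rewrite lee_fin sqr_ge0.
Qed.

(** The squares of the integrals of a row against the members of the basis are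
    the squared coefficients of the conjugate row; Parseval on almost every row
    and Tonelli give the norm of the kernel. *)
Lemma HSnorm_kernel e (K : (R -> R[i]) -> R -> R[i]) kappa : orthonormal_basis e ->
  L2 leb2 kappa ->
  (forall f, L2 leb f -> @cmeasurable _ L R (K f)) ->
  (forall f, L2 leb f -> {ae leb, forall t, K f t = kernel_op kappa f t}) ->
  HSnorm e K = L2norm leb2 kappa.
Proof.
move=> be jk mK Kk; have [je _ _] := be.
rewrite L2normE /HSnorm; congr (_ `^ _)%E.
have mop n : @cmeasurable _ L R (kernel_op kappa (e n)).
  exact: cmeasurable_kernel_op (L2_meas jk) (L2_meas (je n)).
under eq_eseriesr => n _.
  rewrite L2norm_sqr (N2_ae_eq (mK _ (je n)) (mop n) (Kk _ (je n))).
  over.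
rewrite -(@integral_nneseries _ L R leb setT measurableT (fun n t => (mod (kernel_op kappa (e n) t) ^+ 2)%:E)).
- rewrite -(N2_rows jk); apply: ae_eq_integral => //.
  + apply: ge0_emeasurable_sum => [n t _ _|n _]; first by rewrite lee_fin sqr_ge0.
    exact: measurable_mod2.
  + by apply: (measurable_integral_leb (measurable_mod2 (L2_meas jk))) => z; rewrite lee_fin sqr_ge0.
  apply: filterS (ae_L2_row jk) => t jt _.
  rewrite -[RHS]N2J -(orthonormal_basis_parseval be (L2J jt)).
  apply: eq_eseriesr => n _; congr (_ ^+ 2)%:E.
  by rewrite kernel_opE (innerJ (L2J (je n)) jt) modJ; congr mod; apply: eq_cint => s; rewrite mulrC.
- by move=> n; exact: measurable_mod2.
- by move=> n t _; rewrite lee_fin sqr_ge0.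
Qed.

End HilbertSchmidtNorm.

(** * Kernels of Gabor multipliers *)

Section GaborKernels.
Context {R : realType}.
Local Notation L := (measurableTypeR R).
Variables (b0 nu0 : R) (g h : R -> R[i]).
Hypothesis (g_L2 : L2 leb g) (h_L2 : L2 leb h).
Implicit Types (z q : R * R) (m : int * int -> R[i]) (f : R -> R[i]) (s kappa : R * R -> R[i]).

(** The kernel of the rank one operator with range spanned by the shifted [h]. *)
Definition rank1_kernel z q : R[i] := tfshift z h q.1 * conjc (tfshift z g q.2).

Lemma rank1_kernel_L2 z : L2 leb2 (rank1_kernel z).
Proof.
apply: (@L2_tensor _ (tfshift z h) (fun t => conjc (tfshift z g t))).
  exact: L2_tfshift.
by apply: L2J; exact: L2_tfshift.
Qed.

Lemma sprdom_rank1 z : sprdom (rank1_kernel z).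
Proof.
split; first exact: rank1_kernel_L2.
apply: aeW => b; apply: inner_cintegrable; first exact: L2_tfshift.
exact: (L2_shift (- b) (L2_tfshift z g_L2)).
Qed.

(** Time-frequency shifts become modulations on the spreading side: this is
    what turns the lattice into a Fourier series. *)
Lemma spr_rank1 z q :
  spr (rank1_kernel z) q = expi (2 * pi * (z.2 * q.1 - z.1 * q.2)) * stft g h q.
Proof.
have jI : cintegrable leb (fun t => h t * conjc (tfshift q g t)).
  by apply: inner_cintegrable => //; exact: L2_tfshift.
rewrite /stft /inner -cintZ// -[RHS](cint_shift (- z.1)); last first.
  by apply: cmeasurableZ; exact: jI.1.
apply: eq_cint => t; rewrite /rank1_kernel /tfshift /modulation /translation /=.
rewrite !conjcM !conjc_expi (_ : t - q.1 - z.1 = t - z.1 - q.1); last by ring.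
rewrite (_ : expi (2 * pi * (z.2 * q.1 - z.1 * q.2)) * _ =
  expi (2 * pi * (z.2 * q.1 - z.1 * q.2)) * expi (- (2 * pi * q.2 * (t - z.1))) *
  (h (t - z.1) * conjc (g (t - z.1 - q.1)))); last by ring.
rewrite (_ : _ * _ * _ = expi (2 * pi * z.2 * t) * expi (- (2 * pi * z.2 * (t - q.1))) *
  expi (- (2 * pi * q.2 * t)) * (h (t - z.1) * conjc (g (t - z.1 - q.1)))); last by ring.
by rewrite -!expiD; congr (expi _ * _); ring.
Qed.

Lemma kernel_op_rank1 z f t : L2 leb f ->
  kernel_op (rank1_kernel z) f t = stft g f z * tfshift z h t.
Proof.
move=> jf; rewrite mulrC /stft /inner -cintZ; last first.
  by apply: inner_cintegrable => //; exact: L2_tfshift.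
by apply: eq_cint => s; rewrite /rank1_kernel /=; ring.
Qed.

Local Notation lp := (lattice_point b0 nu0).

Lemma rank1_row z t : L2 leb (fun x => rank1_kernel z (t, x)).
Proof. exact: (L2Z (tfshift z h t) (L2J (L2_tfshift z g_L2))). Qed.

Lemma kernel_op_rank1_sum m (F : {fset int * int}) f t : L2 leb f ->
  kernel_op (\sum_(p <- F) (fun q => m p * rank1_kernel (lp p) q)) f t =
  (\sum_(p <- F) (fun t => m p * stft g f (lp p) * tfshift (lp p) h t)) t.
Proof.
move=> jf; rewrite kernel_opE.
rewrite (_ : (fun x => _) = \sum_(p <- F) (fun x => m p * rank1_kernel (lp p) (t, x))); last first.
  by apply/funext => x; rewrite !fct_sumE.
rewrite inner_suml; [|by move=> p; apply: L2Z; exact: rank1_row|exact: L2J].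
rewrite fct_sumE; apply: eq_bigr => p _; rewrite innerZl; [|exact: rank1_row|exact: L2J].
by rewrite -kernel_opE kernel_op_rank1// mulrA.
Qed.

Lemma cmeasurable_gabor_multiplier m f :
  @cmeasurable _ L R (gabor_multiplier b0 nu0 g h m f).
Proof.
rewrite /gabor_multiplier /L2sum; case: xgetP => [s _ [/L2_meas//]|_].
exact: L2_meas (L2_0 leb).
Qed.

(** The norm of an integral operator is at most that of its kernel, so the
    expansion of the kernel gives, for every [f], that of the multiplier at [f]. *)
Lemma gabor_multiplierE m s f :
  expands leb2 (fun p => rank1_kernel (lp p)) m s -> L2 leb f ->
  {ae leb, forall t, gabor_multiplier b0 nu0 g h m f t = kernel_op s f t}.
Proof.
move=> [js hs] jf; pose w (p : int * int) t := m p * stft g f (lp p) * tfshift (lp p) h t.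
have jw p : L2 leb (w p) by apply: L2Z; exact: L2_tfshift.
have jop := L2_kernel_op js jf.
have hw : sums_to (L2norm leb) w (kernel_op s f).
  apply/sums_to_N2 => eps e0; set d := eps / (sqn leb f + 1).
  have Kp : 0 < sqn leb f + 1 by rewrite ltr_wpDl// sqn_ge0.
  have dp : 0 < d by rewrite divr_gt0.
  move/sums_to_N2: hs => /(_ d dp)[F0 hF]; exists F0 => F F0F; have {}hF := hF F F0F.
  set S := \sum_(p <- F) _ in hF.
  have jS : L2 leb2 S by apply: L2_sum => p; apply: L2Z; exact: rank1_kernel_L2.
  have jsS := L2B js jS.
  have -> : N2 leb (kernel_op s f - \sum_(p <- F) w p) = N2 leb (kernel_op (s - S) f).
    apply: N2_ae_eq; first exact: L2_meas (L2B jop (L2_sum _ jw)).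
      exact: L2_meas (L2_kernel_op jsS jf).
    apply: filterS (kernel_opB js jS jf) => t ->.
    by rewrite kernel_op_rank1_sum.
  apply: le_lt_trans (N2_kernel_op jsS jf) _.
  have -> : eps = (sqn leb f + 1) * d by rewrite mulrC divfK// gt_eqF.
  move: hF; rewrite (L2_fin jsS) (L2_fin jf) -EFinM !lte_fin => hF.
  apply: le_lt_trans (_ : (sqn leb f + 1) * sqn leb2 (s - S) < _).
    by rewrite ler_wpM2r ?sqn_ge0// lerDl.
  by rewrite ltr_pM2l.
rewrite /gabor_multiplier /L2sum.
case: xgetP => [s' _ [js' hs']|/(_ (kernel_op s f)) []]; last by split.
exact: sums_to_L2_unique jw js' jop hs' hw.
Qed.

Lemma HSnorm_residual e (H : (R -> R[i]) -> R -> R[i]) kappa m s :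
  orthonormal_basis e -> (forall f, L2 leb f -> L2 leb (H f)) ->
  integral_kernel H kappa -> expands leb2 (fun p => rank1_kernel (lp p)) m s ->
  HSnorm e (H - gabor_multiplier b0 nu0 g h m) = L2norm leb2 (kappa - s).
Proof.
move=> be jH [jk Hk] es; apply: HSnorm_kernel be (L2B jk es.1) _ _ => f jf.
  apply: cmeasurableB; first exact: L2_meas (jH f jf).
  exact: cmeasurable_gabor_multiplier.
apply: filterS3 (Hk f jf) (gabor_multiplierE es jf) (kernel_opB jk es.1 jf) => t h1 h2 ->.
by rewrite -[LHS]/(H f t - gabor_multiplier b0 nu0 g h m f t) h1 h2.
Qed.

End GaborKernels.

(** * Periodic functions and symplectic Fourier series *)

Section Reindexing.
Context {R : realType} {I : choiceType}.

Lemma sums_to_reindex (V : zmodType) (N : V -> \bar R) (u : I -> V) (s : V) (f f' : I -> I) :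
  cancel f f' -> cancel f' f -> sums_to N u s -> sums_to N (u \o f) s.
Proof.
move=> fK f'K us eps e0; have [F0 hF] := us eps e0.
exists [fset f' i | i in F0]%fset => F F0F.
have <- : \sum_(i <- [fset f i | i in F]%fset) u i = \sum_(i <- F) (u \o f) i.
  by rewrite big_imfset//= => i j _ _; exact: can_inj.
apply: hF; apply/fsubsetP => i iF0; apply/imfsetP; exists (f' i) => /=; last by rewrite f'K.
by apply: (fsubsetP F0F); apply/imfsetP; exists i.
Qed.

Lemma csum_reindex (u : I -> R[i]) (f f' : I -> I) : cancel f f' -> cancel f' f ->
  csum (u \o f) = csum u.
Proof.
move=> fK f'K; rewrite /csum; congr (xget 0 _); apply/seteqP; split => s /=.
  move=> /(sums_to_reindex f'K fK); apply: eq_sums_to => i /=.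
  by rewrite f'K.
exact: sums_to_reindex.
Qed.

End Reindexing.

Lemma ae_preimage d (T : measurableType d) (R : realType) (mu : {measure set T -> \bar R})
    (tau : T -> T) (P : T -> Prop) : measurable_fun setT tau ->
  (forall f : T -> \bar R, measurable_fun setT f -> (forall z, 0 <= f z)%E ->
    (\int[mu]_z f (tau z) = \int[mu]_z f z)%E) ->
  {ae mu, forall z, P z} -> {ae mu, forall z, P (tau z)}.
Proof.
move=> mtau inv [N [mN N0 hN]]; exists (tau @^-1` N).
have mpre : measurable (tau @^-1` N) by rewrite -[X in measurable X]setTI; exact: mtau.
split=> //; last by move=> z /= h; exact: hN.
have E := integral_indic mu measurableT mpre; rewrite setIT in E.
have E' := integral_indic mu measurableT mN; rewrite setIT in E'.
rewrite -E -N0 -E' -(inv (fun z => (\1_N z)%:E)).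
- by apply: eq_integral => z _; rewrite !indicE.
- by apply/measurable_EFinP; exact: measurable_indic.
- by move=> z; rewrite lee_fin.
Qed.

Section Periodicity.
Context {R : realType}.
Variables (b0 nu0 : R).
Hypotheses (b0_gt0 : 0 < b0) (nu0_gt0 : 0 < nu0).
Local Notation L := (measurableTypeR R).
Local Notation LL := (measurableTypeR R * measurableTypeR R)%type.
Implicit Types (F G : R * R -> R[i]) (z : R * R).

Lemma periodic_int (U : Type) (f : R -> U) (c : R) : (forall t, f (t + c) = f t) ->
  forall (k : int) t, f (t + k%:~R * c) = f t.
Proof.
move=> fc; have fn (n : nat) t : f (t + n%:R * c) = f t.
  elim: n => [|n IH]; first by rewrite mul0r addr0.
  by rewrite -natr1 mulrDl mul1r addrA fc.
case=> n t; first exact: fn.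
by rewrite -[RHS](fn n.+1) NegzE mulrNz -[in RHS](subrK (n.+1%:R * c) t) mulNr; rewrite [RHS]fn.
Qed.

Lemma periodic_dual_shift F z p : cell_periodic b0 nu0 F -> F (dual_shift b0 nu0 z p) = F z.
Proof.
move=> Fp; rewrite /dual_shift (surjective_pairing z) /=.
rewrite (periodic_int (f := fun t => F (t, _)) (c := nu0^-1)) => [|t].
  by rewrite (periodic_int (f := fun t => F (_, t)) (c := b0^-1))// => t; case: (Fp z.1 t).
by case: (Fp t (z.2 + p.2%:~R / b0)).
Qed.

Lemma dual_shiftD z p q : dual_shift b0 nu0 (dual_shift b0 nu0 z p) q =
  dual_shift b0 nu0 z (p.1 + q.1, p.2 + q.2).
Proof. by rewrite /dual_shift /= !intrD !mulrDl !addrA. Qed.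

Definition cell_rep z : R * R :=
  dual_shift b0 nu0 z (- Num.floor (z.1 * nu0), - Num.floor (z.2 * b0)).

Lemma cell_repP z : cell b0 nu0 (cell_rep z).
Proof.
by split => /=; rewrite mulrNz mulNr; apply/period_floor.
Qed.

Lemma cell_rep_shift z p : cell_rep (dual_shift b0 nu0 z p) = cell_rep z.
Proof.
rewrite /cell_rep dual_shiftD /=.
have fl (x c : R) (k : int) : 0 < c -> Num.floor ((x + k%:~R / c) * c) = Num.floor (x * c) + k.
  by move=> c0; rewrite mulrDl divfK ?gt_eqF// floorDrz ?intr_int// intrKfloor.
by rewrite !fl//; congr (dual_shift b0 nu0 z (_, _)); ring.
Qed.

Lemma cell_rep_id z : cell b0 nu0 z -> cell_rep z = z.
Proof.
case: z => x y [/= xD yD]; rewrite /cell_rep /dual_shift /=.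
have h1 : 0 = Num.floor (x * nu0) by apply/(period_floor nu0_gt0); rewrite mul0r subr0.
have h2 : 0 = Num.floor (y * b0) by apply/(period_floor b0_gt0); rewrite mul0r subr0.
by rewrite -h1 -h2 oppr0 !mul0r !addr0.
Qed.

Lemma measurable_cell_rep : @measurable_fun _ _ LL LL setT cell_rep.
Proof.
have m1 (c : R) : 0 < c -> @measurable_fun _ _ L L setT
    (fun x => x + (- Num.floor (x * c))%:~R / c).
  move=> c0; apply: measurable_funD; first exact: measurable_id.
  apply: measurable_funM; last exact: measurable_cst.
  rewrite (_ : (fun x => _) = -%R \o (fun x : R => (Num.floor (x * c))%:~R)); last first.
    by apply/funext => x /=; rewrite mulrNz.
  apply: measurableT_comp => //.
  apply: nondecreasing_measurable => // x y xy; rewrite ler_int; apply: le_floor.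
  by rewrite ler_wpM2r// ltW.
apply: measurable_fun_pair.
- exact: measurableT_comp (m1 _ nu0_gt0) measurable_fst.
- exact: measurableT_comp (m1 _ b0_gt0) measurable_snd.
Qed.

(** The plane is a countable union of translates of the cell. *)
Lemma ae_periodic_eq F G : cell_periodic b0 nu0 F -> cell_periodic b0 nu0 G ->
  {ae leb2, forall z, cell b0 nu0 z -> F z = G z} -> {ae leb2, forall z, F z = G z}.
Proof.
move=> Fp Gp [N [mN N0 hN]]; have [phi bphi] := nat_enum_int2.
have : {ae leb2, forall z, forall n, ~ N (plane_shift b0 nu0 phi n z)}.
  apply: ae_foralln => n.
  apply: (@ae_preimage _ LL R leb2 (plane_shift b0 nu0 phi n) (fun z => ~ N z)
    (measurable_plane_shift b0 nu0 phi n) (@plane_invariant R b0 nu0 phi n)).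
  by exists N; split => // z /= /contrapT.
apply: filterS => z nN; have [psi phiK psiK] := bphi.
pose p := (- Num.floor (z.1 * nu0), - Num.floor (z.2 * b0)).
have : ~ N (cell_rep z) by have := nN (psi p); rewrite /plane_shift psiK.
rewrite -(periodic_dual_shift z p Fp) -(periodic_dual_shift z p Gp) => nNz.
by apply: contrapT => ne; apply: nNz; apply: hN => /= h; apply: ne; apply: h; exact: cell_repP.
Qed.

Lemma optimal_dsft_periodic g h eta : cell_periodic b0 nu0 (optimal_dsft b0 nu0 g h eta).
Proof.
have shift z q : optimal_dsft b0 nu0 g h eta (dual_shift b0 nu0 z q) =
    optimal_dsft b0 nu0 g h eta z.
  rewrite /optimal_dsft /periodized_sqr.
  pose f (p : int * int) := (q.1 + p.1, q.2 + p.2).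
  pose f' (p : int * int) := (p.1 - q.1, p.2 - q.2).
  have fK : cancel f f' by move=> [p1 p2]; rewrite /f /f' /= !(addrC q.1) !(addrC q.2) !addrK.
  have f'K : cancel f' f by move=> [p1 p2]; rewrite /f /f' /= !(addrC q.1) !(addrC q.2) !subrK.
  have -> : csum (fun p => conjc (stft g h (dual_shift b0 nu0 (dual_shift b0 nu0 z q) p)) *
      eta (dual_shift b0 nu0 (dual_shift b0 nu0 z q) p)) =
    csum (fun p => conjc (stft g h (dual_shift b0 nu0 z p)) * eta (dual_shift b0 nu0 z p)).
    rewrite -[RHS](csum_reindex _ fK f'K); congr csum; apply/funext => p.
    by rewrite /= !dual_shiftD.
  have -> : (\esum_(p in [set: int * int])
      (mod (stft g h (dual_shift b0 nu0 (dual_shift b0 nu0 z q) p)) ^+ 2)%:E =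
    \esum_(p in [set: int * int]) (mod (stft g h (dual_shift b0 nu0 z p)) ^+ 2)%:E)%E.
    rewrite [RHS](@reindex_esum R _ _ setT setT f).
    - by apply: eq_esum => p _; rewrite dual_shiftD.
    - by rewrite setTT_bijective; exists f'.
  by [].
move=> t xi; split.
- by rewrite -(shift (t, xi) (1, 0)) /dual_shift /= mul0r addr0 mul1r.
- by rewrite -(shift (t, xi) (0, 1)) /dual_shift /= mul0r addr0 mul1r.
Qed.

Definition cutoff F z : R[i] := F z * (\1_(cell b0 nu0) z)%:C.

Lemma cutoff_out F z : ~ cell b0 nu0 z -> cutoff F z = 0.
Proof. by move=> h; rewrite /cutoff indicE memNset// mulr0. Qed.

Lemma cutoff_in F z : cell b0 nu0 z -> cutoff F z = F z.
Proof. by move=> h; rewrite /cutoff indicE mem_set// mulr1. Qed.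

Lemma cmeasurable_cutoff F : @cmeasurable _ LL R F -> @cmeasurable _ LL R (cutoff F).
Proof.
by move=> mF; apply: cmeasurableM => //; apply: cmeasurable_indic; exact: measurable_cell.
Qed.

Lemma cell_L2normE F : cell_L2norm b0 nu0 F = L2norm leb2 (cutoff F).
Proof.
rewrite /cell_L2norm /L2norm (_ : cmod F \_ _ = cmod (cutoff F))//; apply/funext => z.
rewrite patchE /cmod /cutoff indicE; case: ifP => _; first by rewrite mulr1.
by rewrite mulr0 mod0.
Qed.

Lemma sums_to_cell (m : int * int -> R[i]) F :
  sums_to (cell_L2norm b0 nu0) (fun (p : int * int) z =>
      m p * expi (2 * pi * (p.2%:~R * nu0 * z.1 - p.1%:~R * b0 * z.2))) F <->
  sums_to (L2norm leb2) (fun p z => m p * cellexp b0 nu0 p z) (cutoff F).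
Proof.
have E (S : {fset int * int}) : cutoff (F - \sum_(p <- S) (fun z =>
      m p * expi (2 * pi * (p.2%:~R * nu0 * z.1 - p.1%:~R * b0 * z.2)))) =
    cutoff F - \sum_(p <- S) (fun z => m p * cellexp b0 nu0 p z).
  apply/funext => z; rewrite /cutoff -[LHS]/((F z - _) * _) -[RHS]/(F z * _ - _).
  rewrite !fct_sumE mulrBl mulr_suml; congr (_ - _); apply: eq_bigr => p _.
  by rewrite /cellexp mulrA.
by split=> h eps e0; have [F0 hF] := h eps e0; exists F0 => S SF;
  have := hF S SF; rewrite cell_L2normE E.
Qed.

(** [dsft] is a choice among the functions with these properties. The sum of the
    Fourier series in L^2 of the cell, extended by periodicity, is one of them. *)
Lemma dsft_spec m : ell2 m ->
  [/\ @cmeasurable _ LL R (dsft b0 nu0 m), cell_periodic b0 nu0 (dsft b0 nu0 m) &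
      expands leb2 (cellexp b0 nu0) m (cutoff (dsft b0 nu0 m))].
Proof.
move=> m2; have v0 : 0 < nu0^-1 * b0^-1 by rewrite mulr_gt0// invr_gt0.
have [s [js s_supp ms]] := orthogonal_sums_to_supp (cellexp_L2 b0_gt0 nu0_gt0) v0
  (cellexp_orth b0_gt0 nu0_gt0) (measurable_cell b0 nu0) (@cellexp_supp _ b0 nu0) m2.
have cs : cutoff (s \o cell_rep) = s.
  apply/funext => z; have [zD|zD] := pselect (cell b0 nu0 z).
    by rewrite cutoff_in//= cell_rep_id.
  by rewrite cutoff_out// s_supp.
rewrite /dsft; case: xgetP => [X _ [mX pX /sums_to_cell hX]|/(_ (s \o cell_rep)) []]; last first.
  split; first exact: cmeasurable_comp measurable_cell_rep (L2_meas js).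
    move=> t xi; have := cell_rep_shift (t, xi) (1, 0); have := cell_rep_shift (t, xi) (0, 1).
    by rewrite /dual_shift /= !mul0r !addr0 !mul1r => -> ->.
  by apply/sums_to_cell; rewrite cs.
split=> //; split=> //.
have mcX := cmeasurable_cutoff mX.
have {}hX := (sums_to_N2 _ _ _).1 hX 1 ltr01; have [F0 /(_ F0 (fsubset_refl _)) hF] := hX.
set S := \sum_(p <- F0) _ in hF.
have jS : L2 leb2 S by apply: L2_sum => p; apply: L2Z; exact: cellexp_L2.
rewrite -(subrK S (cutoff X)); apply: L2D => //; apply/L2P; split.
  by apply: cmeasurableB => //; exact: (L2_meas jS).
by apply: lt_trans hF _; rewrite ltry.
Qed.

End Periodicity.

(** * Families with a weighted Gram matrix *)

(** The model is a family [v] of exponentials and a periodic weight [wt]; pairings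
    of the [u i] are those of the [v i] in the weighted space. The upper bound of
    the weight makes the synthesis of l^2 coefficients by [u] bounded, although [u]
    is not orthogonal. *)
Section WeightedGram.
Context d1 (T1 : measurableType d1) d2 (T2 : measurableType d2) (R : realType).
Variables (m1 : {measure set T1 -> \bar R}) (m2 : {measure set T2 -> \bar R}).
Context {I : choiceType}.
Variables (u : I -> T1 -> R[i]) (v : I -> T2 -> R[i]) (wt : T2 -> R[i]) (B v0 : R).
Hypothesis u_L2 : forall i, L2 m1 (u i).
Hypothesis v_L2 : forall i, L2 m2 (v i).
Hypothesis v0_gt0 : 0 < v0.
Hypothesis v_orth : forall i j, inner m2 (v i) (v j) = if i == j then v0%:C else 0.
Hypothesis wt_meas : cmeasurable wt.
Hypothesis wt_real : forall x, conjc (wt x) = wt x.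
Hypothesis B_ge0 : 0 <= B.
Hypothesis wt_le : {ae m2, forall x, mod (wt x) <= B}.
Hypothesis gram : forall i j, inner m1 (u i) (u j) = inner m2 (fun x => wt x * v i x) (v j).

Let le_wt f : {ae m2, forall x, mod (wt x * f x) <= mod (B%:C * f x)}.
Proof.
by apply: filterS wt_le => x h; rewrite !modM modR ger0_norm// ler_wpM2r ?mod_ge0.
Qed.

Lemma L2_weighted f : L2 m2 f -> L2 m2 (fun x => wt x * f x).
Proof.
move=> jf; apply: (L2_le (g := fun x => B%:C * f x)) => //; last exact: L2Z.
by apply: cmeasurableM => //; exact: L2_meas jf.
Qed.

Lemma sqn_weighted f : L2 m2 f -> sqn m2 (fun x => wt x * f x) <= B ^+ 2 * sqn m2 f.
Proof.
move=> jf; rewrite -lee_fin -(L2_fin (L2_weighted jf)) EFinM -(L2_fin jf).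
have -> : (B ^+ 2)%:E = (mod (B%:C) ^+ 2)%:E by rewrite modR ger0_norm.
rewrite -N2Z; last exact: L2_meas jf.
apply: N2_le => //; first exact: L2_meas (L2_weighted jf).
exact: (L2_meas (L2Z (B%:C) jf)).
Qed.

Lemma inner_weighted f g : inner m2 (fun x => wt x * f x) g = inner m2 f (fun x => wt x * g x).
Proof. by apply: eq_cint => x; rewrite conjcM wt_real; ring. Qed.

Let zu c i : L2 m1 (fun x => c * u i x). Proof. exact: L2Z. Qed.
Let zv c i : L2 m2 (fun x => c * v i x). Proof. exact: L2Z. Qed.

Lemma sqn_weighted_sum (c : I -> R[i]) (F : {fset I}) :
  sqn m1 (\sum_(i <- F) (fun x => c i * u i x)) <= B * v0 * \sum_(i <- F) mod (c i) ^+ 2.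
Proof.
set S := \sum_(i <- F) _; pose M := \sum_(i <- F) (fun x => c i * v i x).
have jS : L2 m1 S by apply: L2_sum => i; exact: zu.
have jM : L2 m2 M by apply: L2_sum => i; exact: zv.
have jw := L2_weighted jM.
have Suj j : inner m1 S (u j) = inner m2 (fun x => wt x * M x) (v j).
  rewrite inner_weighted inner_suml// inner_suml//; last exact: L2_weighted.
  by apply: eq_bigr => i _; rewrite !innerZl//; [rewrite gram inner_weighted|exact: L2_weighted].
have SS : inner m1 S S = inner m2 M (fun x => wt x * M x).
  rewrite -inner_weighted [LHS]inner_sumr// [RHS]inner_sumr//.
  by apply: eq_bigr => j _; rewrite !innerZr// Suj.
rewrite -mulrA -(sqn_orthogonal_sum v_L2 v_orth) -/M.
rewrite -(@ler_pXn2r _ 2) ?nnegrE ?mulr_ge0 ?sqn_ge0//.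
have -> : sqn m1 S ^+ 2 = mod (inner m1 S S) ^+ 2.
  by rewrite inner_self modR ger0_norm ?sqn_ge0.
rewrite SS; apply: le_trans (cauchy_schwarz jM jw) _.
have -> : (B * sqn m2 M) ^+ 2 = sqn m2 M * (B ^+ 2 * sqn m2 M) by ring.
by rewrite ler_wpM2l ?sqn_ge0//; exact: sqn_weighted.
Qed.

Lemma weighted_expands (c : I -> R[i]) : l2 c -> exists s, expands m1 u c s.
Proof.
move=> c2; apply: (sums_to_exists (a := fun i => mod (c i) ^+ 2) (B := B * v0)) => //.
- by rewrite mulr_ge0// ltW.
- by move=> i; exact: sqr_ge0.
- move=> F; rewrite (L2_fin (L2_sum _ (fun i => zu (c i) i))).
  by rewrite lee_fin; exact: sqn_weighted_sum.
Qed.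

Lemma inner_weighted_expansion (c : I -> R[i]) s f j :
  expands m1 u c s -> expands m2 v c f ->
  inner m1 s (u j) = inner m2 (fun x => wt x * f x) (v j).
Proof.
move=> [js us] [jf vf]; have jw := L2_weighted (v_L2 j); rewrite inner_weighted.
have h1 := sums_to_inner (fun i => zu (c i) i) js (u_L2 j) us.
have h2 := sums_to_inner (fun i => zv (c i) i) jf jw vf.
apply: csums_to_unique h1 _; apply: eq_sums_to h2 => i.
by rewrite !innerZl// gram inner_weighted.
Qed.

End WeightedGram.

(** * Pairings of functions on the plane folded onto the cell *)

(** The planar measure as a sigma-finite one, so that Fubini's theorem applies to
    its product with the counting measure. *)
Definition plane_measure (R : realType) :
    set (measurableTypeR R * measurableTypeR R) -> \bar R :=
  (@lebesgue_measure R \x @lebesgue_measure R)%E.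

HB.instance Definition _ (R : realType) := Measure.on (@plane_measure R).

Lemma plane_measure_sigma_finite (R : realType) : sigma_finite setT (@plane_measure R).
Proof.
pose J n : set (measurableTypeR R) := `[- n%:R, n%:R]%classic.
have mJ n : measurable (J n) by exact: measurable_itv.
have Joo n : (lebesgue_measure (J n) < +oo)%E.
  by rewrite lebesgue_measure_itv /=; case: ifP => _; rewrite -?EFinD ltry.
exists (fun n => J n `*` J n).
  apply/esym/seteqP; split => // -[x y] _; exists (Num.bound (`|x| + `|y|)) => //.
  have xy0 : 0 <= `|x : R| + `|y : R| by rewrite addr_ge0.
  have h := ltW (archi_boundP xy0).
  by split; rewrite /J /= in_itv /= -ler_norml; apply: le_trans h; rewrite ?lerDl ?lerDr.
move=> n; split; first exact: measurableX.
have := @product_measure1E _ _ _ _ R (@lebesgue_measure R) (@lebesgue_measure R) _ _ (mJ n) (mJ n).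
move=> E; apply: (@eq_ind_r _ _ (fun r => r < +oo)%E _ _ E).
have f0 : (lebesgue_measure (J n) \is a fin_num)%E.
  by rewrite ge0_fin_numE; [exact: Joo|exact: measure_ge0].
by apply: lte_mul_pinfty; [exact: measure_ge0|exact: f0|exact: Joo].
Qed.

HB.instance Definition _ (R : realType) :=
  @Measure_isSigmaFinite.Build _ _ _ (@plane_measure R) (@plane_measure_sigma_finite R).

Section Folding.
Context {R : realType}.
Variables (b0 nu0 : R) (phi : nat -> int * int).
Hypotheses (b0_gt0 : 0 < b0) (nu0_gt0 : 0 < nu0).
Hypothesis phi_bij : bijective phi.
Local Notation LL := (measurableTypeR R * measurableTypeR R)%type.
Local Notation count := (@nat_counting R).
Local Notation shift := (plane_shift b0 nu0 phi).
Local Notation D := (cell b0 nu0).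
Implicit Types (F G : R * R -> R[i]) (z : R * R).

(** The values of a function on the translates of a point. Square integrability on
    the plane makes almost every fiber square summable, and sums over translates
    become inner products of fibers. *)
Definition fiber F z (n : nat) : R[i] := F (shift n z).

Definition bracket F G z : R[i] := inner count (fiber F z) (fiber G z).

Let plane_tiles : tiles (@plane_measure R) D shift (plane_unshift b0 nu0 phi).
Proof.
split.
- exact: measurable_cell.
- exact: measurable_plane_shift.
- exact: measurable_plane_unshift.
- exact: plane_shiftK.
- exact: plane_invariant.
- exact: plane_tiling.
Qed.

Lemma ae_L2_fiber F : L2 leb2 F -> {ae leb2, forall z, D z -> L2 count (fiber F z)}.
Proof.
move=> jF; have := ae_periodize_cintegrable plane_tiles (inner_cintegrable jF jF); apply: filterS => z h Dz.
apply/L2P; split; first exact: cmeasurable_nat.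
have [_] := h Dz; congr (_ < _)%E; apply: eq_integral => n _.
by rewrite /cmod modM modJ -expr2.
Qed.

Lemma cmeasurable_cutoff_bracket F G : L2 leb2 F -> L2 leb2 G ->
  @cmeasurable _ LL R (cutoff b0 nu0 (bracket F G)).
Proof.
move=> jF jG; have := (periodization_cintegrable plane_tiles (inner_cintegrable jF jG)).1.
by congr cmeasurable; apply/funext => z; rewrite /cutoff mulrC.
Qed.

Lemma measurable_N2_fiber F : @cmeasurable _ LL R F ->
  @measurable_fun _ _ LL _ setT (fun z => N2 count (fiber F z)).
Proof.
move=> mF; pose f (q : LL * nat) : \bar R := (mod (F (shift q.2 q.1)) ^+ 2)%:E.
have f0 q : (0 <= f q)%E by rewrite lee_fin sqr_ge0.
apply: (@measurable_fun_fubini_tonelli_F _ _ LL nat _ count f _ f0).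
apply: measurable_prod_nat => n; apply: measurableT_comp (measurable_mod2 mF) _.
exact: measurable_plane_shift.
Qed.

Lemma N2_fibers F : @cmeasurable _ LL R F ->
  (N2 leb2 F = \int[leb2]_z ((\1_D z)%:E * N2 count (fiber F z)))%E.
Proof.
by move=> mF; apply: (periodize_ge0 plane_tiles (measurable_mod2 mF)) => z; rewrite lee_fin sqr_ge0.
Qed.

Lemma N2_cutoff_bracket F G (B : R) : 0 <= B -> L2 leb2 F -> L2 leb2 G ->
  {ae leb2, forall z, D z -> (N2 count (fiber G z) <= B%:E)%E} ->
  (N2 leb2 (cutoff b0 nu0 (bracket F G)) <= B%:E * N2 leb2 F)%E.
Proof.
move=> B0 jF jG GB; rewrite (N2_fibers (L2_meas jF)).
have mI : @measurable_fun _ _ LL _ setT (fun z => (\1_D z)%:E * N2 count (fiber F z))%E.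
  apply: emeasurable_funM; last exact: measurable_N2_fiber (L2_meas jF).
  by apply/measurable_EFinP; apply: measurable_indic; exact: measurable_cell.
have I0 z : (0 <= (\1_D z)%:E * N2 count (fiber F z))%E by rewrite mule_ge0 ?N2_ge0// lee_fin.
rewrite -ge0_integralZl//; apply: ae_ge0_le_integral => //.
- by move=> z _; rewrite lee_fin sqr_ge0.
- exact: measurable_mod2 (cmeasurable_cutoff_bracket jF jG).
- by move=> z _; rewrite mule_ge0.
- exact: measurable_funeM.
apply: filterS3 GB (ae_L2_fiber jF) (ae_L2_fiber jG) => z hB hF hG _.
have [Dz|Dz] := pselect (D z); last first.
  by rewrite cutoff_out// mod0 expr0n mule_ge0.
have [jf jg] := (hF Dz, hG Dz); move: (hB Dz); rewrite (L2_fin jf) (L2_fin jg).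
rewrite cutoff_in// indicE mem_set// mul1e -EFinM !lee_fin => {}hB.
apply: le_trans (cauchy_schwarz jf jg) _.
by rewrite mulrC ler_wpM2r ?sqn_ge0.
Qed.

Lemma L2_cutoff_bracket F G (B : R) : 0 <= B -> L2 leb2 F -> L2 leb2 G ->
  {ae leb2, forall z, D z -> (N2 count (fiber G z) <= B%:E)%E} ->
  L2 leb2 (cutoff b0 nu0 (bracket F G)).
Proof.
move=> B0 jF jG GB; apply/L2P; split; first exact: cmeasurable_cutoff_bracket.
by apply: le_lt_trans (N2_cutoff_bracket B0 jF jG GB) _; rewrite (L2_fin jF) -EFinM ltry.
Qed.

(** By periodicity these factors come out of the brackets. *)
Definition planeexp (p : int * int) z : R[i] :=
  expi (2 * pi * (p.2%:~R * nu0 * z.1 - p.1%:~R * b0 * z.2)).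

Lemma planeexp_shift p z q : planeexp p (dual_shift b0 nu0 z q) = planeexp p z.
Proof.
rewrite /planeexp /dual_shift /= -[RHS]mul1r -(expi_int (p.2 * q.1 - p.1 * q.2)) -expiD.
congr expi; rewrite intrB !intrM.
have n0 : nu0 != 0 by rewrite gt_eqF.
have b1 : b0 != 0 by rewrite gt_eqF.
by field; rewrite n0 b1.
Qed.

Lemma L2_planeexp p F : L2 leb2 F -> L2 leb2 (fun z => planeexp p z * F z).
Proof.
move=> jF; under eq_fun do rewrite mulrC.
apply: (@L2Mbounded _ _ _ _ _ _ 1) => //; last by move=> z; rewrite mod_expi.
apply: cmeasurable_expi; apply: measurable_funM; first exact: measurable_cst.
apply: measurable_funB; apply: measurable_funM; try exact: measurable_cst.
- exact: measurable_fst.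
- exact: measurable_snd.
Qed.

Lemma bracket_planeexp p F G : L2 leb2 F -> L2 leb2 G ->
  {ae leb2, forall z, D z -> bracket (fun z => planeexp p z * F z) G z = planeexp p z * bracket F G z}.
Proof.
move=> jF jG; apply: filterS2 (ae_L2_fiber jF) (ae_L2_fiber jG) => z hF hG Dz.
rewrite /bracket -innerZl; [|exact: hF|exact: hG].
by apply: eq_cint => n; rewrite /fiber planeexp_shift.
Qed.

(** Folding turns pairings with a modulated function into Fourier coefficients. *)
Lemma inner_planeexp p F G : L2 leb2 F -> L2 leb2 G ->
  inner leb2 F (fun z => planeexp p z * G z) =
  inner leb2 (cutoff b0 nu0 (bracket F G)) (cellexp b0 nu0 p).
Proof.
move=> jF jG; have jI := inner_cintegrable jF (L2_planeexp p jG).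
apply: etrans (periodize_cint plane_tiles jI) _; apply: cint_ae_eq.
- exact: (periodization_cintegrable plane_tiles jI).1.
- apply: cmeasurableM; first exact: cmeasurable_cutoff_bracket.
  exact/cmeasurableJ/L2_meas/cellexp_L2.
apply: filterS2 (ae_L2_fiber jF) (ae_L2_fiber jG) => z hF hG.
have [Dz|Dz] := pselect (D z); last first.
  by rewrite cutoff_out// indicE memNset// !mul0r.
rewrite cutoff_in// /cellexp indicE mem_set// mulr1 mul1r mulrC /bracket.
rewrite -innerZl; [|exact: hF|exact: hG].
by apply: eq_cint => n; rewrite /fiber conjcM planeexp_shift; ring.
Qed.

End Folding.

(** * The best approximation *)

Section BestApproximation.
Context {R : realType}.
Variables (b0 nu0 : R) (g h : R -> R[i]) (A B : R) (phi : nat -> int * int).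
Hypotheses (b0_gt0 : 0 < b0) (nu0_gt0 : 0 < nu0) (phi_bij : bijective phi).
Hypotheses (g_L2 : L2 leb g) (h_L2 : L2 leb h).
Hypotheses (A_gt0 : 0 < A) (AB : A <= B).
Hypothesis U_bounds : {ae leb2, forall z, cell b0 nu0 z ->
  (A%:E <= periodized_sqr b0 nu0 g h z)%E /\ (periodized_sqr b0 nu0 g h z <= B%:E)%E}.
Local Notation L := (measurableTypeR R).
Local Notation LL := (measurableTypeR R * measurableTypeR R)%type.
Local Notation count := (@nat_counting R).
Local Notation D := (cell b0 nu0).
Local Notation V := (stft g h).
Local Notation U := (periodized_sqr b0 nu0 g h).
Local Notation fiber := (fiber b0 nu0 phi).
Local Notation bracket := (bracket b0 nu0 phi).
Local Notation cutoff := (cutoff b0 nu0).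
Local Notation cellexp := (cellexp b0 nu0).
Local Notation planeexp := (planeexp b0 nu0).
Implicit Types (m : int * int -> R[i]) (s F : R * R -> R[i]) (z : R * R) (p : int * int).

Let B_ge0 : 0 <= B. Proof. exact: ltW (lt_le_trans A_gt0 AB). Qed.
Let v0_gt0 : 0 < nu0^-1 * b0^-1. Proof. by rewrite mulr_gt0// invr_gt0. Qed.

Lemma L2_stft : L2 leb2 V.
Proof.
have -> : V = spr (rank1_kernel g h (0, 0)).
  apply/funext => q; rewrite spr_rank1// (_ : 2 * pi * _ = 0); last by rewrite /=; ring.
  by rewrite expi0 mul1r.
exact: L2_spr (sprdom_rank1 g_L2 h_L2 _).
Qed.

Lemma periodized_sqrE z : U z = N2 count (fiber V z).
Proof.
apply/esym; apply: (psum_esum (a := fun p => (mod (V (dual_shift b0 nu0 z p)) ^+ 2)%:E) phi_bij).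
by move=> p; rewrite lee_fin sqr_ge0.
Qed.

Lemma N2_fiber_stft_le : {ae leb2, forall z, D z -> (N2 count (fiber V z) <= B%:E)%E}.
Proof. by apply: filterS U_bounds => z hz Dz; rewrite -periodized_sqrE; case: (hz Dz). Qed.

(** The periodization of |V_g h|^2, restricted to the cell. *)
Definition weight z : R[i] := cutoff (bracket V V) z.

Lemma weight_in z : D z -> weight z = (fine (U z))%:C.
Proof. by move=> Dz; rewrite /weight cutoff_in// /bracket inner_self periodized_sqrE. Qed.

Lemma weight_real z : conjc (weight z) = weight z.
Proof.
have [Dz|Dz] := pselect (D z); first by rewrite weight_in// conjc_real.
by rewrite /weight cutoff_out// conjc0.
Qed.

Lemma cmeasurable_weight : @cmeasurable _ LL R weight.
Proof. exact: cmeasurable_cutoff_bracket L2_stft L2_stft. Qed.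

Lemma ae_weight_bounds : {ae leb2, forall z, D z -> A <= fine (U z) /\ fine (U z) <= B}.
Proof.
apply: filterS U_bounds => z hz /hz[h1 h2]; rewrite -!lee_fin fineK//.
rewrite fin_numE; apply/andP; split.
- by rewrite gt_eqF// (lt_le_trans _ h1)// ltNyr.
- by rewrite lt_eqF// (le_lt_trans h2)// ltry.
Qed.

Lemma ae_weight_le : {ae leb2, forall z, mod (weight z) <= B}.
Proof.
apply: filterS ae_weight_bounds => z hz; have [Dz|Dz] := pselect (D z); last first.
  by rewrite /weight cutoff_out// mod0.
have [h1 h2] := hz Dz; rewrite weight_in// modR ger0_norm//.
exact: le_trans (ltW A_gt0) h1.
Qed.

Local Notation K := (fun p => rank1_kernel g h (lattice_point b0 nu0 p)).

Let K_L2 p : L2 leb2 (K p). Proof. exact: rank1_kernel_L2. Qed.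

Lemma inner_spr_kernel F p : L2 leb2 F ->
  inner leb2 F (spr (K p)) = inner leb2 (cutoff (bracket F V)) (cellexp p).
Proof.
move=> jF; rewrite -inner_planeexp//; last exact: L2_stft.
by congr inner; apply/funext => z; rewrite spr_rank1.
Qed.

Lemma gram_kernel p q :
  inner leb2 (K p) (K q) = inner leb2 (fun z => weight z * cellexp p z) (cellexp q).
Proof.
have dK r : sprdom (K r) by exact: sprdom_rank1.
rewrite -inner_spr// inner_spr_kernel; last exact: L2_spr.
have E : spr (K p) = fun z => planeexp p z * V z by apply/funext => z; rewrite spr_rank1.
have jE := L2_planeexp b0 nu0 p L2_stft; rewrite E; apply: inner_ae_eq.
- exact: cmeasurable_cutoff_bracket jE L2_stft.
- apply: cmeasurableM; first exact: cmeasurable_weight.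
  exact/L2_meas/cellexp_L2.
- exact/L2_meas/cellexp_L2.
apply: filterS (bracket_planeexp b0_gt0 nu0_gt0 phi_bij p L2_stft L2_stft) => z hz.
have [Dz|Dz] := pselect (D z); last by rewrite cutoff_out// /weight cutoff_out// mul0r.
by rewrite /weight !cutoff_in// hz// /Defs.cell /cellexp indicE mem_set// mulr1 mulrC.
Qed.

Variables (kappa eta : R * R -> R[i]).
Hypotheses (kappa_L2 : L2 leb2 kappa) (eta_L2 : L2 leb2 eta).
Hypothesis spreading : L2norm leb2 (eta - truncated_spreading kappa r) @[r --> +oo] --> (0 : \bar R).

Local Notation W := (cutoff (bracket eta V)).
Local Notation dsft := (dsft b0 nu0).

Let W_L2 : L2 leb2 W.
Proof. exact: L2_cutoff_bracket B_ge0 eta_L2 L2_stft N2_fiber_stft_le. Qed.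

Let cL2 p : L2 leb2 (cellexp p). Proof. exact: cellexp_L2. Qed.

Let wL2 F : L2 leb2 F -> L2 leb2 (fun z => weight z * F z).
Proof. exact: L2_weighted cmeasurable_weight B_ge0 ae_weight_le F. Qed.

Lemma kernel_expands m : ell2 m -> exists s, expands leb2 K m s.
Proof.
exact: (weighted_expands K_L2 cL2 v0_gt0 (cellexp_orth b0_gt0 nu0_gt0) cmeasurable_weight
  weight_real B_ge0 ae_weight_le gram_kernel).
Qed.

(** On the spreading side and folded onto the cell, the pairing of the residual
    with the [p]-th kernel is the [p]-th Fourier coefficient of the difference of
    the two sides; the exponentials are total. *)
Lemma residual_orth m s : ell2 m -> expands leb2 K m s ->
  (forall p, inner leb2 (kappa - s) (K p) = 0) <->
  {ae leb2, forall z, W z = weight z * cutoff (dsft m) z}.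
Proof.
move=> m2 es; have [mX pX eX] := dsft_spec b0_gt0 nu0_gt0 m2.
have jwX := wL2 eX.1.
have E p : inner leb2 (kappa - s) (K p) =
    inner leb2 (W - (fun z => weight z * cutoff (dsft m) z)) (cellexp p).
  rewrite innerBl//; last exact: es.1.
  rewrite innerBl// (inner_weighted_expansion K_L2 cL2 cmeasurable_weight weight_real B_ge0
    ae_weight_le gram_kernel p es eX) -inner_spr_kernel//.
  by rewrite (inner_spreading kappa_L2 eta_L2 (sprdom_rank1 g_L2 h_L2 _) spreading).
split=> [orth|ae0 p].
  have supp z : ~ D z -> (W - (fun z => weight z * cutoff (dsft m) z)) z = 0.
    by move=> Dz; rewrite -[LHS]/(W z - weight z * cutoff _ z) !cutoff_out// mulr0 subr0.
  have orth' p : inner leb2 (W - (fun z => weight z * cutoff (dsft m) z)) (cellexp p) = 0.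
    by rewrite -E orth.
  apply: filterS (cellexp_total b0_gt0 nu0_gt0 (L2B W_L2 jwX) supp orth') => z /eqP.
  by rewrite -[X in X == 0]/(W z - weight z * cutoff _ z) subr_eq0 => /eqP.
rewrite E -(inner0l leb2 (cellexp p)); apply: inner_ae_eq.
- exact: L2_meas (L2B W_L2 jwX).
- exact: L2_meas (L2_0 leb2).
- exact: L2_meas (cL2 p).
by apply: filterS ae0 => z hz; rewrite -[LHS]/(W z - weight z * cutoff _ z) hz subrr.
Qed.

Lemma ae_cutoff_bracketE : {ae leb2, forall z, D z ->
  W z = optimal_dsft b0 nu0 g h eta z * weight z}.
Proof.
apply: filterS3 ae_weight_bounds (ae_L2_fiber b0_gt0 nu0_gt0 phi_bij eta_L2)
  (ae_L2_fiber b0_gt0 nu0_gt0 phi_bij L2_stft) => z hU he hV Dz.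
have U0 : 0 < fine (U z) by apply: lt_le_trans A_gt0 _; case: (hU Dz).
rewrite weight_in// cutoff_in// /optimal_dsft divfK; last by apply: realC_neq0; rewrite gt_eqF.
have ji := inner_cintegrable (he Dz) (hV Dz).
pose k p := conjc (V (dual_shift b0 nu0 z p)) * eta (dual_shift b0 nu0 z p).
have jk : cintegrable count (fun n => k (phi n)).
  by move: ji; congr cintegrable; apply/funext => n; rewrite mulrC.
rewrite [RHS](csum_psum phi_bij jk); apply: eq_cint => n.
by rewrite mulrC.
Qed.

Lemma weighted_eq_dsft m : ell2 m ->
  {ae leb2, forall z, W z = weight z * cutoff (dsft m) z} <->
  {ae leb2, forall z, dsft m z = optimal_dsft b0 nu0 g h eta z}.
Proof.
move=> m2; have [mX pX eX] := dsft_spec b0_gt0 nu0_gt0 m2.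
split=> hae.
  apply: (ae_periodic_eq b0_gt0 nu0_gt0 pX (optimal_dsft_periodic _ _ _ _ _)).
  apply: filterS3 hae ae_weight_bounds ae_cutoff_bracketE => z h1 h2 h3 Dz.
  have w0 : weight z != 0.
    rewrite weight_in//; apply: realC_neq0; rewrite gt_eqF//; apply: lt_le_trans A_gt0 _.
    by case: (h2 Dz).
  apply: (mulfI w0); rewrite -{1}(cutoff_in (dsft m) Dz) -h1 (h3 Dz).
  by rewrite mulrC.
apply: filterS2 hae ae_cutoff_bracketE => z h1 h2.
have [Dz|Dz] := pselect (D z); last by rewrite !cutoff_out// mulr0.
by rewrite (h2 Dz) (cutoff_in (dsft m) Dz) h1 mulrC.
Qed.

(** The quotient of the two brackets is square integrable because the weight is at
    least [A]; its Fourier coefficients are the multiplier. *)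
Lemma optimal_exists : exists2 m, ell2 m &
  {ae leb2, forall z, W z = weight z * cutoff (dsft m) z}.
Proof.
(* the inverse of the weight, made monotone, hence measurable, and bounded by
   taking the maximum with A *)
pose r (x : R) := (Num.max A x)^-1.
have mr : @measurable_fun _ _ L L setT r.
  apply: nonincreasing_measurable => // x y xy.
  have mA t : 0 < Num.max A t by rewrite lt_max A_gt0.
  by rewrite /r lef_pV2 ?posrE ?mA// ge_max le_max lexx /= le_max xy orbT.
pose f z := W z * (r (complex.Re (weight z)))%:C.
have jf : L2 leb2 f.
  apply: (L2Mbounded (c := A^-1)) => //.
  - by apply: cmeasurable_real; exact: measurableT_comp mr cmeasurable_weight.1.
  - move=> z; rewrite modR ger0_norm /r; last by rewrite invr_ge0 le_max (ltW A_gt0).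
    by rewrite lef_pV2 ?posrE// ?lt_max ?A_gt0// le_max lexx.
have f_supp z : ~ D z -> f z = 0 by move=> Dz; rewrite /f cutoff_out// mul0r.
have wf : {ae leb2, forall z, W z = weight z * f z}.
  apply: filterS ae_weight_bounds => z hz.
  have [Dz|Dz] := pselect (D z); last by rewrite f_supp// cutoff_out// mulr0.
  have [h1 h2] := hz Dz; have U0 : 0 < fine (U z) by apply: lt_le_trans A_gt0 _.
  rewrite /f weight_in// /r /= (max_idPr h1) mulrCA -rmorphM divff ?mulr1//.
  by rewrite gt_eqF.
have f_exp := orthogonal_expansion cL2 v0_gt0 (cellexp_orth b0_gt0 nu0_gt0)
  (measurable_cell b0 nu0) (@cellexp_supp _ b0 nu0) (cellexp_total b0_gt0 nu0_gt0) jf f_supp.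
have m2 := l2_fourier cL2 v0_gt0 (cellexp_orth b0_gt0 nu0_gt0) jf.
exists (fun p => inner leb2 f (cellexp p) / (nu0^-1 * b0^-1)%:C) => //.
set m := fun p => _ in m2 *; have [mX pX eX] := dsft_spec b0_gt0 nu0_gt0 m2.
have jm p : L2 leb2 (fun z => m p * cellexp p z) by exact: L2Z.
have fX := sums_to_L2_unique jm jf eX.1 f_exp eX.2.
by apply: filterS2 wf fX => z -> ->.
Qed.

Lemma optimal_unique m m' : ell2 m -> ell2 m' ->
  {ae leb2, forall z, W z = weight z * cutoff (dsft m) z} ->
  {ae leb2, forall z, W z = weight z * cutoff (dsft m') z} -> m = m'.
Proof.
move=> m2 m2' hm hm'; have [_ _ eX] := dsft_spec b0_gt0 nu0_gt0 m2.
have [_ _ eX'] := dsft_spec b0_gt0 nu0_gt0 m2'.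
have XX' : {ae leb2, forall z, cutoff (dsft m) z = cutoff (dsft m') z}.
  apply: filterS3 hm hm' ae_weight_bounds => z h1 h2 hz.
  have [Dz|Dz] := pselect (D z); last by rewrite !cutoff_out.
  have w0 : weight z != 0.
    rewrite weight_in//; apply: realC_neq0; rewrite gt_eqF//; apply: lt_le_trans A_gt0 _.
    by case: (hz Dz).
  by apply: (mulfI w0); rewrite -h1 -h2.
have v0 : (nu0^-1 * b0^-1)%:C != 0 :> R[i] by apply: realC_neq0; rewrite gt_eqF.
apply/funext => p; apply: (mulIf v0).
rewrite -(inner_orthogonal_expansion cL2 (cellexp_orth b0_gt0 nu0_gt0) p eX.1 eX.2).
rewrite -(inner_orthogonal_expansion cL2 (cellexp_orth b0_gt0 nu0_gt0) p eX'.1 eX'.2).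
by apply: inner_ae_eq => //; exact: L2_meas eX.1 || exact: L2_meas eX'.1 || exact: L2_meas (cL2 p).
Qed.

Variables (e : nat -> R -> R[i]) (H : (R -> R[i]) -> R -> R[i]).
Hypothesis e_basis : orthonormal_basis e.
Hypothesis H_L2 : forall f, L2 leb f -> L2 leb (H f).
Hypothesis H_kappa : integral_kernel H kappa.

Lemma best_normal_equations m : ell2 m ->
  best_gabor_approximation b0 nu0 e g h H m <->
  {ae leb2, forall z, W z = weight z * cutoff (dsft m) z}.
Proof.
move=> m2; have [s es] := kernel_expands m2; rewrite -(residual_orth m2 es).
rewrite -(normal_equations K_L2 kappa_L2 m2 es).
have norm_le F G : L2 leb2 F -> L2 leb2 G ->
    (L2norm leb2 F <= L2norm leb2 G)%E <-> sqn leb2 F <= sqn leb2 G.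
  move=> jF jG; rewrite !L2normE (L2_fin jF) (L2_fin jG) !poweR_EFin lee_fin.
  split; last by apply: ge0_ler_powR; rewrite ?nnegrE ?sqn_ge0 ?invr_ge0.
  apply: contraTT; rewrite -!ltNge; apply: gt0_ltr_powR; rewrite ?nnegrE ?sqn_ge0 ?invr_gt0//.
have HSE m' s' (es' : expands leb2 K m' s') := HSnorm_residual g_L2 h_L2 e_basis H_L2 H_kappa es'.
split=> [[_ best] m' s' m2' es'|best].
  apply/norm_le; [exact: L2B kappa_L2 es.1|exact: L2B kappa_L2 es'.1|].
  by rewrite -(HSE _ _ es) -(HSE _ _ es'); exact: best.
split=> // m' m2'; have [s' es'] := kernel_expands m2'.
rewrite (HSE _ _ es) (HSE _ _ es'); apply/norm_le; last exact: best es'.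
- exact: L2B kappa_L2 es.1.
- exact: L2B kappa_L2 es'.1.
Qed.

End BestApproximation.

Theorem theorem2 (R : realType)
    (phi : R -> R[i]) (phi_schwartz : schwartz phi) (phi_neq0 : phi <> 0)
    (e : nat -> R -> R[i]) (e_basis : orthonormal_basis e)
    (g h : R -> R[i]) (gS0 : S0 phi g) (hS0 : S0 phi h)
    (gh1 : inner leb g h = 1)
    (b0 nu0 : R) (b0_gt0 : 0 < b0) (nu0_gt0 : 0 < nu0)
    (A B : R) (A_gt0 : 0 < A) (AB : A <= B)
    (U_bounds : {ae leb2, forall z, cell b0 nu0 z ->
       (A%:E <= periodized_sqr b0 nu0 g h z)%E /\
       (periodized_sqr b0 nu0 g h z <= B%:E)%E})
    (H : (R -> R[i]) -> (R -> R[i])) (H_HS : hilbert_schmidt e H)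
    (eta : R * R -> R[i]) (eta_H : spreading_function H eta) :
  (exists! m : int * int -> R[i], best_gabor_approximation b0 nu0 e g h H m) /\
  (forall m : int * int -> R[i], ell2 m ->
     (best_gabor_approximation b0 nu0 e g h H m <->
      {ae leb2, forall z, dsft b0 nu0 m z = optimal_dsft b0 nu0 g h eta z})).
Proof.
have [psi psi_bij] := nat_enum_int2.
have [g_L2 h_L2] := (gS0.1, hS0.1).
have H_L2 : forall f, L2 leb f -> L2 leb (H f) by case: H_HS => -[].
have [eta_L2 [kappa H_kappa spr_kappa]] := eta_H.
have best m (m2 : ell2 m) := best_normal_equations b0_gt0 nu0_gt0 psi_bij g_L2 h_L2
  A_gt0 AB U_bounds H_kappa.1 eta_L2 spr_kappa e_basis H_L2 H_kappa m2.
split=> [|m m2]; last first.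
  apply: iff_trans (best m m2) _.
  exact: (weighted_eq_dsft b0_gt0 nu0_gt0 psi_bij g_L2 h_L2 A_gt0 U_bounds eta_L2 m2).
have [m m2 hm] := optimal_exists b0_gt0 nu0_gt0 psi_bij g_L2 h_L2 A_gt0 AB U_bounds eta_L2.
exists m; split; first exact/best.
move=> m' hm'; have m2' := hm'.1; move/(best _ m2'): hm'.
exact: (optimal_unique b0_gt0 nu0_gt0 psi_bij A_gt0 U_bounds m2 m2' hm).
Qed.
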